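(* Consider Problem B and its discretization with exact integration, Problem $B^N(J)$ (both defined in the context). Suppose Problem B has an optimal solution $(x^\ast(t),u^\ast(t))$ in which the strong derivative $(x_r^\ast(t))^{(m)}$ has bounded variation for some integer $m\ge2$. In Problem $B^N(J)$ select an integer $m_1$ so that $1\le m_1\le m-1$. Suppose $f(\cdot)$, $g(\cdot)$ and $F(\cdot)$ are $C^m$. Suppose all other bounds in Problem $B^N(J)$ (namely $\underline{b},\bar b,\underline{b}_j,\bar b_j,d$) are large enough in the sense of the context. Let $\{(\bar x^{\ast N},\bar u^{\ast N})\}_{N\ge N_1}$, with $N_1>r+m_1+1$, be any sequence in which $(\bar x^{\ast N},\bar u^{\ast N})$ is an optimal solution of Problem $B^N(J)$, with interpolation $(x^{\ast N}(t),u^{\ast N}(t))$. Then there is a constant $M_1$ independent of $N$ such that for all $N\ge N_1$ $$\left|J(x^\ast(\cdot),u^\ast(\cdot))-J(x^{\ast N}(\cdot),u^{\ast N}(\cdot))\right|\le\frac{M_1}{(N-r-m_1-1)^{2m-2m_1-1}}.$$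
   Context: Derivatives are weak derivatives unless ''strong'' is specified. **Problem B.** Determine the state-control function pair $(x(t),u(t))$, $x\in\mathbb{R}^r$, $u\in\mathbb{R}$, $t\in[-1,1]$, minimizing $$J(x(\cdot),u(\cdot))=\int_{-1}^1F(x(t),u(t))\,dt+E(x(-1),x(1))$$ subject to $\dot x_1=x_2,\ \dots,\ \dot x_{r-1}=x_r,\ \dot x_r=f(x)+g(x)u$, and $x(-1)=x_0$. Here $F:\mathbb{R}^r\times\mathbb{R}\to\mathbb{R}$, $E:\mathbb{R}^r\times\mathbb{R}^r\to\mathbb{R}$, $f,g:\mathbb{R}^r\to\mathbb{R}$ are Lipschitz continuous in their arguments and $g(x)\ne0$ for all $x$. **LGL nodes, weights, differentiation matrix.** $L_N$ is the Legendre polynomial of degree $N$. The nodes are $t_0=-1$, $t_N=1$, and $t_1<\dots<t_{N-1}$ the roots of $\dot L_N$. The weights are $w_k=\frac{2}{N(N+1)}\frac{1}{L_N(t_k)^2}$. $D$ is the $(N+1)\times(N+1)$ matrix with entries $D_{ik}=\frac{L_N(t_i)}{L_N(t_k)}\frac{1}{t_i-t_k}$ for $i\neq k$, $D_{00}=-\frac{N(N+1)}4$, $D_{NN}=\frac{N(N+1)}4$, and $0$ otherwise; it maps the nodal values of a polynomial of degree $\le N$ to the nodal values of its derivative. **Discrete variables and interpolation.** $\bar x^{Nk}=(\bar x_1^{Nk},\dots,\bar x_r^{Nk})^T\in\mathbb{R}^r$, $\bar u^{Nk}\in\mathbb{R}$, $k=0,\dots,N$; $\bar x_i^N=[\bar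 x_i^{N0}\ \cdots\ \bar x_i^{NN}]$ (row vector). The interpolation of $(\bar x^N,\bar u^N)$ is the pair $(x^N(t),u^N(t))$ where $x_i^N(t)$ is the polynomial of degree $\le N$ with $x_i^N(t_k)=\bar x_i^{Nk}$ for all $k$, and $u^N(t)=\frac{\dot x_r^N(t)-f(x^N(t))}{g(x^N(t))}$. **Spectral coefficients.** For an integer $m_1\ge1$ and $0\le n\le N-r-m_1+1$, $$a_n^N(m_1)=\left(n+\tfrac12\right)\sum_{k=0}^N L_n(t_k)\,w_k\,\left(D^{m_1}(\bar x_r^N)^T\right)_k .$$ These are the Legendre coefficients of the polynomial interpolating $\bar x_r^N(D^T)^{m_1}$ (entries of vectors indexed $0,\dots,N$). **Problem $B^N(J)$.** Find $\bar x^{Nk}\in\mathbb{R}^r$, $\bar u^{Nk}\in\mathbb{R}$, $k=0,\dots,N$, minimizing the exact cost of the interpolation $(x^N(t),u^N(t))$ of $(\bar x^N,\bar u^N)$, $$J(x^N(\cdot),u^N(\cdot))=\int_{-1}^1F(x^N(t),u^N(t))\,dt+E(x^N(-1),x^N(1)),$$ subject to: (1) $D(\bar x_i^N)^T=(\bar x_{i+1}^N)^T$ for $1\le i\le r-1$, and $(D(\bar x_r^N)^T)_k=f(\bar x^{Nk})+g(\bar x^{Nk})\bar u^{Nk}$ for $0\le k\le N$; (2) $\bar x^{N0}=x_0$; (3) $\underline b\le(\bar x^{Nk},\bar u^{Nk})\le\bar b$ componentwise for $0\le k\le N$; (4) $\underline b_j\le[1\ 0\ \cdots\ 0]D^j(\bar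 x_r^N)^T\le\bar b_j$ for $1\le j\le m_1-1$; (5) $\sum_{n=0}^{N-r-m_1+1}|a_n^N(m_1)|\le d$. Here $\underline b,\bar b\in\mathbb{R}^{r+1}$ and $\underline b_j,\bar b_j,d\in\mathbb{R}$ are fixed, independent of $N$. **''Bounds large enough''.** There are thresholds, depending on Problem B, $(x^\ast,u^\ast)$, $m$ and $m_1$ but not on $N$, such that the assertion holds whenever $\bar b,\bar b_j,d$ lie (componentwise) above and $\underline b,\underline b_j$ below the corresponding thresholds. In particular, the optimal trajectory $(x^\ast(t),u^\ast(t))$ lies in the interior of the box $[\underline b,\bar b]$, $(x_r^\ast(t))^{(j)}$ lies in the interior of $[\underline b_j,\bar b_j]$, and $d>\frac6{\sqrt\pi}\left(U((x_r^\ast)^{(m_1+1)})+V((x_r^\ast)^{(m_1+1)})\right)\zeta(3/2)$, where $U(h)$ is an upper bound of $|h|$, $V(h)$ the total variation of $h$ on $[-1,1]$, and $\zeta(s)=\sum_{k\ge1}k^{-s}$. *)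

(* Defs.v *)
From mathcomp Require Import all_boot all_order all_algebra polyrcf.
From mathcomp Require Import all_classical all_reals all_analysis.

Set Implicit Arguments.
Unset Strict Implicit.
Unset Printing Implicit Defensive.

Import Order.TTheory GRing.Theory Num.Theory.
Import numFieldNormedType.Exports.

Local Open Scope classical_set_scope.
Local Open Scope ring_scope.

(* The state dimension r >= 1 is written q.+1, so that x_1, ..., x_r are the
   components 0, ..., q, and x_r is the component ord_max. *)

Section Calculus.
Variable R : realType.

Definition tdom : set R := `[-1, 1].

(* h is the strong (classical) derivative of y on the closed interval tdom; it is
   one-sided at the endpoints, and values outside tdom are irrelevant. *)
Definition strong_derivative (y h : R -> R) : Prop :=
  forall t, tdom t -> (y s - y t) / (s - t) @[s --> within tdom t^'] --> h t.

(* ys j is the j-th strong derivative of y on tdom for j <= m. *)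
Definition strong_derivatives (m : nat) (y : R -> R) (ys : nat -> R -> R) :=
  {in tdom, ys 0%N =1 y} /\
  forall j, (j < m)%N -> strong_derivative (ys j) (ys j.+1).

Definition test_function (phi : R -> R) : Prop :=
  (forall n t, derivable (derive1n n phi) t 1) /\
  exists a b, [/\ -1 < a, b < 1 & forall t, t \notin `[a, b] -> phi t = 0].

Definition integrable_tdom (h : R -> R) : Prop :=
  lebesgue_measure.-integrable tdom (EFin \o h).

Definition weak_derivative (y h : R -> R) : Prop :=
  [/\ integrable_tdom y, integrable_tdom h &
      forall phi, test_function phi ->
        \int[lebesgue_measure]_(t in tdom) (y t * derive1 phi t) =
        - \int[lebesgue_measure]_(t in tdom) (h t * phi t)].

(* f is of class C^k; in finite dimension, asking for the directional
   derivatives in all directions is the same as asking for partial derivatives. *)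
Fixpoint Ck (k : nat) (V : normedModType R) (f : V -> R) : Prop :=
  continuous f /\
  if k is k'.+1 then
    forall v, (forall x, derivable f x v) /\ Ck k' (fun x => 'D_v f x)
  else True.

Definition zeta (s : R) : R :=
  limn (series (fun k => (k.+1%:R : R) `^ (- s))).

End Calculus.

Arguments tdom {R}.

Section ContinuousProblem.
Variables (R : realType) (q : nat).

Record problemB := ProblemB {
  runcost : 'rV[R]_q.+1 * R -> R;              (* F *)
  endcost : 'rV[R]_q.+1 * 'rV[R]_q.+1 -> R;    (* E *)
  drift   : 'rV[R]_q.+1 -> R;                  (* f *)
  gain    : 'rV[R]_q.+1 -> R;                  (* g *)
  init    : 'rV[R]_q.+1                        (* x_0 *)
}.

Definition problemB_wf (P : problemB) : Prop :=
  [/\ lipschitz (runcost P), lipschitz (endcost P), lipschitz (drift P),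
      lipschitz (gain P) & forall x, gain P x != 0].

Definition cost (P : problemB) (x : R -> 'rV[R]_q.+1) (u : R -> R) : R :=
  \int[lebesgue_measure]_(t in tdom) runcost P (x t, u t)
  + endcost P (x (-1), x 1).

(* x is the continuous representative, so that x(-1) and x(1) make sense; the
   running cost is then integrable, F being Lipschitz. *)
Definition admissible (P : problemB) (x : R -> 'rV[R]_q.+1) (u : R -> R) :=
  [/\ {within tdom, continuous x},
      integrable_tdom u,
      forall i j : 'I_q.+1, j = i.+1 :> nat ->
        weak_derivative (fun t => x t 0 i) (fun t => x t 0 j),
      weak_derivative (fun t => x t 0 ord_max)
                      (fun t => drift P (x t) + gain P (x t) * u t) &
      x (-1) = init P].

Definition optimalB (P : problemB) (x : R -> 'rV[R]_q.+1) (u : R -> R) :=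
  admissible P x u /\
  forall x' u', admissible P x' u' -> cost P x u <= cost P x' u'.

End ContinuousProblem.

Section LGL.
Variables (R : realType) (N : nat).

(* Legendre polynomials, by the Rodrigues formula. *)
Definition legendre (n : nat) : {poly R} :=
  ((2 ^ n * n`!)%:R)^-1 *: (('X^2 - 1) ^+ n)^`(n).

(* rootsR lists the real roots in increasing order; the derivative of L_N has
   N - 1 of them, all in (-1, 1). *)
Definition node (k : 'I_N.+1) : R :=
  nth 0 (-1 :: rcons (rootsR (legendre N)^`()) 1) k.

Definition weight (k : 'I_N.+1) : R :=
  2 / (N%:R * N.+1%:R) * ((legendre N).[node k] ^+ 2)^-1.

Definition lgl_diffmx : 'M[R]_N.+1 :=
  \matrix_(i, k)
    if i != k then
      (legendre N).[node i] / (legendre N).[node k] / (node i - node k)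
    else if i == ord0 then - (N%:R * N.+1%:R / 4)
    else if i == ord_max then N%:R * N.+1%:R / 4
    else 0.

(* The polynomial of degree <= N with nodal values v. *)
Definition interp (v : 'cV[R]_N.+1) : {poly R} :=
  xget 0 [set p : {poly R} |
    (size p <= N.+1)%N /\ forall k, p.[node k] = v k 0].

(* The coefficient a_n^N(m1), v being the column of nodal values of x_r. *)
Definition spectral_coef (m1 n : nat) (v : 'cV[R]_N.+1) : R :=
  (n%:R + 2^-1) *
  \sum_k (legendre n).[node k] * weight k * (lgl_diffmx ^+ m1 *m v) k 0.

End LGL.

Section DiscreteProblem.
Variables (R : realType) (q : nat).

(* Bounds on the pair (x, u), on the derivatives of x_r at -1, and on the sum
   of the spectral coefficients. *)
Record bounds := Bounds {
  blo : 'rV[R]_(q.+1 + 1);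
  bhi : 'rV[R]_(q.+1 + 1);
  dlo : nat -> R;
  dhi : nat -> R;
  dsum : R
}.

(* Bounds which are strictly larger than the thresholds T. *)
Definition beyond (m1 : nat) (T b : bounds) : Prop :=
  [/\ forall i, blo b 0 i < blo T 0 i /\ bhi T 0 i < bhi b 0 i,
      forall j, (1 <= j <= m1 - 1)%N -> dlo b j < dlo T j /\ dhi T j < dhi b j &
      dsum T < dsum b].

(* The trajectory (x, u) is interior to the bounds b; xr j is the j-th strong
   derivative of x_r. Weak derivatives determine u up to a null set only. *)
Definition interior_trajectory (m1 : nat) (b : bounds)
    (x : R -> 'rV[R]_q.+1) (u : R -> R) (xr : nat -> R -> R) : Prop :=
  [/\ forall t i, tdom t ->
        blo b 0 (lshift 1 i) < x t 0 i < bhi b 0 (lshift 1 i),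
      {ae lebesgue_measure, forall t, tdom t ->
        blo b 0 (rshift q.+1 0) < u t < bhi b 0 (rshift q.+1 0)},
      forall t j, tdom t -> (1 <= j <= m1 - 1)%N -> dlo b j < xr j t < dhi b j &
      exists U : R, (forall t, tdom t -> `|xr m1.+1 t| <= U) /\
        6 / Num.sqrt pi
          * (U + fine (total_variation (-1) 1 (xr m1.+1))) * zeta (3 / 2)
        < dsum b].

Variable N : nat.

(* Row k of X is the nodal state at node k. *)
Definition interp_state (X : 'M[R]_(N.+1, q.+1)) (t : R) : 'rV[R]_q.+1 :=
  \row_i (interp (col i X)).[t].

Definition interp_control (P : problemB R q) (X : 'M[R]_(N.+1, q.+1)) (t : R) :=
  ((interp (col ord_max X))^`().[t] - drift P (interp_state X t))
  / gain P (interp_state X t).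

Definition interp_cost (P : problemB R q) (X : 'M[R]_(N.+1, q.+1)) : R :=
  cost P (interp_state X) (interp_control P X).

Definition feasibleBN (P : problemB R q) (m1 : nat) (b : bounds)
    (X : 'M[R]_(N.+1, q.+1)) (U : 'cV[R]_N.+1) : Prop :=
  [/\ (forall i j : 'I_q.+1, j = i.+1 :> nat ->
         lgl_diffmx R N *m col i X = col j X) /\
      (forall k, (lgl_diffmx R N *m col ord_max X) k 0 =
         drift P (row k X) + gain P (row k X) * U k 0),
      row ord0 X = init P,
      forall k i, blo b 0 i <= row_mx X U k i <= bhi b 0 i,
      forall j, (1 <= j <= m1 - 1)%N ->
        dlo b j <= (lgl_diffmx R N ^+ j *m col ord_max X) ord0 0 <= dhi b j &
      \sum_(0 <= n < (N - q.+1 - m1 + 1).+1)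
         `|spectral_coef m1 n (col ord_max X)| <= dsum b].

Definition optimalBN (P : problemB R q) (m1 : nat) (b : bounds)
    (X : 'M[R]_(N.+1, q.+1)) (U : 'cV[R]_N.+1) : Prop :=
  feasibleBN P m1 b X U /\
  forall X' U', feasibleBN P m1 b X' U' -> interp_cost P X <= interp_cost P X'.

End DiscreteProblem.

(* Main.v *)
Require Import Defs.
From mathcomp Require Import all_boot all_order all_algebra polyrcf.
From mathcomp Require Import all_classical all_reals all_analysis measurable_realfun ring lra zify.
Import Order.TTheory GRing.Theory Num.Theory.
Import numFieldNormedType.Exports.
Local Open Scope classical_set_scope.
Local Open Scope ring_scope.

Set Implicit Arguments.
Unset Strict Implicit.
Unset Printing Implicit Defensive.

(** A feasible point of the discrete problem never costs less than the optimum of the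
continuous one. The differentiation matrix is exact on polynomials of degree at most [N], so
the nodal equations of motion are identities between polynomials ([feasible_trajectory]);
the interpolation is therefore admissible in the continuous problem. What remains is to
exhibit a feasible point whose cost exceeds the optimum by little.

The competitor is obtained from the Legendre expansion of the derivative of order [m1] of the
last component of the optimal state: truncate it at degree [K = N - q.+1 - m1 + 1] and
integrate it up to [m1 + q] times, with the initial values of the optimal state
([approximant]). The truncation error is orthogonal to the polynomials of degree at most [K],
so its first [K + 1] iterated primitives vanish at 1 as well as at -1 ([approximant_orth]):
for [N] large both endpoints of the trajectory are exact, and the end costs agree. As the
quadrature is exact up to degree [2 N - 1], the spectral coefficients of the competitor are
Legendre coefficients of a fixed function, so their sum is bounded; the other constraints hold
because the competitor is uniformly close to the optimal trajectory
([approximating_polynomials]).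

The error is measured with [s = m - m1]. Each derivative gains a factor [1 / n] for the
[n]-th Legendre coefficient ([moment_recurrence]). The last one, of bounded variation, gains
[n ^ (- 3/2)], because the primitive of [L_n] vanishing at the endpoints is of that order, by
Sonin's argument ([legendre_deriv_bound]). With the normalizing factor [n + 1/2], the
coefficients are [O(n ^ (- s - 1/2))], and the error [eps] of the truncation is
[O(K ^ (1/2 - s))] ([legendre_sum_approx]).

The exponent [2 s - 1] of the theorem is that of [eps ^ 2]: near an optimum the excess cost is
quadratic. Indeed the reflection of the competitor in the optimal trajectory is admissible
too, hence costs at least the optimum, while the second difference of the cost, the sum of the
costs of the competitor and of its reflection minus twice the optimum, is [O(eps ^ 2)], as the
running cost and the equations of motion are of class C^2 ([cost_perturbation]). The control
is a quotient, not an affine function of the trajectory, which costs another term of second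
order ([runcost_second_difference]).

The optimal trajectory satisfies the equations of motion weakly. Its components are
continuous, so these weak derivatives are strong ([weak_strong_derivative]), and the control
is determined almost everywhere by the trajectory ([weak_derivative_unique]). *)

(** * Integrals of polynomials *)

Section PolynomialIntegral.
Variable R : realType.
Implicit Types p q : {poly R}.

(** The coefficient of degree 0 is [p`_0 / 0], that is 0. *)
Definition prim p : {poly R} := \poly_(i < (size p).+1) (p`_i.-1 / i%:R).

Lemma deriv_prim p : (prim p)^`() = p.
Proof.
apply/polyP => i; rewrite coef_deriv coef_poly /= ltnS.
case: ltnP => [_|h]; last by rewrite mul0rn nth_default.
by rewrite -[LHS]mulr_natr divfK ?pnatr_eq0.
Qed.

Lemma size_prim p : (size (prim p) <= (size p).+1)%N.
Proof. exact: size_poly. Qed.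

Lemma deriv_eq0 p : p^`() = 0 -> p = p.[0]%:P.
Proof.
move=> h; apply/polyP => -[|i]; rewrite coefC /= ?horner_coef0 //.
have /eqP := congr1 (fun q : {poly R} => q`_i) h.
by rewrite coef_deriv coef0 mulrn_eq0 /= => /eqP.
Qed.

Definition pint p : R := (prim p).[1] - (prim p).[-1].

Lemma pint_deriv q : pint q^`() = q.[1] - q.[-1].
Proof.
have /deriv_eq0 h : (prim q^`() - q)^`() = 0 by rewrite derivB deriv_prim subrr.
have e : prim q^`() = q + ((prim q^`() - q).[0])%:P by rewrite -h addrC subrK.
by rewrite /pint e !hornerD !hornerC; ring.
Qed.

Lemma pintE p q : q^`() = p -> pint p = q.[1] - q.[-1].
Proof. by move=> <-; exact: pint_deriv. Qed.

Lemma pintD p q : pint (p + q) = pint p + pint q.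
Proof.
by rewrite (@pintE _ (prim p + prim q)) ?derivD ?deriv_prim // !hornerD /pint; ring.
Qed.

Lemma pintZ c p : pint (c *: p) = c * pint p.
Proof.
by rewrite (@pintE _ (c *: prim p)) ?derivZ ?deriv_prim // !hornerZ /pint; ring.
Qed.

Lemma pint0 : pint 0 = 0.
Proof. by rewrite -(scale0r 0) pintZ mul0r. Qed.

Lemma pintN p : pint (- p) = - pint p.
Proof. by rewrite -scaleN1r pintZ mulN1r. Qed.

Lemma pintB p q : pint (p - q) = pint p - pint q.
Proof. by rewrite pintD pintN. Qed.

Lemma pint_sum (I : Type) (r : seq I) (P : pred I) (F : I -> {poly R}) :
  pint (\sum_(i <- r | P i) F i) = \sum_(i <- r | P i) pint (F i).
Proof. by apply: (big_morph pint pintD); exact: pint0. Qed.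

Lemma le_pint p q : (forall t, -1 <= t <= 1 -> p.[t] <= q.[t]) ->
  pint p <= pint q.
Proof.
move=> h; rewrite -subr_ge0 -pintB /pint subr_ge0.
have := @ler_hornerW R (-1) 1 (prim (q - p)); apply.
- move=> t; rewrite in_itv /= => /andP[h1 h2].
  by rewrite deriv_prim hornerD hornerN subr_ge0 h // !ltW.
- by rewrite in_itv /= lexx; lra.
- by rewrite in_itv /= lexx; lra.
- lra.
Qed.

Lemma horner_natr n (t : R) : (n%:R : {poly R}).[t] = n%:R.
Proof. by rewrite -polyC_natr hornerC. Qed.

End PolynomialIntegral.

(* Unlike [hornerE], these rules keep products in the order in which they were
   written and never unfold a polynomial. *)
Definition horner_ringE := (hornerD, hornerN, hornerM, hornerZ, hornerXn, hornerX,
  hornerC, horner_natr).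

(** * Legendre polynomials *)

Section Legendre.
Variable R : realType.
Implicit Types p q : {poly R}.
Local Notation L := (legendre R).
Local Notation w := ('X^2 - 1 : {poly R}).

Lemma derivn_mulX p k :
  ('X * p)^`(k.+1) = 'X * p^`(k.+1) + k.+1%:R * p^`(k).
Proof.
elim: k => [|k ih]; first by rewrite !derivn1 derivn0 derivM derivX; ring.
rewrite derivnS ih derivD !derivM derivX -!derivnS.
have -> : (k.+1%:R : {poly R})^`() = 0 by rewrite -polyC_natr derivC.
ring.
Qed.

Lemma deriv_natr n : (n%:R : {poly R})^`() = 0.
Proof. by rewrite -polyC_natr derivC. Qed.

Lemma derivn_natl n p k : (n%:R * p)^`(k) = n%:R * p^`(k).
Proof. by rewrite !mulr_natl derivnMn. Qed.

Lemma derivn_mulX2 p k :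
  ('X * ('X * p))^`(k.+2) = 'X * ('X * p^`(k.+2))
    + 2 * k.+2%:R * ('X * p^`(k.+1)) + k.+2%:R * k.+1%:R * p^`(k).
Proof. rewrite !derivn_mulX; ring. Qed.

Lemma deriv_w n : (w ^+ n.+1)^`() = 2 * n.+1%:R * 'X * w ^+ n.
Proof.
rewrite deriv_exp derivB derivXn -(polyC1 R) derivC subr0 polyC1 expr1 /=.
by rewrite -[RHS]mulrA -mulr_natl; ring.
Qed.

(** [W0 = (X^2 - 1)^n] satisfies [(X^2 - 1) W0' = 2 n X W0]; by Leibniz' rule, differentiating
    this [n + 1] times gives a second order equation for the [n]-th derivative of [W0]. *)
Lemma rodrigues_ode n :
  let W := (w ^+ n)^`(n) in
  w * W^`()^`() + 2 * 'X * W^`() - n%:R * n.+1%:R * W = 0.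
Proof.
case: n => [|n] W.
  by rewrite /W expr0 derivn0 -(polyC1 R) derivC linear0; ring.
have e : w * (w ^+ n.+1)^`() = 2 * n.+1%:R * 'X * w ^+ n.+1.
  by rewrite deriv_w (exprS _ n); ring.
have := congr1 (fun q : {poly R} => q^`(n.+2)) e.
have -> : w * (w ^+ n.+1)^`() = 'X * ('X * (w ^+ n.+1)^`()) - (w ^+ n.+1)^`().
  ring.
have -> : 2 * n.+1%:R * 'X * w ^+ n.+1 = (2 * n.+1)%:R * ('X * w ^+ n.+1).
  by rewrite natrM; ring.
rewrite derivnB derivn_mulX2 derivn_natl derivn_mulX -!derivSn.
rewrite [_^`(n.+3)]derivnS [_^`(n.+2)]derivnS -/W => h.
rewrite -[RHS](subrr (2 * n.+1%:R * ('X * W^`() + n.+2%:R * W))).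
rewrite natrM in h; rewrite -{1}h.
ring.
Qed.

Definition lcst n : R := ((2 ^ n * n`!)%:R)^-1.

Lemma lcst_neq0 n : lcst n != 0.
Proof. by rewrite invr_eq0 pnatr_eq0 muln_eq0 expn_eq0 -lt0n fact_gt0. Qed.

Lemma lcst_aux n : 2 ^+ n * n`!%:R != 0 :> R.
Proof. by rewrite mulf_neq0 ?expf_neq0 ?pnatr_eq0 // -lt0n fact_gt0. Qed.

Lemma legendreE n : L n = lcst n *: (w ^+ n)^`(n). Proof. by []. Qed.

(** Legendre's equation in self-adjoint form. Orthogonality, the norms, the bounds on [L n]
    and the role of its derivative in the quadrature are all read off from it. *)
Lemma legendre_ode n :
  ((1 - 'X^2) * (L n)^`())^`() = - (n%:R * n.+1%:R) *: L n.
Proof.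
have := rodrigues_ode n; rewrite legendreE; set W := (_ ^`(n)) => /= h.
have h' : n%:R * n.+1%:R * W = w * W^`()^`() + 2 * 'X * W^`().
  by apply/eqP; rewrite eq_sym -subr_eq0 h.
rewrite derivZ scaleNr scalerA mulrC -scalerA -scalerN.
rewrite -scalerAl derivZ scalerN scalerA [X in - (X *: _)]mulrC -scalerA -scalerN; congr (_ *: _).
rewrite -natrM -mul_polyC polyC_natr natrM h' derivM derivB derivXn -(polyC1 R) derivC polyC1.
by rewrite /= expr1 -mulr_natl; ring.
Qed.

(** At [a], only the term of Leibniz' formula in which all derivatives hit the power
    survives. *)
Lemma deriv_n_XsubC_exp (a : R) n q :
  ((('X - a%:P) ^+ n * q)^`(n)).[a] = n`!%:R * q.[a].
Proof.
elim: n q => [|n ih] q; first by rewrite derivn0 expr0 mul1r mul1r.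
rewrite derivSn.
have -> : ((('X - a%:P) ^+ n.+1) * q)^`()
    = ('X - a%:P) ^+ n * (n.+1%:R * q + ('X - a%:P) * q^`()).
  by rewrite derivM deriv_exp derivXsubC mul1r /= exprS -mulr_natl; ring.
rewrite ih !hornerE subrr mul0r addr0 -polyC_natr hornerC factS natrM.
ring.
Qed.

Lemma legendre_1 n : (L n).[1] = 1.
Proof.
rewrite legendreE hornerZ.
have -> : w = ('X - 1%:P) * ('X + 1) by rewrite polyC1; ring.
rewrite exprMn deriv_n_XsubC_exp /lcst horner_exp.
have -> : ('X + 1 : {poly R}).[1] = 2 by rewrite !hornerE.
by rewrite natrM natrX [X in _ * X]mulrC mulVf ?lcst_aux.
Qed.

Lemma legendre_N1 n : (L n).[-1] = (-1) ^+ n.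
Proof.
rewrite legendreE hornerZ.
have -> : w = ('X - (-1)%:P) * ('X - 1) by rewrite polyCN polyC1; ring.
rewrite exprMn deriv_n_XsubC_exp /lcst horner_exp.
have -> : ('X - 1 : {poly R}).[-1] = (-1) * 2 by rewrite !hornerE; ring.
rewrite exprMn natrM natrX.
rewrite [X in _ * X](_ : _ = (2 ^+ n * n`!%:R) * (-1) ^+ n) ?mulKf ?lcst_aux //.
by rewrite mulrCA mulrC [X in X * _]mulrC.
Qed.

Lemma size_w n : size (w ^+ n) = n.*2.+1.
Proof.
have mw : w \is monic by exact: monicXnsubC.
by rewrite -[LHS]prednK ?size_poly_gt0 ?monic_neq0 ?monic_exp // size_exp size_XnsubC //= mul2n.
Qed.

Lemma legendre_lead_coef n : (L n)`_n != 0.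
Proof.
rewrite legendreE coefZ mulf_neq0 ?lcst_neq0 // coef_derivn addnn.
rewrite mulrn_eq0 -(mulr1n 1) negb_or -lt0n ffact_gt0 -addnn leq_addr /=.
have /monicP : w ^+ n \is monic by rewrite monic_exp // monicXnsubC.
by rewrite /lead_coef size_w /= -addnn => ->; rewrite oner_eq0.
Qed.

Lemma size_legendre n : size (L n) = n.+1.
Proof.
apply/eqP; rewrite eqn_leq; apply/andP; split; last first.
  rewrite ltnNge; apply/negP => h.
  by have := legendre_lead_coef n; rewrite nth_default ?eqxx.
rewrite legendreE (leq_trans (size_scale_leq _ _)) //.
apply/leq_sizeP => j hj; rewrite coef_derivn nth_default ?mul0rn //.
by rewrite size_w -addnn -addnS leq_add2l.
Qed.

(** It turns an integral against [L n.+1] into a difference of integrals against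
    derivatives of Legendre polynomials, divided by [2 n + 3]: integration by parts then gains
    a factor [1 / n]. *)
Lemma legendre_recurrence n :
  (L n.+2)^`() = (2 * n.+1 + 1)%:R *: L n.+1 + (L n)^`().
Proof.
rewrite !legendreE !derivZ -!derivnS.
rewrite [_^`(n.+3)]derivSn [_^`()^`(_)]derivSn.
have -> : ((w ^+ n.+2)^`())^`() =
  (2 * n.+2)%:R * ((2 * n.+1 + 1)%:R * w ^+ n.+1 + (2 * n.+1)%:R * w ^+ n).
  rewrite deriv_w !derivM deriv_natr.
  by rewrite deriv_natr derivX deriv_w (exprS _ n) !(natrD, natrM); ring.
rewrite derivn_natl derivnD !derivn_natl.
have e1 : lcst n.+2 * (2 * n.+2)%:R = lcst n.+1.
  by rewrite /lcst expnS factS mulnACA natrM invfM mulrC mulVKf // pnatr_eq0.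
have e2 : lcst n.+1 * (2 * n.+1)%:R = lcst n.
  by rewrite /lcst expnS factS mulnACA natrM invfM mulrC mulVKf // pnatr_eq0.
rewrite -!(polyC_natr R) !mul_polyC scalerA e1 scalerDr !scalerA e2.
by rewrite [lcst _ * _]mulrC.
Qed.

Lemma one_subX2_1 p : ((1 - 'X^2) * p).[1] = 0.
Proof. by rewrite !hornerE; ring. Qed.
Lemma one_subX2_N1 p : ((1 - 'X^2) * p).[-1] = 0.
Proof. by rewrite !hornerE; ring. Qed.

(** The operator of Legendre's equation is symmetric, since [1 - X^2] vanishes at both ends of
    the interval, and its eigenvalues [n (n + 1)] are distinct. *)
Lemma legendre_orth n m : n != m -> pint (L n * L m) = 0.
Proof.
move=> nm.
pose A := (1 - 'X^2) * (L n)^`(); pose B := (1 - 'X^2) * (L m)^`().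
have hd : (A * L m - L n * B)^`()
   = (m%:R * m.+1%:R - n%:R * n.+1%:R) *: (L n * L m).
  have hA : A^`() = _ := legendre_ode n; have hB : B^`() = _ := legendre_ode m.
  rewrite derivB (derivM A) (derivM _ B) hA hB /A /B -!mul_polyC !polyCB !polyCN; ring.
have := pint_deriv (A * L m - L n * B); rewrite hd pintZ.
have [A1 A2] : A.[1] = 0 /\ A.[-1] = 0 by rewrite /A one_subX2_1 one_subX2_N1.
have [B1 B2] : B.[1] = 0 /\ B.[-1] = 0 by rewrite /B one_subX2_1 one_subX2_N1.
rewrite !hornerD !hornerN (hornerM A) (hornerM _ B) (hornerM A) (hornerM _ B) A1 A2 B1 B2.
rewrite !(mul0r, mulr0) !subr0 => /eqP; rewrite mulf_eq0 => /orP[|/eqP//].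
rewrite subr_eq0 -!natrM eqr_nat => /eqP h; exfalso; move/eqP: nm; nia.
Qed.

Lemma legendre_span n p : (size p <= n)%N ->
  exists c : nat -> R, p = \sum_(i < n) c i *: L i.
Proof.
elim: n p => [|n ih] p.
  by rewrite leqn0 size_poly_eq0 => /eqP ->; exists (fun=> 0); rewrite big_ord0.
move=> hp; pose a := p`_n / (L n)`_n.
have [|c hc] := ih (p - a *: L n).
  apply/leq_sizeP => j; rewrite leq_eqVlt => /orP[/eqP <-|hj].
    by rewrite coefB coefZ /a divfK ?subrr ?legendre_lead_coef.
  rewrite coefB coefZ !nth_default ?mulr0 ?subr0 ?size_legendre //.
  exact: leq_trans hp hj.
exists (fun i => if i == n then a else c i).
rewrite big_ord_recr /= eqxx -[LHS](subrK (a *: L n)) hc; congr (_ + _).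
by apply: eq_bigr => i _; rewrite (ltn_eqF (ltn_ord i)).
Qed.

Lemma legendre_orth_low n p : (size p <= n)%N -> pint (L n * p) = 0.
Proof.
move=> /legendre_span[c ->]; rewrite mulr_sumr pint_sum big1 // => i _.
by rewrite -scalerAr pintZ legendre_orth ?mulr0 // gtn_eqF.
Qed.

(** [X L_n'] and [n L_n] have the same leading term, so [2 X L_n L_n'] has the same integral as
    [2 n L_n^2]; integrating the derivative of [X L_n^2] gives the norm. *)
Lemma legendre_norm n : pint (L n * L n) = 2 / (2 * n + 1)%:R.
Proof.
have sq : (size ('X * (L n)^`() - n%:R *: L n)%R <= n)%N.
  apply/leq_sizeP => j; rewrite coefB coefZ coefXM leq_eqVlt.
  case: j => [|j] /=; first by rewrite orbF => /eqP ->; rewrite mul0r subrr.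
  rewrite coef_deriv => /orP[/eqP ->|hj].
    by rewrite mulr_natl subrr.
  rewrite !nth_default ?mul0rn ?mulr0 ?subrr ?size_legendre //.
have hd : ('X * (L n * L n))^`() =
   (2 * n + 1)%:R *: (L n * L n) + 2 *: (L n * ('X * (L n)^`() - n%:R *: L n)).
  rewrite !derivM derivX -!mul_polyC !polyC_natr natrD natrM; ring.
have := pint_deriv ('X * (L n * L n)); rewrite hd pintD !pintZ.
rewrite (legendre_orth_low sq) mulr0 addr0 !hornerM !hornerX legendre_1 legendre_N1.
have -> : (-1) ^+ n * (-1) ^+ n = 1 :> R by rewrite -expr2 sqrr_sign.
move=> h; apply: (mulfI (_ : (2 * n + 1)%:R != 0)).
  by rewrite pnatr_eq0 addn1.
rewrite h [RHS]mulrC divfK ?pnatr_eq0 ?addn1 //; ring.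
Qed.

End Legendre.

(** * Pointwise bounds for Legendre polynomials *)

(** Legendre's equation is used with an arbitrary parameter [c], as only its sign and the
    values at the endpoints matter. *)
Section Sonin.
Variables (R : realType) (p : {poly R}) (c : R).
Hypothesis c_gt0 : 0 < c.
Hypothesis ode : ((1 - 'X^2) * p^`())^`() = - c *: p.
Hypothesis p1 : p.[1] ^+ 2 = 1.
Hypothesis pN1 : p.[-1] ^+ 2 = 1.

(** Sonin's function: it increases away from 0, while its product with [1 - t^2]
    decreases away from 0. *)
Definition sonin : {poly R} := p * p + c^-1 *: ((1 - 'X^2) * (p^`() * p^`())).

Let c_neq0 : c != 0. Proof. by rewrite gt_eqF. Qed.

Let deriv_1X2 : (1 - 'X^2 : {poly R})^`() = - (2 * 'X).
Proof. by rewrite derivB derivXn -(polyC1 R) derivC polyC1 /= expr1 -mulr_natl; ring. Qed.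

Let deriv_sonin : sonin^`() = c^-1 *: (2 * 'X * (p^`() * p^`())).
Proof.
rewrite /sonin derivD derivZ.
have -> : ((1 - 'X^2) * (p^`() * p^`()))^`() =
   2 * ((1 - 'X^2) * p^`())^`() * p^`() + 2 * 'X * (p^`() * p^`()).
  rewrite !derivM deriv_1X2; ring.
rewrite ode scalerDr addrA [X in X + _](_ : _ = 0) ?add0r //.
rewrite derivM scaleNr mulrN mulNr scalerN -scalerAr -scalerAl scalerA.
rewrite mulVf // scale1r; ring.
Qed.

Let deriv_sonin1 : ((1 - 'X^2) * sonin)^`() = - (2 * 'X * (p * p)).
Proof.
rewrite derivM deriv_sonin /sonin -!mul_polyC deriv_1X2; ring.
Qed.

Let sonin_incr t : -1 <= t <= 1 -> sonin.[0] <= sonin.[t] <= 1.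
Proof.
move=> /andP[t1 t2].
have s1 : sonin.[1] = 1.
  by rewrite /sonin !horner_ringE -expr2 p1; ring.
have s2 : sonin.[-1] = 1.
  by rewrite /sonin !horner_ringE -expr2 pN1; ring.
have c0 : 0 <= c^-1 by rewrite invr_ge0 ltW.
have d x : sonin^`().[x] = x * (c^-1 * (2 * p^`().[x] ^+ 2)).
  by rewrite deriv_sonin !horner_ringE; ring.
have dpos x : 0 <= c^-1 * (2 * p^`().[x] ^+ 2).
  by rewrite mulr_ge0 // mulr_ge0 // sqr_ge0.
have [t0|t0] := leP 0 t.
  have incr : {in `[0, 1] &, {homo (horner sonin) : x y / x <= y}}.
    apply: ler_hornerW => x; rewrite in_itv /= => /andP[x1 x2].
    by rewrite d mulr_ge0 // ltW.
  by rewrite -[in X in _ && (_ <= X)]s1 !incr // in_itv /= ?lexx ?t0 ?t2 ?ler01.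
have incr : {in `[-1, 0] &, {homo (horner (- sonin)) : x y / x <= y}}.
  apply: ler_hornerW => x; rewrite in_itv /= => /andP[x1 x2].
  by rewrite derivN hornerN d -mulNr mulr_ge0 // oppr_ge0 ltW.
have := incr t 0; have := incr (-1) t; rewrite !in_itv /= !hornerN !lerN2 s2.
by rewrite !lexx t1 (ltW t0) lerN10 /= => -> // ->.
Qed.

Lemma sonin_le1 t : -1 <= t <= 1 -> `|p.[t]| <= 1.
Proof.
move=> ht; have /andP[_] := sonin_incr ht.
rewrite /sonin !horner_ringE => h.
rewrite -ler_sqr ?nnegrE // expr1n real_normK ?num_real //.
apply: le_trans h; rewrite expr2 lerDl mulr_ge0 ?invr_ge0 ?(ltW c_gt0) //.
rewrite mulr_ge0 // -?expr2 ?sqr_ge0 //.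
by case/andP: ht => *; nra.
Qed.

Lemma pint_sturm_liouville : pint ((1 - 'X^2) * (p^`() * p^`())) = c * pint (p * p).
Proof.
have := pint_deriv (((1 - 'X^2) * p^`()) * p).
rewrite derivM ode pintD -scalerAl pintZ !hornerM.
have -> : (1 - 'X^2 : {poly R}).[1] = 0 by rewrite !horner_ringE; ring.
have -> : (1 - 'X^2 : {poly R}).[-1] = 0 by rewrite !horner_ringE; ring.
rewrite !mul0r subr0 -mulrA => h; lra.
Qed.

(** The value at 0, being the least one, is at most the average over the interval. *)
Lemma sonin0_le : sonin.[0] <= pint (p * p).
Proof.
have : pint sonin.[0]%:P <= pint sonin.
  by apply: le_pint => t ht; rewrite hornerC; have /andP[] := sonin_incr ht.
have -> : pint sonin.[0]%:P = sonin.[0] * 2.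
  rewrite (@pintE _ _ (sonin.[0] *: 'X)); first by rewrite !horner_ringE; ring.
  by rewrite derivZ derivX -mul_polyC mulr1.
by rewrite {2}/sonin pintD pintZ pint_sturm_liouville mulKf // => h; lra.
Qed.

(** The left side is at most [c (1 - t^2) sonin(t)], which is largest at 0. *)
Lemma sonin_deriv_bound t : -1 <= t <= 1 ->
  ((1 - t ^+ 2) * p^`().[t]) ^+ 2 <= c * pint (p * p).
Proof.
move=> ht.
have key : ((1 - 'X^2) * sonin).[t] <= sonin.[0].
  have d x : ((1 - 'X^2) * sonin)^`().[x] = - x * (2 * p.[x] ^+ 2).
    by rewrite deriv_sonin1 !horner_ringE; ring.
  have dpos x : 0 <= 2 * p.[x] ^+ 2 by rewrite mulr_ge0 // sqr_ge0.
  have e0 : ((1 - 'X^2) * sonin).[0] = sonin.[0] by rewrite !horner_ringE; ring.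
  rewrite -e0; set S := _ * sonin in d *.
  have [t0|t0] := leP 0 t.
    have incr : {in `[0, 1] &, {homo (horner (- S)) : x y / x <= y}}.
      apply: ler_hornerW => x; rewrite in_itv /= => /andP[x1 x2].
      by rewrite derivN hornerN d mulNr opprK mulr_ge0 // ltW.
    have := incr 0 t; rewrite !in_itv /= !hornerN !lerN2 lexx ler01 t0.
    by case/andP: ht => _ -> /=; apply.
  have incr : {in `[-1, 0] &, {homo (horner S) : x y / x <= y}}.
    apply: ler_hornerW => x; rewrite in_itv /= => /andP[x1 x2].
    by rewrite d mulr_ge0 // oppr_ge0 ltW.
  have [t1 _] := andP ht.
  by apply: incr; rewrite ?in_itv /= ?lexx ?t1 ?lerN10 ?(ltW t0).
have h1 : ((1 - t ^+ 2) * p^`().[t]) ^+ 2 <= c * ((1 - 'X^2) * sonin).[t].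
  have -> : ((1 - 'X^2) * sonin).[t] = (1 - t ^+ 2) * p.[t] ^+ 2 +
      c^-1 * ((1 - t ^+ 2) * p^`().[t]) ^+ 2.
    by rewrite /sonin !horner_ringE; ring.
  rewrite mulrDr mulVKf // lerDr mulr_ge0 ?(ltW c_gt0) // mulr_ge0 ?sqr_ge0 //.
  by case/andP: ht => *; nra.
apply: le_trans h1 _; rewrite ler_pM2l //; apply: le_trans key _; exact: sonin0_le.
Qed.

End Sonin.

Section LegendreBounds.
Variable R : realType.
Local Notation L := (legendre R).

Lemma nn1_gt0 n : (0 < n)%N -> 0 < n%:R * n.+1%:R :> R.
Proof. by move=> n0; rewrite mulr_gt0 // ltr0n. Qed.

Lemma legendre_sqr1 n : (L n).[1] ^+ 2 = 1.
Proof. by rewrite legendre_1 expr1n. Qed.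

Lemma legendre_sqrN1 n : (L n).[-1] ^+ 2 = 1.
Proof. by rewrite legendre_N1 sqrr_sign. Qed.

Lemma legendre0 : L 0 = 1.
Proof.
have : size (L 0) = 1%N by rewrite size_legendre.
move/eqP/size_poly1P => [c c0 e]; have := legendre_1 R 0.
by rewrite e !hornerC => ->; rewrite polyC1.
Qed.

Lemma legendre_le1 n t : -1 <= t <= 1 -> `|(L n).[t]| <= 1.
Proof.
case: n => [|n] ht; first by rewrite legendre0 hornerE normr1.
apply: (sonin_le1 (nn1_gt0 (ltn0Sn n)) (legendre_ode R n.+1)) => //.
- exact: legendre_sqr1.
- exact: legendre_sqrN1.
Qed.

(** The left side is of order [n], although [L_n'] is of order [n^2] at the endpoints. *)
Lemma legendre_deriv_bound n t : (0 < n)%N -> -1 <= t <= 1 ->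
  ((1 - t ^+ 2) * (L n)^`().[t]) ^+ 2 <= n%:R * n.+1%:R * (2 / (2 * n + 1)%:R).
Proof.
move=> n0 ht; rewrite -legendre_norm.
apply: (sonin_deriv_bound (nn1_gt0 n0) (legendre_ode R n)) => //.
- exact: legendre_sqr1.
- exact: legendre_sqrN1.
Qed.

End LegendreBounds.

(** * The Legendre-Gauss-Lobatto nodes *)

Section RootsOfDerivatives.
Variable R : realType.
Implicit Types (p q : {poly R}) (s : seq R).

(** The bounds on the new roots are those of Rolle's theorem between consecutive ones; they
    make the lemma applicable to its own output. *)
Lemma rolle_seq p (a : R) s : path <%R a s -> all (root p) (a :: s) ->
  exists2 s', size s' = size s /\ path <%R a s' &
    all (root p^`()) s' /\ all (fun x => x < last a s) s'.
Proof.
elim: s a => [|b s ih] a /=; first by move=> _ _; exists [::].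
move=> /andP[ab bs] /and3P[ra rb rs].
have [s' [es ps] [rs' ls]] := ih b bs (introT andP (conj rb rs)).
have [|c] := @rolle _ a b p ab.
  by move/rootP: ra => ->; move/rootP: rb => ->.
rewrite in_itv /= => /andP[ac cb] pc.
exists (c :: s'); first split; rewrite /= ?es //.
  rewrite ac /=; case: s' ps {es rs' ls} => //= d s' /andP[bd ->].
  by rewrite (lt_trans cb bd).
split; rewrite /root ?pc ?eqxx //= ls andbT (lt_le_trans cb) //.
have : sorted <=%R (b :: s) by exact: sub_path (@ltW _ R) _ _ bs.
move=> /(order_path_min le_trans)/allP h; have := mem_last b s.
by rewrite inE => /predU1P[->//|/h].
Qed.

Lemma derivn_XsubC_exp (a : R) n k q :
  exists q', (('X - a%:P) ^+ (k + n) * q)^`(k) = ('X - a%:P) ^+ n * q'.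
Proof.
elim: k n => [|k ih] n; first by exists q; rewrite derivn0.
have [q' e] := ih n.+1.
exists (n.+1%:R * q' + ('X - a%:P) * q'^`()).
by rewrite derivnS addSnnS e derivM deriv_exp derivXsubC mul1r /= exprS -mulr_natl; ring.
Qed.

Lemma root_derivn_XsubC_exp (a : R) n k q : (k < n)%N ->
  root (('X - a%:P) ^+ n * q)^`(k) a.
Proof.
move=> kn; have [q'] := derivn_XsubC_exp a (n - k) k q.
rewrite subnKC ?(ltnW kn) // => ->; rewrite -(subnSK kn) exprS.
by apply/rootP; rewrite !hornerM hornerXsubC subrr !mul0r.
Qed.

(** The [k]-th derivative has one more root inside the interval than the preceding one, by
    Rolle's theorem between the roots of the latter, to which the endpoints belong as they are
    roots of order [n] of the polynomial. *)
Lemma derivn_w_roots n k : (k <= n)%N ->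
  exists2 s, size s = k /\ path <%R (-1) s &
    all (root (('X^2 - 1 : {poly R}) ^+ n)^`(k)) s /\ all (fun x => x < 1) s.
Proof.
elim: k => [|k ih] kn; first by exists [::].
have [s [es ps] [rs ls]] := ih (ltnW kn).
have [||s' [es' ps'] [rs' ls']] := @rolle_seq (('X^2 - 1 : {poly R}) ^+ n)^`(k) (-1) (rcons s 1).
- rewrite rcons_path ps /=; have := mem_last (-1) s.
  by rewrite inE => /predU1P[->|/(allP ls)//]; lra.
- rewrite /= all_rcons rs andbT; apply/andP; split.
    have -> : 'X^2 - 1 = ('X - (-1)%:P) * ('X - 1) :> {poly R} by rewrite polyCN polyC1; ring.
    by rewrite exprMn root_derivn_XsubC_exp.
  have -> : 'X^2 - 1 = ('X - 1%:P) * ('X + 1) :> {poly R} by rewrite polyC1; ring.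
  by rewrite exprMn root_derivn_XsubC_exp.
exists s'; first by rewrite es' size_rcons es.
by rewrite derivnS; split=> //; move: ls'; rewrite last_rcons.
Qed.

End RootsOfDerivatives.

Section Nodes.
Variables (R : realType) (N : nat).
Hypothesis N_gt0 : (0 < N)%N.
Local Notation L := (legendre R).
Local Notation LN := (legendre R N).
Local Notation t_ := (node R (N := N)).
Implicit Types p q : {poly R}.

Let size_LN' : size LN^`() = N.
Proof.
have h : LN^`()`_N.-1 != 0.
  by rewrite coef_deriv mulrn_eq0 prednK // negb_or -lt0n N_gt0 legendre_lead_coef.
apply/eqP; rewrite eqn_leq; apply/andP; split.
  by rewrite -ltnS -(size_legendre R N) lt_size_deriv // -size_poly_eq0 size_legendre.
rewrite leqNgt; apply: contra h => h; rewrite nth_default //.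
by rewrite -ltnS prednK.
Qed.

Let LN'_neq0 : LN^`() != 0.
Proof. by rewrite -size_poly_gt0 size_LN'. Qed.

(** The [N] roots of [L_N] inside the interval leave room for [N - 1] roots of its derivative
    between them, which are all the roots by the degree. *)
Lemma deriv_legendre_roots :
  [/\ size (rootsR LN^`()) = N.-1, uniq (rootsR LN^`()) &
      forall x, x \in rootsR LN^`() -> -1 < x < 1].
Proof.
have [s [es ps] [rs ls]] := @derivn_w_roots R N N (leqnn N).
have rL : all (root LN) s.
  apply/allP => x /(allP rs) /rootP h; apply/rootP.
  by rewrite legendreE hornerZ h mulr0.
case: s es ps rs ls rL => [e|a s es /= /andP[a1 ps] _ /andP[a2 ls] rL].
  by move: N_gt0; rewrite -e.
have [s' [es' ps'] [rs' ls']] := rolle_seq ps rL.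
have u' : uniq s'.
  have : sorted <%R s' by exact: path_sorted ps'.
  by apply: sorted_uniq; [exact: lt_trans|move=> x; rewrite ltxx].
have sub : {subset s' <= rootsR LN^`()}.
  move=> x xs; have := roots_on_rootsR LN'_neq0 x.
  by rewrite in_itv /= => <-; exact: (allP rs').
have uR : uniq (rootsR LN^`()) by exact: uniq_roots.
have le : (size (rootsR LN^`()) <= size s')%N.
  have := max_poly_roots LN'_neq0 _ uR; rewrite size_LN' => h.
  have {}es : N.-1 = size s by rewrite -es.
  rewrite es' -es -ltnS prednK //; apply: h.
  apply/allP => x xs; have := roots_on_rootsR LN'_neq0 x.
  by rewrite in_itv /= xs => ->.
have [h1 h2] := uniq_min_size u' sub le.
split=> //; first by rewrite -h1 es' -es.
move=> x; rewrite -h2 => xs; apply/andP; split.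
  have /allP h : all (> a) s' by apply: (order_path_min lt_trans ps').
  exact: lt_trans a1 (h _ xs).
apply: lt_trans (allP ls' _ xs) _.
by have := mem_last a s; rewrite inE => /predU1P[->|/(allP ls)].
Qed.

Let nodes : seq R := -1 :: rcons (rootsR LN^`()) 1.

Let size_nodes : size nodes = N.+1.
Proof.
have [h _ _] := deriv_legendre_roots.
by rewrite /nodes /= size_rcons h prednK.
Qed.

Let uniq_nodes : uniq nodes.
Proof.
have [_ u h] := deriv_legendre_roots.
rewrite /nodes /= mem_rcons inE rcons_uniq u andbT negb_or; apply/andP; split.
  by apply/andP; split; [apply/eqP; lra|apply/negP => /h; rewrite ltxx].
by apply/negP => /h; rewrite ltxx andbF.
Qed.

Lemma node_inj : injective t_.
Proof.
move=> i j /eqP; rewrite /node -/nodes nth_uniq ?size_nodes // => /eqP.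
exact: val_inj.
Qed.

Lemma node0 : t_ ord0 = -1. Proof. by []. Qed.

Lemma node_max : t_ ord_max = 1.
Proof.
have [h _ _] := deriv_legendre_roots.
rewrite /node /=; move: h; case: (N) N_gt0 => // n _ h; rewrite /= nth_rcons h ltnn eqxx.
by [].
Qed.

Lemma node_interior i : i != ord0 -> i != ord_max ->
  -1 < t_ i < 1 /\ LN^`().[t_ i] = 0.
Proof.
have [h _ h'] := deriv_legendre_roots.
move=> i0 iN; have li : (i.-1 < size (rootsR LN^`()))%N.
  have : nat_of_ord i != 0%N by apply: contra i0 => /eqP e; apply/eqP/val_inj.
  have : nat_of_ord i != N by apply: contra iN => /eqP e; apply/eqP/val_inj.
  have := ltn_ord i; rewrite h; lia.
have e : t_ i = nth 0 (rootsR LN^`()) i.-1.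
  rewrite /node; case: i i0 iN li => -[|i] //= hi _ _ li.
  by rewrite nth_rcons li.
have mi : t_ i \in rootsR LN^`() by rewrite e mem_nth.
split; first exact: h'.
apply/rootP; have := roots_on_rootsR LN'_neq0 (t_ i).
by rewrite in_itv /= mi => /esym <-.
Qed.

Lemma node_itv i : -1 <= t_ i <= 1.
Proof.
have [->|i0] := eqVneq i ord0; first by rewrite node0; apply/andP; split; lra.
have [->|iN] := eqVneq i ord_max; first by rewrite node_max; apply/andP; split; lra.
by have [/andP[? ?] _] := node_interior i0 iN; rewrite !ltW.
Qed.

(** A multiple of the product of the [X - t_k]. Its derivative is a multiple of [L_N], by
    Legendre's equation, which is why the values of [L_N] at the nodes occur in the
    differentiation matrix and in the weights. *)
Definition omega : {poly R} := (1 - 'X^2) * LN^`().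

Lemma omega_node i : omega.[t_ i] = 0.
Proof.
rewrite /omega !horner_ringE.
have [->|i0] := eqVneq i ord0; first by rewrite node0; ring.
have [->|iN] := eqVneq i ord_max; first by rewrite node_max; ring.
by have [_ ->] := node_interior i0 iN; rewrite mulr0.
Qed.

Lemma poly_nodes_eq0 p : (size p <= N.+1)%N -> (forall i, p.[t_ i] = 0) -> p = 0.
Proof.
move=> sp h; apply: (@roots_geq_poly_eq0 _ _ nodes) => //.
- apply/allP => x /(nthP 0)[i]; rewrite size_nodes => hi <-.
  by apply/rootP; have := h (Ordinal hi).
- by rewrite size_nodes.
Qed.

Definition omega_ (k : 'I_N.+1) : {poly R} := omega %/ ('X - (t_ k)%:P).

Lemma omegaE k : omega = omega_ k * ('X - (t_ k)%:P).
Proof.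
have : root omega (t_ k) by apply/rootP; exact: omega_node.
by rewrite -dvdp_XsubCl => /divpK.
Qed.

Let size_1X2 : size (1 - 'X^2 : {poly R}) = 3%N.
Proof. by rewrite -opprB size_polyN size_XnsubC. Qed.

Let omega_neq0 : omega != 0.
Proof. by rewrite mulf_neq0 // -size_poly_eq0 size_1X2. Qed.

Lemma size_omega : size omega = N.+2.
Proof.
by rewrite /omega size_mul ?LN'_neq0 // -?size_poly_eq0 size_1X2 // size_LN'.
Qed.

Lemma size_omega_ k : size (omega_ k) = N.+1.
Proof. by rewrite size_divp ?polyXsubC_eq0 // size_XsubC size_omega subn1. Qed.

Lemma deriv_omega : omega^`() = - (N%:R * N.+1%:R) *: LN.
Proof. exact: legendre_ode. Qed.

Lemma omega__node i k : i != k -> (omega_ k).[t_ i] = 0.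
Proof.
move=> ik; have := omega_node i; rewrite (omegaE k) hornerM hornerXsubC.
move/eqP; rewrite mulf_eq0 => /orP[/eqP//|].
by rewrite subr_eq0 => /eqP/node_inj/eqP; rewrite (negbTE ik).
Qed.

Lemma omega__diag k : (omega_ k).[t_ k] = - (N%:R * N.+1%:R) * LN.[t_ k].
Proof.
rewrite -hornerZ -deriv_omega (omegaE k) derivM derivXsubC mulr1 hornerD hornerM.
by rewrite hornerXsubC subrr mulr0 add0r.
Qed.

Lemma omega__diag_neq0 k : (omega_ k).[t_ k] != 0.
Proof.
apply/eqP => h; have : omega_ k = 0.
  apply: poly_nodes_eq0; first by rewrite size_omega_.
  by move=> i; have [->//|] := eqVneq i k; exact: omega__node.
by move/eqP; rewrite -size_poly_eq0 size_omega_.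
Qed.

Lemma legendre_node_neq0 k : LN.[t_ k] != 0.
Proof.
by have := omega__diag_neq0 k; rewrite omega__diag mulf_eq0 => /norP[].
Qed.

Definition lagr k : {poly R} := ((omega_ k).[t_ k])^-1 *: omega_ k.

Lemma lagr_node i k : (lagr k).[t_ i] = (i == k)%:R.
Proof.
rewrite hornerZ; have [->|ik] := eqVneq i k; first by rewrite mulVf ?omega__diag_neq0.
by rewrite (omega__node ik) mulr0.
Qed.

Lemma size_lagr k : (size (lagr k) <= N.+1)%N.
Proof. by rewrite (leq_trans (size_scale_leq _ _)) // size_omega_. Qed.

Lemma lagr_sum_node (v : 'I_N.+1 -> R) i : (\sum_k v k *: lagr k).[t_ i] = v i.
Proof.
rewrite horner_sum (bigD1 i) //= hornerZ lagr_node eqxx mulr1 big1 ?addr0 // => j ji.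
by rewrite hornerZ lagr_node eq_sym (negbTE ji) mulr0.
Qed.

Lemma size_lagr_sum (v : 'I_N.+1 -> R) : (size (\sum_k v k *: lagr k)%R <= N.+1)%N.
Proof.
apply: (leq_trans (size_sum _ _ _)); apply/bigmax_leqP => k _.
by rewrite (leq_trans (size_scale_leq _ _)) // size_lagr.
Qed.

Lemma lagr_expand p : (size p <= N.+1)%N -> p = \sum_k p.[t_ k] *: lagr k.
Proof.
move=> sp; apply/eqP; rewrite -subr_eq0; apply/eqP/poly_nodes_eq0.
  rewrite (leq_trans (size_polyD _ _)) // geq_max sp size_polyN.
  exact: size_lagr_sum.
by move=> i; rewrite hornerD hornerN lagr_sum_node subrr.
Qed.

Definition nodal p : 'cV[R]_N.+1 := \col_k p.[t_ k].

Lemma interpP (v : 'cV[R]_N.+1) :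
  (size (interp v) <= N.+1)%N /\ forall k, (interp v).[t_ k] = v k 0.
Proof.
have := @xgetPex _ 0 [set p : {poly R} |
    (size p <= N.+1)%N /\ forall k, p.[t_ k] = v k 0].
apply; exists (\sum_k v k 0 *: lagr k); split; first exact: size_lagr_sum.
by move=> k; rewrite lagr_sum_node.
Qed.

Lemma interp_nodal p : (size p <= N.+1)%N -> interp (nodal p) = p.
Proof.
move=> sp; have [h1 h2] := interpP (nodal p).
apply/eqP; rewrite -subr_eq0; apply/eqP/poly_nodes_eq0.
  by rewrite (leq_trans (size_polyD _ _)) // geq_max h1 size_polyN.
by move=> i; rewrite hornerD hornerN h2 mxE subrr.
Qed.

Lemma nodal_interp v : nodal (interp v) = v.
Proof.
by apply/matrixP => i j; rewrite mxE (interpP v).2 ord1.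
Qed.

Lemma legendre_ode_horner (t : R) :
  (1 - t ^+ 2) * LN^`()^`().[t] - 2 * t * LN^`().[t] = - (N%:R * N.+1%:R) * LN.[t].
Proof.
have := congr1 (fun p : {poly R} => p.[t]) (legendre_ode R N).
rewrite hornerZ => <-; rewrite derivM derivB derivXn -(polyC1 R) derivC /=.
by rewrite sub0r -mulr_natl expr1 !horner_ringE; ring.
Qed.

(** Off the diagonal, differentiate [omega = omega_k (X - t_k)] once and evaluate it at [t_i];
    on the diagonal, differentiate it twice and evaluate at [t_k], where [L_N'] is 0, except at
    the endpoints, where Legendre's equation gives it. *)
Lemma diffmx_lagr i k : lgl_diffmx R N i k = (lagr k)^`().[t_ i].
Proof.
rewrite mxE derivZ hornerZ omega__diag.
have Nn : N%:R * N.+1%:R != 0 :> R by rewrite mulf_neq0 // pnatr_eq0 -?lt0n.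
have Lk := legendre_node_neq0 k.
have [->{i}|ik] /= := eqVneq i k; last first.
  have h : (omega_ k)^`().[t_ i] * (t_ i - t_ k) = - (N%:R * N.+1%:R) * LN.[t_ i].
    rewrite -hornerZ -deriv_omega (omegaE k) derivM derivXsubC mulr1 hornerD hornerM.
    by rewrite hornerXsubC omega__node // addr0.
  have tik : t_ i - t_ k != 0 by rewrite subr_eq0 (inj_eq node_inj).
  rewrite -[(omega_ k)^`().[_]](mulfK tik) h.
  by set c := N%:R * _ in Nn *; field; rewrite tik Lk Nn.
have h : (omega_ k)^`().[t_ k] * 2 = - (N%:R * N.+1%:R) * LN^`().[t_ k].
  rewrite -hornerZ -derivZ -deriv_omega (omegaE k) derivM derivXsubC mulr1 derivD derivM.
  by rewrite derivXsubC !hornerD hornerM hornerXsubC subrr mulr1; ring.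
have {h} -> : (omega_ k)^`().[t_ k] = - (N%:R * N.+1%:R) * LN^`().[t_ k] / 2.
  by rewrite -h; field.
have -> : (- (N%:R * N.+1%:R) * LN.[t_ k])^-1 * (- (N%:R * N.+1%:R) * LN^`().[t_ k] / 2)
   = LN^`().[t_ k] / (2 * LN.[t_ k]).
  by set c := N%:R * _ in Nn *; field; rewrite Lk Nn.
have ode := legendre_ode_horner (t_ k).
have [k0|k0] := eqVneq k ord0.
  move: ode Lk; rewrite k0 node0 => ode Lk.
  have -> : LN^`().[-1] = - (N%:R * N.+1%:R) * LN.[-1] / 2 by rewrite -ode; field.
  by field.
have [kN|kN] := eqVneq k ord_max.
  move: ode Lk; rewrite kN node_max => ode Lk.
  have -> : LN^`().[1] = N%:R * N.+1%:R * LN.[1] / 2.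
    by move: ode; rewrite expr1n subrr mul0r; lra.
  by field.
by have [_ ->] := node_interior k0 kN; rewrite mul0r.
Qed.

Lemma diffmx_nodal p : (size p <= N.+1)%N ->
  lgl_diffmx R N *m nodal p = nodal p^`().
Proof.
move=> sp; apply/matrixP => i j; rewrite !mxE {2}(lagr_expand sp).
rewrite (big_morph _ (@derivD R) (@deriv0 R)) horner_sum; apply: eq_bigr => k _.
by rewrite diffmx_lagr mxE derivZ hornerZ mulrC.
Qed.

Lemma size_derivn_le p k n : (size p <= n)%N -> (size p^`(k) <= n - k)%N.
Proof.
move=> sp; apply/leq_sizeP => j hj; rewrite coef_derivn nth_default ?mul0rn //.
by apply: leq_trans sp _; lia.
Qed.

Lemma diffmx_exp_nodal p k : (size p <= N.+1)%N ->
  lgl_diffmx R N ^+ k *m nodal p = nodal p^`(k).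
Proof.
move=> sp; elim: k => [|k ih]; first by rewrite expr0 mul1mx derivn0.
rewrite exprS -[_ * _]/(_ *m _) -mulmxA ih diffmx_nodal -?derivnS //.
by rewrite (leq_trans (size_derivn_le _ sp)) // leq_subr.
Qed.

Lemma pint_1X2 q : pint (((1 - 'X^2) * q) * LN^`()) = - pint (LN * ((1 - 'X^2) * q)^`()).
Proof.
have := pint_deriv (((1 - 'X^2) * q) * LN); rewrite derivM pintD [_^`() * LN]mulrC.
have -> : ((1 - 'X^2) * q * LN).[1] = 0 by rewrite !horner_ringE; ring.
have -> : ((1 - 'X^2) * q * LN).[-1] = 0 by rewrite !horner_ringE; ring.
by rewrite subrr => /eqP; rewrite addrC addr_eq0 => /eqP.
Qed.

Lemma pint_legendre_lead p (a : R) : (size p <= N.+1)%N -> p`_N = a * LN`_N ->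
  pint (LN * p) = a * (2 / (2 * N + 1)%:R).
Proof.
move=> sp h; have -> : p = a *: LN + (p - a *: LN) by rewrite addrC subrK.
rewrite mulrDr pintD -scalerAr pintZ legendre_norm legendre_orth_low ?addr0 //.
apply/leq_sizeP => j; rewrite leq_eqVlt => /orP[/eqP <-|hj].
  by rewrite coefB coefZ h subrr.
rewrite coefB coefZ !nth_default ?mulr0 ?subr0 ?size_legendre //.
exact: leq_trans sp hj.
Qed.

(** With [Q] the difference quotient of [L_N] at [t_k], the product [Q omega] equals
    [(L_N - L_N(t_k)) omega_k]. The integrals of [L_N omega_k] and [Q omega] depend on leading
    coefficients only, by orthogonality. *)
Lemma pint_omega_ k : LN.[t_ k] * pint (omega_ k) = - 2.
Proof.
pose Q := (LN - (LN.[t_ k])%:P) %/ ('X - (t_ k)%:P).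
have eQ : LN - (LN.[t_ k])%:P = Q * ('X - (t_ k)%:P).
  have : root (LN - (LN.[t_ k])%:P) (t_ k) by rewrite /root !hornerE subrr.
  by rewrite -dvdp_XsubCl => /divpK.
have sQ : (size Q <= N)%N.
  rewrite size_divp ?polyXsubC_eq0 // size_XsubC leq_subLR addnC addn1 /=.
  rewrite (leq_trans (size_polyD _ _)) // geq_max size_legendre size_polyN leqnn /=.
  by rewrite (leq_trans (size_polyC_leq1 _)).
have cQ : Q`_N.-1 = LN`_N.
  have := congr1 (fun p : {poly R} => p`_N) eQ.
  rewrite coefB coefC gtn_eqF // subr0 => ->.
  rewrite mulrBr coefB coefMX coefMC gtn_eqF // (nth_default _ sQ) mul0r subr0 //.
have co : (omega_ k)`_N = - N%:R * LN`_N.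
  have := congr1 (fun p : {poly R} => p`_N.+1) (omegaE k).
  rewrite mulrBr coefB coefMX coefMC /= [X in _ - X * _]nth_default ?size_omega_ //.
  rewrite mul0r subr0 => <-; rewrite /omega mulrBl mul1r coefB coefXnM /= subSS subn1.
  rewrite [X in X - _]nth_default ?size_LN' // sub0r coef_deriv prednK // mulNr mulr_natl.
  by case: (N) N_gt0.
have -> : LN.[t_ k] * pint (omega_ k) = pint (LN * omega_ k) - pint (Q * omega).
  rewrite -pintZ -pintB; congr pint.
  have -> : Q * omega = (LN - (LN.[t_ k])%:P) * omega_ k by rewrite eQ (omegaE k); ring.
  by rewrite -mul_polyC; ring.
rewrite (pint_legendre_lead _ co) ?size_omega_ //.
have -> : Q * omega = ((1 - 'X^2) * Q) * LN^`() by rewrite /omega; ring.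
rewrite pint_1X2 (@pint_legendre_lead _ (- N.+1%:R)).
- rewrite natrD natrM; field.
  by rewrite -natrM natr1 pnatr_eq0.
- rewrite -[N.+1]/(N.+2.-1) -subn1 -derivn1 size_derivn_le //.
  rewrite (leq_trans (size_polyMleq _ _)) // size_1X2 /= !ltnS; exact: sQ.
rewrite coef_deriv mulrBl mul1r coefB coefXnM nth_default ?(leq_trans sQ) //.
rewrite sub0r mulNr mulr_natl -mulNrn; congr (- _ *+ _).
by case: (N) N_gt0 cQ => // n _; rewrite subSS subn1.
Qed.

Lemma weight_pint k : weight R k = pint (lagr k).
Proof.
have Lk := legendre_node_neq0 k.
have Nn : N%:R * N.+1%:R != 0 :> R by rewrite mulf_neq0 // pnatr_eq0 -?lt0n.
have e : pint (omega_ k) = -2 / LN.[t_ k].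
  by apply: (mulfI Lk); rewrite pint_omega_; field.
by rewrite /weight pintZ omega__diag e; set c := N%:R * _ in Nn *; field; rewrite Lk Nn.
Qed.

(** Interpolatory quadrature is exact up to degree [N]. Beyond, reduce modulo [omega]: the
    multiples of [omega] vanish at the nodes, and by parts their integrals are those of [L_N]
    against polynomials of degree less than [N]. *)
Lemma quadrature p : (size p <= N.*2)%N ->
  \sum_k weight R k * p.[t_ k] = pint p.
Proof.
move=> sp.
have low q : (size q <= N.+1)%N -> \sum_k weight R k * q.[t_ k] = pint q.
  move=> sq; rewrite {2}(lagr_expand sq) pint_sum; apply: eq_bigr => k _.
  by rewrite pintZ weight_pint mulrC.
have smod : (size (p %% omega)%R <= N.+1)%N.
  by rewrite -ltnS -size_omega ltn_modp.
rewrite [in RHS](divp_eq p omega) pintD.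
have -> : pint (p %/ omega * omega) = 0.
  have -> : p %/ omega * omega = ((1 - 'X^2) * (p %/ omega)) * LN^`().
    by rewrite /omega; ring.
  rewrite pint_1X2 legendre_orth_low ?oppr0 //.
  rewrite -derivn1; have := @size_derivn_le ((1 - 'X^2) * (p %/ omega)) 1 N.+1.
  rewrite subn1; apply; rewrite (leq_trans (size_polyMleq _ _)) // size_1X2.
  rewrite size_divp // size_omega /=; move: sp N_gt0; move: (size p) => s; lia.
rewrite add0r -low //; apply: eq_bigr => k _; congr (_ * _).
by rewrite [in LHS](divp_eq p omega) hornerD hornerM omega_node mulr0 add0r.
Qed.

Lemma spectral_coef_nodal m1 n p : (size p <= N.+1)%N ->
  (n + size p^`(m1) <= N.*2)%N ->
  spectral_coef m1 n (nodal p) = (n%:R + 2^-1) * pint (L n * p^`(m1)).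
Proof.
move=> sp sn; rewrite /spectral_coef diffmx_exp_nodal //; congr (_ * _).
rewrite -quadrature; last first.
  by rewrite (leq_trans (size_polyMleq _ _)) // size_legendre.
apply: eq_bigr => k _; rewrite mxE (hornerM (L n)); move: (weight R k) => c; ring.
Qed.

End Nodes.

(** * Calculus on the closed interval *)

Section StrongDerivative.
Variable R : realType.
Implicit Types (f g y h : R -> R) (t s : R) (p : {poly R}).

(** Compared with the limit of difference quotients, there is no division and no exclusion of
    [t] itself. *)
Definition diff_at f t l := forall e, 0 < e -> exists2 d, 0 < d &
  forall s, `|s - t| < d -> `|f s - f t - l * (s - t)| <= e * `|s - t|.

Lemma is_derive_diff_at f t l : is_derive t 1 f l <-> diff_at f t l.
Proof.
split=> [[df dl] e e0|h].
  have : (fun s => s^-1 *: (f (s *: 1 + t) - f t)) @ 0^' --> l.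
    by rewrite -dl; exact: df.
  move/cvgrPdist_lt => /(_ e e0); rewrite near_withinE => /nbhs_ballP[d /= d0 hd].
  exists d => // s std; have [->|st] := eqVneq s t.
    by rewrite !subrr mulr0 subr0 normr0 mulr0.
  have st0 : s - t != 0 by rewrite subr_eq0.
  have /hd : ball 0 d (s - t) by rewrite /ball /= sub0r normrN.
  move=> /(_ st0); rewrite /= -[(s - t) *: 1]/((s - t) * 1) mulr1 subrK.
  rewrite -[_ *: _]/((s - t)^-1 * (f s - f t)) => H.
  have -> : f s - f t - l * (s - t) = - (l - (s - t)^-1 * (f s - f t)) * (s - t).
    by field.
  by rewrite normrM normrN ler_wpM2r // ltW.
have c : (fun s => s^-1 *: (f (s *: 1 + t) - f t)) @ 0^' --> l.
  apply/cvgrPdist_le => e e0; have [d d0 hd] := h e e0.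
  rewrite near_withinE; apply/nbhs_ballP; exists d => //= s.
  rewrite /ball /= sub0r normrN => sd s0.
  have := hd (s + t); rewrite addrK => /(_ sd).
  rewrite -[s *: 1]/(s * 1) mulr1 -[_ *: _]/(s^-1 * (f (s + t) - f t)) => H.
  have -> : l - s^-1 * (f (s + t) - f t) = - s^-1 * (f (s + t) - f t - l * s) by field.
  rewrite normrM normrN normfV ler_pdivrMl ?normr_gt0 // [X in _ <= X]mulrC; exact: H.
split; first by apply/cvg_ex; exists l.
by apply/cvg_lim.
Qed.

Lemma tdomP t : tdom t <-> -1 <= t <= 1.
Proof. by rewrite /tdom /= in_itv. Qed.

Definition sdiff y h := forall t, tdom t -> forall e, 0 < e -> exists2 d, 0 < d &
  forall s, tdom s -> `|s - t| < d -> `|y s - y t - h t * (s - t)| <= e * `|s - t|.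

Lemma strong_derivativeP y h : strong_derivative y h <-> sdiff y h.
Proof.
split=> H t tt; last first.
  apply/cvgrPdist_le => e e0; have [d d0 hd] := H t tt e e0.
  rewrite near_withinE /=; apply/nbhs_ballP; exists d => //= s.
  rewrite /ball /= distrC => sd [st ts].
  have st0 : s - t != 0 by rewrite subr_eq0.
  have -> : h t - (y s - y t) / (s - t) = - (s - t)^-1 * (y s - y t - h t * (s - t)).
    by field.
  by rewrite normrM normrN normfV ler_pdivrMl ?normr_gt0 // [X in _ <= X]mulrC hd.
move=> e e0; have /cvgrPdist_lt/(_ e e0) := H t tt.
rewrite near_withinE => /nbhs_ballP[d /= d0 hd]; exists d => // s ts std.
have [->|st] := eqVneq s t; first by rewrite !subrr mulr0 subr0 normr0 mulr0.
have st0 : s - t != 0 by rewrite subr_eq0.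
have /hd : ball t d s by rewrite /ball /= distrC.
move=> H'; have {}H' : `|h t - (y s - y t) / (s - t)| < e by apply: H'.
have -> : y s - y t - h t * (s - t) = - (h t - (y s - y t) / (s - t)) * (s - t).
  by field.
by rewrite normrM normrN ler_wpM2r // ltW.
Qed.

Definition clamp (t : R) : R := Num.max (-1) (Num.min 1 t).

Lemma clamp_tdom t : tdom (clamp t).
Proof.
apply/tdomP; rewrite /clamp; have [h|h] := leP 1 t; rewrite maxElt; case: ifP => h'; lra.
Qed.

Lemma clamp_id t : tdom t -> clamp t = t.
Proof.
by move=> /tdomP/andP[h1 h2]; rewrite /clamp (min_idPr _) // (max_idPr _).
Qed.

Lemma continuous_clamp : continuous clamp.
Proof.
move=> t; apply: (@continuous_max R R (fun=> -1) (fun t => Num.min 1 t)).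
  exact: cvg_cst.
apply: (@continuous_min R R (fun=> 1) id); first exact: cvg_cst.
exact: cvg_id.
Qed.

Lemma continuous_clamp_comp (W : topologicalType) (z : R -> W) :
  {within tdom, continuous z} -> continuous (z \o clamp).
Proof.
move=> cz t; apply: cvg_comp; last first.
  by move/subspace_continuousP : cz => /(_ _ (clamp_tdom t)); exact.
move=> A nA; have B : nbhs t (fun s => tdom (clamp s) -> A (clamp s)) := @continuous_clamp t _ nA.
by apply: filterS B => s; apply; exact: clamp_tdom.
Qed.

(** A strong derivative on the closed interval is a two-sided derivative of an
    extension (by its tangents at the endpoints), so that the calculus of two-sided
    derivatives applies to it. *)
Lemma strong_derivative_ext y h : strong_derivative y h <->
  exists2 Y, {in tdom, Y =1 y} & forall t, tdom t -> is_derive t 1 Y (h t).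
Proof.
rewrite strong_derivativeP; split=> [H|[Y Yy dY] t tt e e0]; last first.
  have /is_derive_diff_at/(_ e e0)[d d0 hd] := dY t tt.
  by exists d => // s ts sd; rewrite -!Yy ?inE // hd.
exists (fun t => y (clamp t) + h (clamp t) * (t - clamp t)).
  by move=> t; rewrite inE => tt; rewrite clamp_id // subrr mulr0 addr0.
move=> t tt; apply/is_derive_diff_at => e e0; have [d d0 hd] := H t tt e e0.
have [t1 t2] := andP (proj1 (tdomP t) tt).
pose d' := if t == -1 then 1 else t + 1; pose d'' := if t == 1 then 1 else 1 - t.
have d'0 : 0 < d' by rewrite /d'; case: eqP => ?; lra.
have d''0 : 0 < d'' by rewrite /d''; case: eqP => ?; lra.
exists (Num.min d (Num.min d' d'')); first by rewrite !lt_min d0 d'0.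
move=> s; rewrite !lt_min => /and3P[sd sd' sd''].
rewrite (clamp_id tt) subrr mulr0 addr0.
have ee : 0 <= e * `|s - t| by rewrite mulr_ge0 // ltW.
have [s1|s1] := ltP s (-1).
  have -> : clamp s = -1.
    by rewrite /clamp (min_idPr _) ?(max_idPl _) // ltW // (lt_trans s1); lra.
  have te : t = -1.
    apply/eqP/negPn/negP => tn; move: sd'; rewrite /d' (negbTE tn).
    by rewrite ltr_norml => /andP[]; lra.
  by rewrite te in ee *; rewrite [X in `|X|](_ : _ = 0) ?normr0 //; ring.
have [s2|s2] := ltP 1 s.
  have -> : clamp s = 1.
    by rewrite /clamp (min_idPl _) ?(max_idPr _) // ltW.
  have te : t = 1.
    apply/eqP/negPn/negP => tn; move: sd''; rewrite /d'' (negbTE tn).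
    by rewrite ltr_norml => /andP[]; lra.
  by rewrite te in ee *; rewrite [X in `|X|](_ : _ = 0) ?normr0 //; ring.
have ts : tdom s by apply/tdomP; rewrite s1.
by rewrite (clamp_id ts) subrr mulr0 addr0 hd.
Qed.

Definition cont y := {within tdom, continuous y}.

Lemma cont_continuous y : continuous y -> cont y.
Proof. exact: continuous_subspaceT. Qed.

Lemma cont_ext y z : {in tdom, y =1 z} -> cont y -> cont z.
Proof. exact: subspace_eq_continuous. Qed.

Lemma cont_cst (c : R) : cont (fun=> c).
Proof. by apply: cont_continuous => t; exact: cvg_cst. Qed.

Lemma contD y z : cont y -> cont z -> cont (fun t => y t + z t).
Proof. by move=> cy cz t; apply: continuousD; [exact: cy|exact: cz]. Qed.

Lemma contN y : cont y -> cont (fun t => - y t).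
Proof. by move=> cy t; apply: continuousN; exact: cy. Qed.

Lemma contB y z : cont y -> cont z -> cont (fun t => y t - z t).
Proof. by move=> cy cz; apply: contD => //; exact: contN. Qed.

Lemma contM y z : cont y -> cont z -> cont (fun t => y t * z t).
Proof. by move=> cy cz t; apply: continuousM; [exact: cy|exact: cz]. Qed.

Lemma contV y : cont y -> (forall t, tdom t -> y t != 0) -> cont (fun t => (y t)^-1).
Proof.
move=> cy y0; apply/subspace_continuousP => t tt; apply: cvgV; first exact: y0.
by move/subspace_continuousP : cy; exact.
Qed.

Lemma cont_sum (I : Type) (r : seq I) (F : I -> R -> R) :
  (forall i, cont (F i)) -> cont (fun t => \sum_(i <- r) F i t).
Proof.
move=> h; elim: r => [|i r ih].
  by apply: (cont_ext _ (@cont_cst 0)) => t _; rewrite big_nil.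
by apply: (cont_ext _ (contD (h i) ih)) => t _; rewrite big_cons.
Qed.

Lemma is_derive_poly p t : is_derive t 1 (horner p) p^`().[t].
Proof.
elim/poly_ind: p t => [|p c ih] t.
  rewrite deriv0 horner0 (_ : horner 0 = cst 0); first exact: is_derive_cst.
  by apply/funext => x; rewrite horner0.
have -> : horner (p * 'X + c%:P) = (horner p) * id + cst c.
  by apply/funext => x; rewrite !hornerE.
rewrite derivMXaddC hornerD hornerMX; have := ih t => ?; apply: is_derive_eq.
rewrite -![_ *: _]/(_ * _) /=; ring.
Qed.

Lemma cont_poly p : cont (horner p).
Proof. by apply: cont_continuous; exact: continuous_horner. Qed.

Lemma is_derive_strong y h : (forall t, tdom t -> is_derive t 1 y (h t)) ->
  strong_derivative y h.
Proof. by move=> H; apply/strong_derivative_ext; exists y. Qed.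

Lemma strong_derivative_poly p : strong_derivative (horner p) (horner p^`()).
Proof. by apply: is_derive_strong => t _; exact: is_derive_poly. Qed.

Lemma strong_derivative_cont y h : strong_derivative y h -> cont y.
Proof.
move=> /strong_derivative_ext[Y Yy dY]; apply: cont_ext Yy _.
apply: continuous_in_subspaceT => t; rewrite inE => tt.
by apply: differentiable_continuous; apply/derivable1_diffP; have [] := dY t tt.
Qed.

Lemma strong_derivative_eq y z h k : {in tdom, y =1 z} -> {in tdom, h =1 k} ->
  strong_derivative y h -> strong_derivative z k.
Proof.
move=> yz hk /strong_derivative_ext[Y Yy dY]; apply/strong_derivative_ext.
exists Y; first by move=> t tt; rewrite Yy // yz.
by move=> t tt; rewrite -hk ?inE //; exact: dY.
Qed.

Lemma strong_derivativeD y z h k : strong_derivative y h -> strong_derivative z k ->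
  strong_derivative (fun t => y t + z t) (fun t => h t + k t).
Proof.
move=> /strong_derivative_ext[Y Yy dY] /strong_derivative_ext[Z Zz dZ].
apply/strong_derivative_ext; exists (Y + Z); first by move=> t tt; rewrite -Yy // -Zz.
by move=> t tt; have := dY t tt; have := dZ t tt => ? ?; exact: is_deriveD.
Qed.

Lemma strong_derivativeM y z h k : strong_derivative y h -> strong_derivative z k ->
  strong_derivative (fun t => y t * z t) (fun t => h t * z t + y t * k t).
Proof.
move=> /strong_derivative_ext[Y Yy dY] /strong_derivative_ext[Z Zz dZ].
apply/strong_derivative_ext; exists (Y * Z); first by move=> t tt; rewrite -Yy // -Zz.
move=> t tt; have := dY t tt; have := dZ t tt => ? ?.
apply: is_derive_eq; rewrite Yy ?Zz ?inE // -![_ *: _]/(_ * _); ring.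
Qed.

Lemma strong_derivative_cst (c : R) : strong_derivative (fun=> c) (fun=> 0).
Proof.
by apply/strong_derivative_ext; exists (cst c) => // t tt; exact: is_derive_cst.
Qed.

Lemma strong_derivativeZ (c : R) y h : strong_derivative y h ->
  strong_derivative (fun t => c * y t) (fun t => c * h t).
Proof.
move=> yh; apply: (strong_derivative_eq _ _ (strong_derivativeM (strong_derivative_cst c) yh)).
  by [].
by move=> t _ /=; rewrite mul0r add0r.
Qed.

Lemma strong_derivativeB y z h k : strong_derivative y h -> strong_derivative z k ->
  strong_derivative (fun t => y t - z t) (fun t => h t - k t).
Proof.
move=> yh /(@strong_derivativeZ (-1)) zk.
apply: (strong_derivative_eq _ _ (strong_derivativeD yh zk)) => t _ /=; by rewrite mulN1r.
Qed.

Lemma mean_value y h s t : strong_derivative y h -> tdom s -> tdom t -> s < t ->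
  exists2 c, s < c < t & y t - y s = h c * (t - s).
Proof.
move=> /strong_derivative_ext[Y Yy dY] /[dup] ds /tdomP/andP[s1 _] /[dup] dt /tdomP/andP[_ t1] st.
have sub u : u \in `]s, t[ -> tdom u.
  by rewrite in_itv /= => /andP[h1 h2]; apply/tdomP; apply/andP; split; lra.
have cY : {within `[s, t], continuous Y}.
  apply: continuous_in_subspaceT => u; rewrite inE /= in_itv /= => /andP[u1 u2].
  have ut : tdom u by apply/tdomP; apply/andP; split; lra.
  by apply: differentiable_continuous; apply/derivable1_diffP; have [] := dY u ut.
have [c] := MVT st (fun u us => dY u (sub u us)) cY.
by rewrite in_itv /= => ci; rewrite !Yy ?inE //; exists c.
Qed.

Lemma mean_value_le y h (C : R) s t : strong_derivative y h ->
  (forall u, tdom u -> `|h u| <= C) -> tdom s -> tdom t ->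
  `|y t - y s| <= C * `|t - s|.
Proof.
move=> yh hC.
have key u v : tdom u -> tdom v -> u < v -> `|y v - y u| <= C * `|v - u|.
  move=> du dv uv; have [c cuv ->] := mean_value yh du dv uv.
  rewrite normrM ler_wpM2r // hC //.
  move: du dv cuv => /tdomP/andP[? _] /tdomP/andP[_ ?] /andP[? ?].
  by apply/tdomP/andP; split; lra.
move=> ds dt; have [->|] := eqVneq s t; first by rewrite !subrr normr0 mulr0.
rewrite neq_lt => /orP[|] st; first exact: key.
by rewrite distrC [`|t - s|]distrC key.
Qed.

Lemma tdomN1 : @tdom R (-1). Proof. by apply/tdomP; rewrite lexx; lra. Qed.
Lemma tdom1 : @tdom R 1. Proof. by apply/tdomP; rewrite lexx andbT; lra. Qed.

Lemma strong_derivative_bound y h (C : R) t : strong_derivative y h ->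
  (forall u, tdom u -> `|h u| <= C) -> y (-1) = 0 -> tdom t -> `|y t| <= 2 * C.
Proof.
move=> yh hC y0 dt; have := mean_value_le yh hC tdomN1 dt.
rewrite y0 subr0 => h'; apply: le_trans h' _; rewrite mulrC ler_wpM2r //.
  by apply: le_trans (hC _ tdom1).
by move/tdomP : dt => /andP[? ?]; rewrite ger0_norm; lra.
Qed.

Lemma cont_bounded y : cont y -> exists2 C, 0 < C & forall t, tdom t -> `|y t| <= C.
Proof.
move=> cy; have ca : {within `[-1, 1], continuous (fun t => `|y t|)}.
  by move=> t; apply: continuous_comp; [exact: cy|exact: norm_continuous].
have [|c _ hc] := EVT_max _ ca; first lra.
exists (`|y c| + 1); first by rewrite ltr_wpDl.
by move=> t tt; rewrite (le_trans (hc t tt)) // lerDl.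
Qed.

End StrongDerivative.

Section Integral.
Variable R : realType.
Implicit Types (f g y h : R -> R) (t s : R) (p : {poly R}).
Notation mu := (@lebesgue_measure R).

Definition Int f : R := \int[mu]_(t in tdom) f t.

Lemma measurable_tdom : measurable (@tdom R : set (measurableTypeR R)).
Proof. exact: measurable_itv. Qed.

Lemma cont_integrable y : cont y -> integrable_tdom y.
Proof.
move=> cy; apply: continuous_compact_integrable => //; exact: segment_compact.
Qed.

Lemma integrable_IntD y z : integrable_tdom y -> integrable_tdom z ->
  Int (fun t => y t + z t) = Int y + Int z.
Proof. by move=> iy iz; rewrite /Int RintegralD //; exact: measurable_tdom. Qed.

Lemma integrable_IntZ c y : integrable_tdom y -> Int (fun t => c * y t) = c * Int y.
Proof. by move=> iy; rewrite /Int RintegralZl //; exact: measurable_tdom. Qed.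

Lemma eq_Int y z : {in tdom, y =1 z} -> Int y = Int z.
Proof. by move=> h; apply: eq_Rintegral => t tt; apply: h; move: tt; rewrite !inE. Qed.

Lemma IntD y z : cont y -> cont z -> Int (fun t => y t + z t) = Int y + Int z.
Proof. by move=> cy cz; apply: integrable_IntD; exact: cont_integrable. Qed.

Lemma IntZ c y : cont y -> Int (fun t => c * y t) = c * Int y.
Proof. by move=> cy; apply: integrable_IntZ; exact: cont_integrable. Qed.

Lemma IntB y z : cont y -> cont z -> Int (fun t => y t - z t) = Int y - Int z.
Proof.
move=> cy cz; rewrite -mulN1r -IntZ // -IntD //; last by apply: contM => //; exact: cont_cst.
by apply: eq_Int => t _; rewrite mulN1r.
Qed.

Lemma le_Int y z : cont y -> cont z -> (forall t, tdom t -> y t <= z t) -> Int y <= Int z.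
Proof.
by move=> cy cz h; apply: le_Rintegral; [exact: measurable_tdom|exact: cont_integrable..|].
Qed.

Lemma Int_cst c : Int (fun=> c) = c * 2.
Proof.
rewrite /Int Rintegral_cst; last exact: measurable_tdom.
congr (_ * _); transitivity (fine (mu [set` `[-1 : R, 1]])); first by [].
rewrite lebesgue_measure_itv /= lte_fin ifT; last lra.
by rewrite -EFinB /=; lra.
Qed.

Lemma Int_FTC y h : strong_derivative y h -> cont h -> Int h = y 1 - y (-1).
Proof.
move=> /strong_derivative_ext[Y Yy dY] ch.
have N11 : (-1 : R) < 1 by lra.
have cY t : tdom t -> {for t, continuous Y}.
  move=> tt; apply: differentiable_continuous; apply/derivable1_diffP.
  by have [] := dY t tt.
rewrite /Int /Rintegral (@continuous_FTC2 _ h Y) //=.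
- by rewrite !Yy // inE; [exact: tdomN1|exact: tdom1].
- split.
  + move=> t; rewrite in_itv /= => /andP[t1 t2].
    by have [] := dY t; [apply/tdomP; rewrite !ltW|].
  + by apply: cvg_at_right_filter; apply: cY; exact: tdomN1.
  + by apply: cvg_at_left_filter; apply: cY; exact: tdom1.
- move=> t; rewrite in_itv /= => /andP[t1 t2]; rewrite derive1E.
  by have [|_ ->] := dY t; [apply/tdomP; rewrite !ltW|].
Qed.

(** Continuing [h] by constants makes every point of the interval an interior point of a
    larger one. *)
Lemma cont_primitive h : cont h -> exists2 y, y (-1) = 0 & strong_derivative y h.
Proof.
move=> ch; have cH := continuous_clamp_comp ch.
pose F t := \int[mu]_(s in `[-2, t]) (h \o @clamp R) s.
exists (fun t => F t - F (-1)); first by rewrite subrr.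
have iH : mu.-integrable `[-2, 2] (EFin \o (h \o @clamp R)).
  apply: continuous_compact_integrable; first exact: segment_compact.
  exact: continuous_subspaceT.
apply: is_derive_strong => t tt; have [t1 t2] := andP (proj1 (tdomP t) tt).
have t22 : t < 2 by lra.
have t2' : -2 < t by lra.
have [dF F'] := continuous_FTC1_closed t22 iH t2' (cH t).
have dF' : is_derive t 1 F (h t).
  by apply: DeriveDef => //; rewrite -derive1E F' /= clamp_id.
have -> : (fun t => F t - F (-1)) = F - cst (F (-1)) by [].
by apply: is_derive_eq; rewrite subr0.
Qed.

Lemma Int_poly p : Int (horner p) = pint p.
Proof.
have := Int_FTC (@strong_derivative_poly _ (prim p)); rewrite deriv_prim.
by move=> -> //; exact: cont_poly.
Qed.

Lemma Int_sum (I : Type) (r : seq I) (F : I -> R -> R) :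
  (forall i, cont (F i)) -> Int (fun t => \sum_(i <- r) F i t) = \sum_(i <- r) Int (F i).
Proof.
move=> h; elim: r => [|i r ih].
  by rewrite big_nil -[RHS](mul0r 2) -Int_cst; apply: eq_Int => t _; rewrite big_nil.
rewrite big_cons -ih -IntD //; last exact: cont_sum.
by apply: eq_Int => t _; rewrite big_cons.
Qed.

Lemma Int_parts y h z k : strong_derivative y h -> strong_derivative z k ->
  cont h -> cont k ->
  Int (fun t => y t * k t) = (y 1 * z 1 - y (-1) * z (-1)) - Int (fun t => h t * z t).
Proof.
move=> yh zk ch ck; have yz := strong_derivativeM yh zk.
have cy := strong_derivative_cont yh; have cz := strong_derivative_cont zk.
rewrite -(Int_FTC yz) ?IntD; [ring|exact: contM|exact: contM|].
by apply: contD; exact: contM.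
Qed.

End Integral.

(** * Moments of functions of bounded variation *)

Section BoundedVariation.
Variable R : realType.
Implicit Types (h w : R -> R) (p G : {poly R}).

(** For [h] of bounded variation, [T] is the variation of [h] up to [t]. Only the increments
    of [T] are used, and they are additive. *)
Definition tv_dominated h (T : R -> R) := forall s t, tdom s -> tdom t -> s <= t ->
  `|h t - h s| <= T t - T s.

Lemma bounded_variation_tv_dominated h : bounded_variation (-1) 1 h ->
  exists T, tv_dominated h T.
Proof.
move=> bv; exists (fun t => fine (total_variation (-1) t h)).
have fn t : -1 <= t <= 1 -> total_variation (-1) t h \is a fin_num.
  move=> /andP[t1 t2]; apply/bounded_variationP => //.
  exact: bounded_variationl bv.
move=> s t /tdomP/andP[s1 s2] /tdomP/andP[t1 t2] st.
have ft : total_variation (-1) t h \is a fin_num by rewrite fn ?t1.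
have fs : total_variation (-1) s h \is a fin_num by rewrite fn ?s1.
have e := total_variationD h s1 st.
have fst : total_variation s t h \is a fin_num.
  by move: ft; rewrite e fin_numD => /andP[].
have -> : fine (total_variation (-1) t h) - fine (total_variation (-1) s h)
    = fine (total_variation s t h) by rewrite e fineD //; ring.
rewrite -lee_fin fineK //.
exact: total_variation_ge.
Qed.

Lemma dominated_bounded h T : tv_dominated h T ->
  exists2 C, 0 <= C & forall t, tdom t -> `|h t| <= C.
Proof.
move=> hT; exists (`|h (-1)| + `|T 1 - T (-1)|); first by rewrite addr_ge0.
move=> t tt; have [t1 t2] := andP (proj1 (tdomP t) tt).
have h1 := hT _ _ (tdomN1 R) tt t1; have h2 := hT _ _ tt (tdom1 R) t2.
rewrite -[h t](subrK (h (-1))) addrC (le_trans (ler_normD _ _)) // lerD2l.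
apply: le_trans h1 _; apply: le_trans (ler_norm _).
by have := normr_ge0 (h 1 - h t); lra.
Qed.

(** The integral of [h G'] over [tdom], for [h] of bounded variation, is at most the
    variation of [h] times the supremum of [|G|]. As [h] is only known as a derivative,
    the integral is expressed by parts, through [w]. On a short interval, the mean value
    theorem compares the increment of the integral, minus [h G], with that of [h] times the
    supremum of [|G|], up to an error which disappears when the increments are added over finer
    and finer subdivisions. *)
Lemma variation_estimate w h T G M :
  strong_derivative w h -> tv_dominated h T -> G.[-1] = 0 -> G.[1] = 0 ->
  (forall t, tdom t -> `|G.[t]| <= M) ->
  `|w 1 * G^`().[1] - w (-1) * G^`().[-1] - Int (fun t => w t * G^`()^`().[t])|
    <= (T 1 - T (-1)) * M.
Proof.
move=> wh hT G0 G1 GM.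
have cw := strong_derivative_cont wh.
have cwG : cont (fun t => w t * G^`()^`().[t]) by apply: contM => //; exact: cont_poly.
have [W W0 dW] := cont_primitive cwG.
have -> : Int (fun t => w t * G^`()^`().[t]) = W 1 - W (-1) by exact: Int_FTC.
pose Phi t := w t * G^`().[t] - W t.
have dPhi : strong_derivative Phi (fun t => h t * G^`().[t]).
  apply: (strong_derivative_eq _ _ (strong_derivativeB
    (strong_derivativeM wh (@strong_derivative_poly _ G^`())) dW)) => // t _.
  by rewrite /= addrK.
pose Psi t := Phi t - h t * G.[t].
have [B B0 hB] := cont_bounded (@cont_poly _ G^`()).
have step s t : tdom s -> tdom t -> s < t ->
    `|Psi t - Psi s| <= (T t - T s) * (B * (t - s) + M).
  move=> ds dt st.
  have dchi : strong_derivative (fun x => Phi x - h s * G.[x])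
      (fun x => h x * G^`().[x] - h s * G^`().[x]).
    exact: (strong_derivativeB dPhi (@strong_derivativeZ _ (h s) _ _ (@strong_derivative_poly _ G))).
  have [c /andP[sc ct] ec] := mean_value dchi ds dt st.
  have dc : tdom c.
    move: ds dt => /tdomP/andP[? ?] /tdomP/andP[? ?]; apply/tdomP/andP; split; lra.
  have -> : Psi t - Psi s = (h c - h s) * G^`().[c] * (t - s) + (h s - h t) * G.[t].
    rewrite [_ * G^`().[c]]mulrBl -ec /Psi; ring.
  have hc := hT _ _ ds dc (ltW sc); have hct := hT _ _ dc dt (ltW ct).
  have hst := hT _ _ ds dt (ltW st).
  have -> : (T t - T s) * (B * (t - s) + M) =
    (T t - T s) * (B * (t - s)) + (T t - T s) * M by ring.
  rewrite (le_trans (ler_normD _ _)) // lerD // !normrM.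
    rewrite [`|t - s|]ger0_norm ?subr_ge0 ?(ltW st) // mulrA ler_wpM2r ?subr_ge0 ?(ltW st) //.
    rewrite ler_pM // ?hB //; apply: le_trans hc _.
    by have := normr_ge0 (h t - h c); lra.
  by rewrite distrC ler_pM // GM.
have Psi1 : Psi 1 - Psi (-1) = w 1 * G^`().[1] - w (-1) * G^`().[-1] - (W 1 - W (-1)).
  by rewrite /Psi /Phi G0 G1; ring.
rewrite -Psi1; apply/ler_addgt0Pr => e e0.
have TT0 : 0 <= T 1 - T (-1).
  have N11 : (-1 : R) <= 1 by lra.
  by have := hT _ _ (tdomN1 R) (tdom1 R) N11; apply: le_trans.
pose n := (Num.trunc ((T 1 - T (-1)) * B * 2 / e)).+1.
have n0 : 0 < n%:R :> R by rewrite ltr0n.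
have hn : (T 1 - T (-1)) * B * (2 / n%:R) <= e.
  rewrite mulrA ler_pdivrMr // [X in _ <= X]mulrC -ler_pdivrMr //.
  by rewrite ltW // /n truncnS_gt.
pose x k : R := -1 + k%:R * (2 / n%:R).
have dx k : (k <= n)%N -> tdom (x k).
  move=> kn; have h1 : 0 <= k%:R * (2 / n%:R) :> R by rewrite mulr_ge0 // divr_ge0.
  have h2 : k%:R * (2 / n%:R) <= 2 :> R.
    rewrite mulrA ler_pdivrMr // mulrC ler_pM2l //.
    by rewrite ler_nat.
  by apply/tdomP; rewrite /x; apply/andP; split; lra.
have xS k : x k.+1 - x k = 2 / n%:R by rewrite /x -natr1; ring.
have tn0 : 0 < 2 / n%:R :> R by rewrite divr_gt0.
have sum k : (k <= n)%N -> `|Psi (x k) - Psi (x 0%N)| <=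
    (T (x k) - T (x 0%N)) * (B * (2 / n%:R) + M).
  elim: k => [|k ih] kn; first by rewrite !subrr normr0 mul0r.
  have -> : Psi (x k.+1) - Psi (x 0%N) =
    (Psi (x k.+1) - Psi (x k)) + (Psi (x k) - Psi (x 0%N)) by ring.
  have -> : T (x k.+1) - T (x 0%N) = (T (x k.+1) - T (x k)) + (T (x k) - T (x 0%N)) by ring.
  rewrite (le_trans (ler_normD _ _)) // mulrDl lerD ?ih ?(ltnW kn) //.
  have := @step (x k) (x k.+1); rewrite xS; apply; [exact/dx/ltnW|exact: dx|].
  by rewrite -subr_gt0 xS.
have xn : x n = 1 by rewrite /x mulrCA divff ?gt_eqF //; ring.
have x0 : x 0%N = -1 by rewrite /x mul0r addr0.
have := sum n (leqnn n); rewrite xn x0 => H; apply: le_trans H _.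
rewrite mulrDr addrC lerD2l; apply: le_trans hn; rewrite mulrA //.
Qed.

End BoundedVariation.

Section Coefficients.
Variable R : realType.
Local Notation L := (legendre R).
Implicit Types (y w h : R -> R).

Definition moment y n : R := Int (fun t => (L n).[t] * y t).

(** The value of [moment h n] for a derivative [h] of [w], computed by parts. *)
Definition moment_parts w n : R :=
  w 1 - w (-1) * (-1) ^+ n - Int (fun t => w t * (L n)^`().[t]).

(** This is [n ^ (- s - 3/2)], in a form free of real exponents. *)
Definition decay (s n : nat) : R := (n%:R ^+ s * (n%:R * Num.sqrt n%:R))^-1.

Lemma moment_partsE w h n : strong_derivative w h -> cont h -> moment_parts w n = moment h n.
Proof.
move=> wh ch; rewrite /moment_parts /moment.
have e := Int_parts wh (@strong_derivative_poly _ (L n)) ch (@cont_poly _ _).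
rewrite e legendre_1 legendre_N1 mulr1.
have -> : Int (fun t => h t * (L n).[t]) = Int (fun t => (L n).[t] * h t).
  by apply: eq_Int => t _; rewrite mulrC.
ring.
Qed.

Lemma moment_recurrence w n : cont w ->
  moment w n.+1 = (moment_parts w n - moment_parts w n.+2) / (2 * n.+1 + 1)%:R.
Proof.
move=> cw.
have k0 : (2 * n.+1 + 1)%:R != 0 :> R by rewrite pnatr_eq0 addn1.
apply: (mulIf k0); rewrite divfK // mulrC /moment -IntZ; last first.
  by apply: contM => //; exact: cont_poly.
have -> : Int (fun t => (2 * n.+1 + 1)%:R * ((L n.+1).[t] * w t)) =
  Int (fun t => w t * (L n.+2)^`().[t] - w t * (L n)^`().[t]).
  apply: eq_Int => t _; rewrite legendre_recurrence hornerD hornerZ; ring.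
rewrite IntB; [|by apply: contM => //; exact: cont_poly..].
by rewrite /moment_parts !exprS; ring.
Qed.

(** The primitive of [L_n] vanishing at both ends is [- (1 - t^2) L_n' / (n (n + 1))], by
    Legendre's equation, and is of order [n ^ (- 3/2)]. *)
Lemma moment_parts_bound w h T n : strong_derivative w h -> tv_dominated h T -> (0 < n)%N ->
  `|moment_parts w n| <= (T 1 - T (-1)) * decay 0 n.
Proof.
move=> wh hT n0.
pose c : R := n%:R * n.+1%:R; have c0 : 0 < c by exact: nn1_gt0.
pose G : {poly R} := - c^-1 *: ((1 - 'X^2) * (L n)^`()).
have dG : G^`() = L n.
  rewrite /G derivZ legendre_ode scalerA mulrNN mulVf ?scale1r //.
  by rewrite gt_eqF.
have := @variation_estimate _ w h T G (decay 0 n) wh hT.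
rewrite dG legendre_1 legendre_N1 mulr1; apply.
- by rewrite /G hornerZ one_subX2_N1 mulr0.
- by rewrite /G hornerZ one_subX2_1 mulr0.
move=> t /tdomP tt; have := legendre_deriv_bound n0 tt.
rewrite -/c => hb; rewrite /G hornerZ mulNr normrN normrM.
have -> : ((1 - 'X^2) * (L n)^`()).[t] = (1 - t ^+ 2) * (L n)^`().[t].
  by rewrite !horner_ringE.
set v := _ * _ in hb *.
have nn : 0 < n%:R :> R by rewrite ltr0n.
rewrite -ler_sqr ?nnegrE ?mulr_ge0 ?invr_ge0 ?sqrtr_ge0 //.
have -> : decay 0 n ^+ 2 = (n%:R ^+ 2 * n%:R)^-1.
  by rewrite /decay expr0 mul1r exprVn exprMn sqr_sqrtr.
rewrite exprMn !real_normK ?num_real //.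
apply: (@le_trans _ _ (c^-1 ^+ 2 * (c * (2 / (2 * n + 1)%:R)))).
  by rewrite ler_wpM2l // sqr_ge0.
have d0 : 0 < (2 * n + 1)%:R :> R by rewrite ltr0n addn1.
have -> : c^-1 ^+ 2 * (c * (2 / (2 * n + 1)%:R)) = 2 / (c * (2 * n + 1)%:R).
  by field; rewrite !gt_eqF.
rewrite ler_pdivrMr ?mulr_gt0 // mulrC ler_pdivlMr ?mulr_gt0 ?exprn_gt0 //.
rewrite /c -natr1 natrD natrM; nra.
Qed.

Lemma decay_ge0 s n : 0 <= decay s n.
Proof. by rewrite invr_ge0 mulr_ge0 ?exprn_ge0 ?mulr_ge0 ?sqrtr_ge0. Qed.

Lemma decay_monotone s n k : (0 < n)%N -> (n <= k)%N -> decay s k <= decay s n.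
Proof.
move=> n0 nk; have k0 : (0 < k)%N by exact: leq_trans nk.
have nn : 0 < n%:R :> R by rewrite ltr0n.
have kk : 0 < k%:R :> R by rewrite ltr0n.
have le : n%:R <= k%:R :> R by rewrite ler_nat.
rewrite lef_pV2 ?posrE ?mulr_gt0 ?exprn_gt0 ?sqrtr_gt0 //.
rewrite ler_pM ?exprn_ge0 ?mulr_ge0 ?sqrtr_ge0 //; last first.
  by rewrite ler_pM ?sqrtr_ge0 // ler_wsqrtr.
by rewrite lerXn2r ?nnegrE // ltW.
Qed.

Lemma decay_shift s n : (0 < n)%N -> decay s n <= 2 ^+ s.+2 * decay s n.+1.
Proof.
move=> n0; have nn : 0 < n%:R :> R by rewrite ltr0n.
have le : n.+1%:R <= 2 * n%:R :> R by rewrite -natrM ler_nat; lia.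
have dn k : (0 < k)%N -> 0 < k%:R ^+ s * (k%:R * Num.sqrt k%:R) :> R.
  by move=> k0; rewrite mulr_gt0 ?exprn_gt0 ?mulr_gt0 ?sqrtr_gt0 ?ltr0n.
rewrite /decay ler_pdivlMr ?dn // mulrC ler_pdivrMr ?dn //.
have -> : 2 ^+ s.+2 * (n%:R ^+ s * (n%:R * Num.sqrt n%:R)) =
   (2 * n%:R) ^+ s * ((2 * n%:R) * (2 * Num.sqrt n%:R)) :> R.
  by rewrite exprMn !exprS; ring.
rewrite ler_pM ?exprn_ge0 ?mulr_ge0 ?sqrtr_ge0 //.
  by rewrite lerXn2r ?nnegrE // mulr_ge0.
rewrite ler_pM ?sqrtr_ge0 // -ler_sqr ?nnegrE ?mulr_ge0 ?sqrtr_ge0 //.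
rewrite exprMn !sqr_sqrtr // (le_trans le) // ler_wpM2r //.
by rewrite -natrX ler_nat.
Qed.

Lemma decayS s n : decay s.+1 n = n%:R^-1 * decay s n.
Proof. by rewrite /decay exprS -mulrA invfM. Qed.

Lemma recurrence_decay w (C : R) s n0 :
  cont w -> (forall n, (n0 <= n)%N -> `|moment_parts w n| <= C * decay s n) ->
  0 <= C -> forall n, (n0.+2 <= n)%N -> `|moment w n| <= (C * 2 ^+ s.+2) * decay s.+1 n.
Proof.
move=> cw h C0 [|n] //; rewrite ltnS => hn.
rewrite moment_recurrence // normrM normfV normr_nat ler_pdivrMr; last first.
  by rewrite ltr0n addn1.
have n0' : (0 < n)%N by exact: leq_trans hn.
have b1 : `|moment_parts w n| <= C * 2 ^+ s.+2 * decay s n.+1.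
  apply: le_trans (h n (ltnW hn)) _.
  by rewrite -mulrA ler_wpM2l // decay_shift.
have b2 : `|moment_parts w n.+2| <= C * 2 ^+ s.+2 * decay s n.+1.
  have n02 : (n0 <= n.+2)%N by exact: leq_trans (ltnW hn) (leq_trans (leqnSn n) (leqnSn _)).
  apply: le_trans (h n.+2 n02) _.
  rewrite -mulrA ler_wpM2l //.
  apply: le_trans (decay_monotone _ _ (leqnSn n.+1)) _ => //.
  by rewrite ler_peMl ?decay_ge0 // exprn_ege1 // ler1n.
apply: le_trans (ler_normB _ _) _; apply: le_trans (lerD b1 b2) _.
rewrite decayS.
set A := C * _; set d := decay s n.+1.
have A0 : 0 <= A * d by rewrite mulr_ge0 ?decay_ge0 // mulr_ge0 // exprn_ge0.
have -> : A * (n.+1%:R^-1 * d) * (2 * n.+1 + 1)%:R = A * d * (2 + n.+1%:R^-1).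
  by rewrite natrD natrM; field.
set z := A * d in A0 *; set iv := _^-1.
have : 0 <= z * iv by rewrite mulr_ge0 // invr_ge0.
rewrite mulrDr; lra.
Qed.

(** Every strong derivative gains a factor [1 / n], by the recurrence; the last function of the
    chain, known only through its variation, gives the initial estimate. *)
Lemma moment_decay s (ys : nat -> R -> R) T :
  (forall j, (j <= s)%N -> strong_derivative (ys j) (ys j.+1)) ->
  tv_dominated (ys s.+1) T ->
  exists2 C, 0 <= C & exists n0, forall n, (n0 <= n)%N -> `|moment (ys 0%N) n| <= C * decay s.+1 n.
Proof.
elim: s ys => [|s ih] ys dys hT.
  have c0 := strong_derivative_cont (dys 0%N isT).
  have T0 : 0 <= T 1 - T (-1).
    have N11 : (-1 : R) <= 1 by lra.
    by have := hT _ _ (tdomN1 R) (tdom1 R) N11; apply: le_trans.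
  exists ((T 1 - T (-1)) * 2 ^+ 2); first by rewrite mulr_ge0.
  exists 3%N; apply: recurrence_decay => // n hn.
  by apply: moment_parts_bound hT _ => //; exact: dys.
have [||C C0 [n0 hn0]] := ih (fun j => ys j.+1); [by move=> j js; exact: dys|by []|].
have c0 := strong_derivative_cont (dys 0%N isT).
have c1 := strong_derivative_cont (dys 1%N isT).
exists (C * 2 ^+ s.+3); first by rewrite mulr_ge0 // exprn_ge0.
exists n0.+2; apply: recurrence_decay => // n hn.
by rewrite (moment_partsE _ (dys 0%N isT)) // hn0.
Qed.

Definition legendre_coef y n : R := (n%:R + 2^-1) * moment y n.

Definition legendre_sum y K : {poly R} := \sum_(n < K.+1) legendre_coef y n *: L n.

Lemma size_lsum y K : (size (legendre_sum y K) <= K.+1)%N.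
Proof.
apply: (leq_trans (size_sum _ _ _)); apply/bigmax_leqP => k _.
by rewrite (leq_trans (size_scale_leq _ _)) // size_legendre ltn_ord.
Qed.

Lemma legendre_sum_coef y K n : (n <= K)%N ->
  (n%:R + 2^-1) * pint (L n * legendre_sum y K) = legendre_coef y n.
Proof.
move=> nK; rewrite /legendre_sum mulr_sumr pint_sum.
have nK' : (n < K.+1)%N by [].
rewrite (bigD1 (Ordinal nK')) //= big1 ?addr0 => [|j ji].
  rewrite -scalerAr pintZ legendre_norm mulrCA [X in _ * X](_ : _ = 1) ?mulr1 //.
  rewrite natrD natrM; field.
  by rewrite -natrM natr1 pnatr_eq0.
rewrite -scalerAr pintZ legendre_orth ?mulr0 // eq_sym.
by apply: contra ji => /eqP e; apply/eqP/val_inj.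
Qed.

Lemma legendre_sum_orth y K (p : {poly R}) : cont y -> (size p <= K.+1)%N ->
  Int (fun t => (y t - (legendre_sum y K).[t]) * p.[t]) = 0.
Proof.
move=> cy sp.
have -> : Int (fun t => (y t - (legendre_sum y K).[t]) * p.[t]) =
   Int (fun t => y t * p.[t]) - pint (legendre_sum y K * p).
  rewrite -Int_poly -IntB; [|by apply: contM => //; exact: cont_poly|exact: cont_poly].
  by apply: eq_Int => t _; rewrite hornerM mulrBl.
have [c ->] := legendre_span sp.
rewrite mulr_sumr pint_sum.
have -> : Int (fun t => y t * (\sum_(i < K.+1) c i *: L i).[t]) =
    Int (fun t => \sum_(i < K.+1) y t * (c i *: L i).[t]).
  by apply: eq_Int => t _; rewrite horner_sum mulr_sumr.
rewrite Int_sum => [|i]; last by apply: contM => //; exact: cont_poly.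
rewrite -sumrB big1 // => i _.
have -> : Int (fun t => y t * (c i *: L i).[t]) = c i * moment y i.
  rewrite -IntZ; last by apply: contM => //; exact: cont_poly.
  by apply: eq_Int => t _; rewrite hornerZ; ring.
rewrite -scalerAr pintZ [_ * L i]mulrC -mulrBr.
have k0 : (i : nat)%:R + 2^-1 != 0 :> R.
  by rewrite gt_eqF // ltr_wpDl // invr_gt0.
have := @legendre_sum_coef y K i (leq_ord i); rewrite /legendre_coef => /(mulfI k0) ->.
by rewrite subrr mulr0.
Qed.

(** Completeness of polynomials, in the form of a maximum principle: a function which
    no polynomial distinguishes from functions that are bounded by [E] is itself bounded
    by [E]. If it exceeded [E] near [t0], the peaking kernel [(1 - (t - t0)^2/4)^n]
    would detect it for [n] large. *)
Lemma peaking (d : R -> R) (E : R) (D : nat -> {poly R}) :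
  cont d -> (forall M t, tdom t -> `|(D M).[t]| <= E) ->
  (forall p : {poly R}, exists M, Int (fun t => (d t - (D M).[t]) * p.[t]) = 0) ->
  forall t, tdom t -> d t <= E.
Proof.
move=> cd hD orth t0 dt0; rewrite leNgt; apply/negP => lt.
pose c := (d t0 - E) / 2; have c0 : 0 < c by rewrite divr_gt0 ?subr_gt0.
have [e e0 he] : exists2 e, 0 < e <= 1 & forall t, tdom t -> `|t - t0| < e -> E + c <= d t.
  have /cvgrPdist_lt/(_ c c0) := (subspace_continuousP _ _).1 cd t0 dt0.
  rewrite /within /= => /nbhs_ballP[e /= e0 he].
  exists (Num.min e 1); first by rewrite lt_min e0 ltr01 ge_min lexx orbT.
  move=> t dt; rewrite lt_min => /andP[te _].
  have : `|d t0 - d t| < c by apply: he => //; rewrite /ball /= distrC.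
  by rewrite ltr_norml => /andP[_]; rewrite /c; lra.
have [e1 e2] := andP e0.
have [B B0 hB] := cont_bounded cd.
have E0 : 0 <= E by apply: le_trans (hD 0%N _ dt0).
pose Q : {poly R} := 1 - 4^-1 *: ('X - t0%:P) ^+ 2.
have Qt t : Q.[t] = 1 - 4^-1 * (t - t0) ^+ 2.
  by rewrite /Q !horner_ringE; ring.
have Q01 t : tdom t -> 0 <= Q.[t] <= 1.
  move: dt0 => /tdomP/andP[a1 a2] /tdomP/andP[b1 b2]; rewrite Qt.
  have : 0 <= (2 - (t - t0)) * (2 + (t - t0)) by rewrite mulr_ge0; lra.
  by have := sqr_ge0 (t - t0) => ? ?; apply/andP; split; lra.
pose al := 1 - e ^+ 2 / 16; pose be := 1 - e ^+ 2 / 4.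
have be0 : 0 < be by rewrite /be; nra.
have bal : be < al by rewrite /be /al; nra.
have far t : tdom t -> e <= `|t - t0| -> Q.[t] <= be.
  move=> dt h; have : e ^+ 2 <= (t - t0) ^+ 2.
    by rewrite -[_ ^+ 2 in X in _ <= X]real_normK ?num_real // lerXn2r ?nnegrE // ltW.
  by rewrite Qt /be; lra.
have near t : `|t - t0| <= e / 2 -> al <= Q.[t].
  move=> h; have : (t - t0) ^+ 2 <= (e / 2) ^+ 2.
    rewrite -[(t - t0) ^+ 2]real_normK ?num_real // lerXn2r ?nnegrE //.
    by rewrite divr_ge0 // ltW.
  by rewrite Qt /al; lra.
have main n : c * (e / 2 * al ^+ n) <= (B + E + c) * be ^+ n * 2.
  have [M hM] := orth (Q ^+ n).
  have low : c * (e / 2 * al ^+ n) <= c * pint (Q ^+ n).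
    rewrite ler_pM2l //.
    have [a [b [ab da db hab]]] : exists a b : R, [/\ b - a = e / 2, tdom a, tdom b &
        forall t, a <= t <= b -> `|t - t0| <= e / 2].
      move: (dt0) => /tdomP/andP[a1 a2].
      have [h|h] := leP 0 t0.
        exists (t0 - e / 2), t0; split; first ring; [by apply/tdomP/andP; split; lra|by []|].
        by move=> t /andP[? ?]; rewrite ler_norml; apply/andP; split; lra.
      exists t0, (t0 + e / 2); split; first ring; [by []|by apply/tdomP/andP; split; lra|].
      by move=> t /andP[? ?]; rewrite ler_norml; apply/andP; split; lra.
    have lab : a < b by rewrite -subr_gt0 ab; lra.
    have inc : {in `[-1, 1] &, {homo horner (prim (Q ^+ n)) : x y / x <= y}}.
      apply: ler_hornerW => t; rewrite in_itv /= => /andP[t1 t2].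
      rewrite deriv_prim horner_exp exprn_ge0 //.
      by have [|] := andP (Q01 t _) => //; apply/tdomP; rewrite !ltW.
    have [t tab et] := poly_mvt (prim (Q ^+ n)) lab.
    have : e / 2 * al ^+ n <= (prim (Q ^+ n)).[b] - (prim (Q ^+ n)).[a].
      rewrite et deriv_prim ab mulrC ler_wpM2r //; first by rewrite divr_ge0 // ltW.
      rewrite horner_exp lerXn2r ?nnegrE //.
      - by rewrite /al; nra.
      - suff dt : tdom t by have /andP[] := Q01 t dt.
        move: tab da db; rewrite in_itv /= => /andP[? ?] /tdomP/andP[? ?] /tdomP/andP[? ?].
        by apply/tdomP/andP; split; lra.
      - by apply: near; apply: hab; move: tab; rewrite in_itv /= => /andP[? ?]; rewrite !ltW.
    move/le_trans; apply; rewrite /pint lerB // inc //.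
    + by rewrite in_itv /= lexx andbT; lra.
    + by move/tdomP: db => /andP[].
    + by rewrite in_itv /= lexx /=; lra.
    + by move/tdomP: da => /andP[].
  apply: le_trans low _; rewrite -subr_le0 -hM -Int_poly -IntZ; last exact: cont_poly.
  rewrite -Int_cst -IntB; [|by apply: contM; [exact: cont_cst|exact: cont_poly]|exact: cont_cst].
  apply: le_Int.
  - apply: contB; last exact: cont_cst.
    by apply: contM; [exact: cont_cst|exact: cont_poly].
  - apply: contM; last exact: cont_poly.
    by apply: contB => //; exact: cont_poly.
  move=> t dt; rewrite horner_exp.
  have [q0 q1] := andP (Q01 t dt); have q0n : 0 <= Q.[t] ^+ n by rewrite exprn_ge0.
  have bn : 0 <= be ^+ n by rewrite exprn_ge0 // ltW.
  have := hD M t dt; rewrite ler_norml => /andP[D1 D2].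
  have := hB t dt; rewrite ler_norml => /andP[B1 B2].
  have [h|h] := ltP `|t - t0| e.
    have h1 := he t dt h.
    have : c * Q.[t] ^+ n <= (d t - (D M).[t]) * Q.[t] ^+ n by rewrite ler_wpM2r //; lra.
    have : 0 <= (B + E + c) * be ^+ n by rewrite mulr_ge0 //; lra.
    lra.
  have qb : Q.[t] ^+ n <= be ^+ n.
    by apply: lerXn2r; rewrite ?nnegrE ?(ltW be0) //; exact: far.
  have : - (B + E) * Q.[t] ^+ n <= (d t - (D M).[t]) * Q.[t] ^+ n by rewrite ler_wpM2r //; lra.
  have : (B + E + c) * Q.[t] ^+ n <= (B + E + c) * be ^+ n by rewrite ler_wpM2l //; lra.
  lra.
have al0 : 0 < al by rewrite (lt_trans be0).
have r1 : `|be / al| < 1.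
  by rewrite ger0_norm ?divr_ge0 ?ltW // ltr_pdivrMr // mul1r.
pose k := c * (e / 2) / ((B + E + c) * 2).
have Bc0 : 0 < (B + E + c) * 2 by rewrite mulr_gt0 //; lra.
have k0 : 0 < k by rewrite divr_gt0 // mulr_gt0 // divr_gt0.
have /cvgrPdist_lt/(_ k k0)[n _ hn] := cvg_expr r1.
have /= := hn n (leqnn n); rewrite sub0r normrN ger0_norm ?exprn_ge0 ?divr_ge0 ?ltW //.
rewrite ltNge => /negP; apply; rewrite expr_div_n ler_pdivlMr ?exprn_gt0 //.
rewrite /k mulrAC ler_pdivrMr //.
have := main n; lra.
Qed.

End Coefficients.

(** * Truncated Legendre expansions *)

Section Truncation.
Variable R : realType.
Local Notation L := (legendre R).
Implicit Types (y : R -> R) (t : R).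

Let rs (n : nat) : R := (Num.sqrt n%:R)^-1.

(** Comparison of [n ^ (- 3/2)] with the differences of [2 n ^ (- 1/2)]. *)
Lemma decay_telescope n : (0 < n)%N -> decay R 0 n.+1 <= 2 * (rs n - rs n.+1).
Proof.
move=> n0; rewrite /decay expr0 mul1r /rs.
set a := Num.sqrt n%:R; set b := Num.sqrt n.+1%:R.
have a0 : 0 < a by rewrite sqrtr_gt0 ltr0n.
have b0 : 0 < b by rewrite sqrtr_gt0 ltr0n.
have a2 : a ^+ 2 = n%:R by rewrite sqr_sqrtr.
have b2 : b ^+ 2 = n%:R + 1 by rewrite sqr_sqrtr // natr1.
have ab : a < b by rewrite ltr_sqrt ?ltr0n // ltr_nat.
rewrite -natr1 -b2.
have -> : 2 * (a^-1 - b^-1) = 2 * (b - a) / (a * b) by field; rewrite !gt_eqF.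
rewrite ler_pdivlMr ?mulr_gt0 // mulrC ler_pdivrMr ?mulr_gt0 ?exprn_gt0 //.
have e : (b - a) * (b + a) = 1 by rewrite -subr_sqr b2 a2 addrC addKr.
have h : 1 <= (b - a) * (2 * b).
  have : (b - a) * (b + a) <= (b - a) * (2 * b) by rewrite ler_pM2l ?subr_gt0 //; lra.
  by rewrite e.
have h2 : a * b <= b * b by rewrite ler_pM2r // ltW.
have -> : 2 * (b - a) * (b ^+ 2 * b) = (b - a) * (2 * b) * (b * b) by ring.
apply: le_trans h2 _; rewrite -[X in X <= _]mul1r ler_pM2r // mulr_gt0 //.
Qed.

Lemma decay_split s K n : (0 < K)%N -> (K <= n)%N ->
  decay R s n <= (K%:R ^+ s)^-1 * decay R 0 n.
Proof.
move=> K0 Kn; have n0 : (0 < n)%N by exact: leq_trans Kn.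
rewrite /decay expr0 mul1r invfM ler_wpM2r ?invr_ge0 ?mulr_ge0 ?sqrtr_ge0 //.
rewrite lef_pV2 ?posrE ?exprn_gt0 ?ltr0n //.
by rewrite lerXn2r ?nnegrE // ler_nat.
Qed.

Section Decaying.
Variables (y : R -> R) (C : R) (s n0 : nat).
Hypothesis cy : cont y.
Hypothesis C0 : 0 <= C.
Hypothesis yC : forall n, (n0 <= n)%N -> `|moment y n| <= C * decay R s.+1 n.

Lemma legendre_coef_decay n : (n0 <= n)%N -> (0 < n)%N -> `|legendre_coef y n| <= 2 * C * decay R s n.
Proof.
move=> h nn; rewrite /legendre_coef normrM ger0_norm ?addr_ge0 ?invr_ge0 //.
have n1 : 1 <= n%:R :> R by rewrite ler1n.
apply: (@le_trans _ _ (2 * n%:R * (C * decay R s.+1 n))).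
  by rewrite ler_pM ?addr_ge0 ?invr_ge0 ?yC //; lra.
rewrite decayS -[X in X <= _](_ : (n%:R * n%:R^-1) * (2 * C * decay R s n) = _); last ring.
by rewrite divff ?mul1r // pnatr_eq0 -lt0n.
Qed.

Lemma legendre_sumS K : legendre_sum y K.+1 = legendre_sum y K + legendre_coef y K.+1 *: L K.+1.
Proof. by rewrite /legendre_sum big_ord_recr. Qed.

Lemma legendre_sum_tail K j t : (n0 <= K)%N -> (0 < K)%N -> tdom t ->
  `|(legendre_sum y (K + j)).[t] - (legendre_sum y K).[t]| <=
    4 * C * (K%:R ^+ s)^-1 * (rs K - rs (K + j)).
Proof.
move=> h K0 tt; elim: j => [|j ih]; first by rewrite addn0 !subrr normr0 mulr0.
rewrite addnS legendre_sumS hornerD hornerZ.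
set A := (legendre_sum y (K + j)).[t] in ih *; set B := (legendre_sum y K).[t] in ih *.
have -> : A + legendre_coef y (K + j).+1 * (L (K + j).+1).[t] - B =
   (A - B) + legendre_coef y (K + j).+1 * (L (K + j).+1).[t] by ring.
have -> : rs K - rs (K + j).+1 = (rs K - rs (K + j)) + (rs (K + j) - rs (K + j).+1) by ring.
rewrite (le_trans (ler_normD _ _)) // mulrDr lerD // normrM.
have Kj : (K <= (K + j).+1)%N by rewrite leqW // leq_addr.
apply: (@le_trans _ _ (2 * C * decay R s (K + j).+1 * 1)).
  rewrite ler_pM ?legendre_coef_decay //; first exact: leq_trans Kj.
  by apply: legendre_le1; apply/tdomP.
have k0 : 0 <= 2 * C * (K%:R ^+ s)^-1.
  by rewrite mulr_ge0 ?invr_ge0 ?exprn_ge0 // mulr_ge0.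
apply: (@le_trans _ _ (2 * C * (K%:R ^+ s)^-1 * (2 * (rs (K + j) - rs (K + j).+1)))).
  rewrite mulr1 -[X in _ <= X]mulrA ler_wpM2l ?mulr_ge0 //.
  apply: le_trans (decay_split _ K0 Kj) _.
  by rewrite ler_wpM2l ?invr_ge0 ?exprn_ge0 // decay_telescope // addn_gt0 K0.
by rewrite le_eqVlt; apply/orP; left; apply/eqP; ring.
Qed.

Definition tail_bound K : R := 4 * C * (K%:R ^+ s * Num.sqrt K%:R)^-1.

Lemma legendre_sum_tail_le K j t : (n0 <= K)%N -> (0 < K)%N -> tdom t ->
  `|(legendre_sum y (K + j)).[t] - (legendre_sum y K).[t]| <= tail_bound K.
Proof.
move=> h K0 tt; apply: le_trans (legendre_sum_tail j h K0 tt) _.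
rewrite /tail_bound invfM mulrA ler_wpM2l //.
  by rewrite mulr_ge0 ?invr_ge0 ?exprn_ge0 // mulr_ge0.
by rewrite lerBlDr lerDl invr_ge0 sqrtr_ge0.
Qed.

(** The partial sums beyond [K] differ from the [K]-th one by at most the bound of the tail, and
    no polynomial distinguishes [y] from all of them. *)
Lemma legendre_sum_approx K t : (n0 <= K)%N -> (0 < K)%N -> tdom t ->
  `|(legendre_sum y K).[t] - y t| <= tail_bound K.
Proof.
move=> h K0 tt; rewrite distrC ler_norml; apply/andP.
have cS k : cont (horner (legendre_sum y k)) by exact: cont_poly.
have O (p : {poly R}) : Int (fun t => (y t - (legendre_sum y (K + size p)).[t]) * p.[t]) = 0.
  by apply: legendre_sum_orth => //; rewrite leqW // leq_addl.
split.
  rewrite lerNl.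
  apply: (@peaking R (fun t => - (y t - (legendre_sum y K).[t])) (tail_bound K)
    (fun M => - (legendre_sum y (K + M) - legendre_sum y K))) => //.
  - by apply: contN; apply: contB.
  - by move=> M u uu; rewrite hornerN normrN hornerD hornerN legendre_sum_tail_le.
  move=> p; exists (size p); rewrite -[RHS]oppr0 -(O p) -[RHS]mulN1r -IntZ; last first.
    by apply: contM; [apply: contB|exact: cont_poly].
  by apply: eq_Int => u _; rewrite !(hornerN, hornerD); ring.
apply: (@peaking R (fun t => y t - (legendre_sum y K).[t]) (tail_bound K)
    (fun M => legendre_sum y (K + M) - legendre_sum y K)) => //.
- exact: contB.
- by move=> M u uu; rewrite hornerD hornerN legendre_sum_tail_le.
move=> p; exists (size p); rewrite -[RHS](O p).
by apply: eq_Int => u _; rewrite !(hornerN, hornerD); ring.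
Qed.

Lemma legendre_coef_summable : exists A, forall K, \sum_(n < K.+1) `|legendre_coef y n| <= A.
Proof.
pose S K : R := \sum_(n < K.+1) `|legendre_coef y n|.
pose k := n0.+1.
have Sn i j : S i <= S (i + j)%N.
  elim: j => [|j ih]; first by rewrite addn0.
  by rewrite addnS; apply: le_trans ih _; rewrite [X in _ <= X]/S big_ord_recr lerDl.
have SS j : S (k + j)%N <= S k + 4 * C * (rs k - rs (k + j)).
  elim: j => [|j ih]; first by rewrite addn0 subrr mulr0 addr0.
  rewrite addnS {1}/S big_ord_recr /= -/(S _).
  have -> : rs k - rs (k + j).+1 = (rs k - rs (k + j)) + (rs (k + j) - rs (k + j).+1) by ring.
  rewrite mulrDr addrA lerD //.
  apply: le_trans (legendre_coef_decay _ _) _ => //; first by rewrite leqW // leqW // leq_addr.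
  apply: (@le_trans _ _ (2 * C * (2 * (rs (k + j) - rs (k + j).+1)))).
    rewrite ler_wpM2l ?mulr_ge0 //.
    have k1 : (1 <= (k + j).+1)%N by [].
    apply: le_trans (decay_split _ (ltn0Sn 0) k1) _.
    by rewrite expr1n invr1 mul1r decay_telescope.
  by rewrite le_eqVlt; apply/orP; left; apply/eqP; ring.
exists (S k + 4 * C * rs k) => K.
have [h|h] := leqP k K.
  rewrite -(subnKC h); apply: le_trans (SS _) _.
  by rewrite lerD2l ler_wpM2l ?mulr_ge0 // lerBlDr lerDl invr_ge0 sqrtr_ge0.
apply: (@le_trans _ _ (S k)); first by rewrite -(subnKC (ltnW h)); exact: Sn.
by rewrite lerDl mulr_ge0 ?invr_ge0 ?sqrtr_ge0 // mulr_ge0.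
Qed.

End Decaying.

Definition prim_at (c : R) (p : {poly R}) : {poly R} := prim p + (c - (prim p).[-1])%:P.

Lemma prim_at_N1 c p : (prim_at c p).[-1] = c.
Proof. by rewrite hornerD hornerC addrC subrK. Qed.

Lemma deriv_prim_at c p : (prim_at c p)^`() = p.
Proof. by rewrite derivD derivC addr0 deriv_prim. Qed.

Lemma size_prim_at c (p : {poly R}) n : (size p <= n)%N -> (size (prim_at c p) <= n.+1)%N.
Proof.
move=> sp; rewrite (leq_trans (size_polyD _ _)) // geq_max.
by rewrite (leq_trans (size_prim _)) // (leq_trans (size_polyC_leq1 _)).
Qed.

(** Iterated primitives of the truncated expansion, with the initial values of the
    functions [Y j], each of which is a primitive of the preceding one. *)
Fixpoint approximant (Y : nat -> R -> R) K j : {poly R} :=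
  if j is j'.+1 then prim_at (Y j (-1)) (approximant Y K j') else legendre_sum (Y 0%N) K.

Section Approximants.
Variables (Y : nat -> R -> R) (J K : nat).
Hypothesis cY : cont (Y 0%N).
Hypothesis dY : forall j, (j < J)%N -> strong_derivative (Y j.+1) (Y j).
Hypothesis JK : (J <= K.+1)%N.
Local Notation P := (approximant Y K).

Lemma size_approximant j : (size (P j) <= K.+1 + j)%N.
Proof.
elim: j => [|j ih]; first by rewrite addn0 size_lsum.
by rewrite addnS size_prim_at.
Qed.

Lemma deriv_approximant j : (P j.+1)^`() = P j.
Proof. exact: deriv_prim_at. Qed.

Lemma derivn_approximant i j : (P (i + j))^`(i) = P j.
Proof. by elim: i => [|i ih]; rewrite ?derivn0 // derivSn addSn deriv_approximant. Qed.

Lemma approximant_N1 j : (P j.+1).[-1] = Y j.+1 (-1).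
Proof. exact: prim_at_N1. Qed.

Lemma contY j : (j <= J)%N -> cont (Y j).
Proof. by case: j => // j jJ; exact: strong_derivative_cont (dY jJ). Qed.

(** The error of a truncated expansion is orthogonal to polynomials of degree at most [K],
    so its iterated primitives vanish at 1 as well as at -1, and retain orthogonality to
    polynomials of lower and lower degree. *)
Lemma approximant_orth j : (j <= J)%N ->
  ((0 < j)%N -> (P j).[1] = Y j 1) /\
  forall q : {poly R}, (size q + j <= K.+1)%N ->
    Int (fun t => ((P j).[t] - Y j t) * q.[t]) = 0.
Proof.
elim: j => [|j ih] jJ.
  split=> // q sq; rewrite addn0 in sq; rewrite -[RHS]oppr0 -(legendre_sum_orth cY sq).
  rewrite -[RHS]mulN1r -IntZ; first by apply: eq_Int => t _; rewrite /=; ring.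
  by apply: contM; [apply: contB => //|]; exact: cont_poly.
have [_ orth] := ih (ltnW jJ).
have de : strong_derivative (fun t => (P j.+1).[t] - Y j.+1 t) (fun t => (P j).[t] - Y j t).
  have := strong_derivativeB (@strong_derivative_poly _ (P j.+1)) (dY jJ).
  by rewrite deriv_approximant.
have ce : cont (fun t => (P j).[t] - Y j t).
  by apply: contB; [exact: cont_poly|exact/contY/ltnW].
have e1 : (P j.+1).[1] = Y j.+1 1.
  have := orth 1; rewrite size_poly1 add1n => /(_ (leq_trans jJ JK)).
  rewrite (_ : Int _ = Int (fun t => (P j).[t] - Y j t)); last first.
    by apply: eq_Int => t _; rewrite hornerE mulr1.
  rewrite (Int_FTC de ce) approximant_N1 subrr subr0 => /eqP.
  by rewrite subr_eq0 => /eqP.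
split=> // q sq.
have := Int_parts de (@strong_derivative_poly _ (prim q)) ce (@cont_poly _ _).
rewrite deriv_prim e1 approximant_N1 !subrr !mul0r subr0 sub0r => ->.
have sp : (size (prim q) + j <= K.+1)%N.
  by apply: leq_trans sq; rewrite addnS -addSn leq_add2r; exact: size_prim.
by rewrite orth // oppr0.
Qed.

Lemma approximant_error (E : R) : (forall t, tdom t -> `|(P 0%N).[t] - Y 0%N t| <= E) ->
  forall j t, (j <= J)%N -> tdom t -> `|(P j).[t] - Y j t| <= 2 ^+ j * E.
Proof.
move=> hE; elim=> [|j ih] t jJ tt; first by rewrite mul1r hE.
have de : strong_derivative (fun t => (P j.+1).[t] - Y j.+1 t) (fun t => (P j).[t] - Y j t).
  have := strong_derivativeB (@strong_derivative_poly _ (P j.+1)) (dY jJ).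
  by rewrite deriv_approximant.
rewrite exprS -mulrA; apply: (strong_derivative_bound de) => //.
  by move=> u uu; exact: ih (ltnW jJ) uu.
by rewrite approximant_N1 subrr.
Qed.

End Approximants.

End Truncation.

(** * Test functions and continuous weak derivatives *)

Section Bumps.
Variable R : realType.
Implicit Types (f y h : R -> R) (t s a c : R) (p q P : {poly R}).

Lemma near_eq_diff_at f g t l : diff_at f t l -> (exists2 d, 0 < d &
  forall s, `|s - t| < d -> f s = g s) -> diff_at g t l.
Proof.
move=> df [d d0 fg] e e0; have [d' d'0 hd'] := df e e0.
exists (Num.min d d'); first by rewrite lt_min d0.
move=> s; rewrite lt_min => /andP[sd sd'].
by rewrite -!fg ?hd' // subrr normr0.
Qed.

Lemma horner_gt0_near q t : 0 < q.[t] ->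
  exists2 d, 0 < d & forall s, `|s - t| < d -> 0 < q.[s].
Proof.
move=> qt; have /cvgrPdist_lt/(_ _ qt)/nbhs_ballP[d /= d0 hd] := @continuous_horner R q t.
exists d => // s sd; have : ball t d s by rewrite /ball /= distrC.
by move=> /hd; rewrite ltr_norml => /andP[_]; rewrite ltrBlDr ltrDl.
Qed.

Lemma horner_bounded_near q t :
  exists2 d, 0 < d & forall s, `|s - t| < d -> `|q.[s]| <= `|q.[t]| + 1.
Proof.
have /cvgrPdist_lt/(_ _ ltr01)/nbhs_ballP[d /= d0 hd] := @continuous_horner R q t.
exists d => // s sd; have : ball t d s by rewrite /ball /= distrC.
move=> /hd h; rewrite -[q.[s]](subrK q.[t]) addrC (le_trans (ler_normD _ _)) // lerD2l.
by rewrite distrC ltW.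
Qed.

Lemma is_derive_powers (f : R -> R) t (l : R) k : is_derive t 1 f l ->
  is_derive t 1 (fun s => f s ^+ k) (k%:R * f t ^+ k.-1 * l).
Proof.
move=> df; elim: k => [|k ih].
  by rewrite !mul0r; exact: is_derive_cst.
have -> : (fun s => f s ^+ k.+1) = f * (fun s => f s ^+ k).
  by apply/funext => s; rewrite exprS.
apply: is_derive_eq; rewrite -![_ *: _]/(_ * _) /=.
by case: k {ih} => [|k] /=; rewrite ?exprS -?natr1; ring.
Qed.

(** The functions [P / q ^ k * exp(- 1 / q)], cut off where [q <= 0], form a class which is
    closed under differentiation; so they are all smooth. *)
Definition expbump q P k t : R :=
  if 0 < q.[t] then P.[t] / q.[t] ^+ k * expR (- (q.[t])^-1) else 0.

Definition expbump_deriv q P k : {poly R} :=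
  P^`() * q ^+ 2 - k%:R * P * q^`() * q + P * q^`().

Lemma expRN_inv_le (x : R) n : 0 < x -> expR (- x^-1) <= n.+1`!%:R * x ^+ n.+1.
Proof.
move=> x0; have f0 : 0 < n.+1`!%:R :> R by rewrite ltr0n fact_gt0.
rewrite expRN -[X in _ <= X]invrK lef_pV2 ?posrE ?expR_gt0 ?invr_gt0 ?mulr_gt0 ?exprn_gt0 //.
have x1 : 0 <= x^-1 by rewrite invr_ge0 ltW.
apply: le_trans (expR_ge1Dxn n x1); rewrite invfM exprVn mulrC lerDr //.
Qed.

(** Near a root of [q], [exp(- 1 / q)] is at most a multiple of [q ^ (k + 2)], so the function
    is at most quadratic in the distance to the root. *)
Lemma is_derive_expbump q P k t :
  is_derive t 1 (expbump q P k) (expbump q (expbump_deriv q P k) k.+2 t).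
Proof.
apply/is_derive_diff_at.
have [qt|qt|qt] := ltgtP 0 q.[t].
- have dq := is_derive_poly q t; have dP := is_derive_poly P t.
  have q0 : q.[t] != 0 by rewrite gt_eqF.
  pose r : R -> R := fun s => (q.[s])^-1.
  have dr : is_derive t 1 r (- q.[t] ^- 2 * q^`().[t]) by exact: is_deriveV.
  have drk : is_derive t 1 (fun s => r s ^+ k)
      (k%:R * r t ^+ k.-1 * (- q.[t] ^- 2 * q^`().[t])).
    exact: is_derive_powers.
  have de : is_derive t 1 (expR \o (- r)) (expR (- r t) * - (- q.[t] ^- 2 * q^`().[t])).
    exact: is_derive1_comp.
  have D : is_derive t 1 ((horner P * (fun s => r s ^+ k)) * (expR \o (- r)))
     (expbump q (expbump_deriv q P k) k.+2 t).
    apply: is_derive_eq; rewrite /expbump qt /expbump_deriv -![_ *: _]/(_ * _) /r.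
    rewrite !fctE /= !horner_ringE.
    move: (expR _) => E.
    case: (k) => [|n] /=; first by field.
    rewrite !exprVn !exprS; field.
    by rewrite q0 expf_neq0.
  apply: near_eq_diff_at (proj1 (is_derive_diff_at _ _ _) D) _.
  have [d d0 hd] := horner_gt0_near qt; exists d => // s /hd qs.
  by rewrite /expbump qs /r -exprVn.
- have nqt : 0 < (- q).[t] by rewrite hornerN oppr_gt0.
  have [d d0 hd] := horner_gt0_near nqt.
  have b0 N j u : q.[u] < 0 -> expbump q N j u = 0.
    by move=> qu; rewrite /expbump ifF //; apply/negbTE; rewrite -leNgt ltW.
  rewrite [expbump _ (expbump_deriv _ _ _) _ _]b0 //.
  move=> e e0; exists d => // s /hd; rewrite hornerN oppr_gt0 => qs.
  by rewrite !b0 // mul0r !subr0 normr0 mulr_ge0 // ltW.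
have rq : root q t by apply/rootP.
have eq : q = (q %/ ('X - t%:P)) * ('X - t%:P).
  by move: rq; rewrite -dvdp_XsubCl => /divpK.
set q1 := q %/ _ in eq.
pose G := (k.+2`!%:R : R) *: (P * q1 ^+ 2).
rewrite {2}/expbump -qt ltxx => e e0.
have [d d0 hd] := horner_bounded_near G t.
have G0 : 0 < `|G.[t]| + 1 by rewrite ltr_wpDl.
exists (Num.min d (e / (`|G.[t]| + 1))); first by rewrite lt_min d0 divr_gt0.
move=> s; rewrite lt_min => /andP[/hd Gs]; rewrite ltr_pdivlMr // => se.
rewrite {2}/expbump -qt ltxx mul0r !subr0 /expbump; case: ifPn => qs; last first.
  by rewrite normr0 mulr_ge0 // ltW.
have x0 : q.[s] != 0 by rewrite gt_eqF.
apply: (@le_trans _ _ (`|G.[s]| * `|s - t| ^+ 2)).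
  rewrite normrM [`|expR _|]ger0_norm ?expR_ge0 //.
  apply: (@le_trans _ _ (`|P.[s] / q.[s] ^+ k| * (k.+2`!%:R * q.[s] ^+ k.+2))).
    by rewrite ler_wpM2l // expRN_inv_le.
  rewrite le_eqVlt; apply/orP; left; apply/eqP.
  have e1 : q.[s] = q1.[s] * (s - t) by rewrite {1}eq hornerM hornerXsubC.
  rewrite -[X in _ * X]ger0_norm; last by rewrite mulr_ge0 // exprn_ge0 // ltW.
  rewrite -normrX -!normrM; congr (`|_|).
  have -> : G.[s] * (s - t) ^+ 2 = k.+2`!%:R * P.[s] * q.[s] ^+ 2.
    by rewrite /G hornerZ hornerM horner_exp e1; ring.
  rewrite !exprS; move: (k.+2`!%:R) => K; field.
  by rewrite expf_neq0.
rewrite expr2 mulrA; apply: ler_wpM2r => //.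
apply: (@le_trans _ _ ((`|G.[t]| + 1) * `|s - t|)); first by rewrite ler_wpM2r.
by rewrite mulrC ltW.
Qed.

(** All derivatives are exhibited at once, so that closure properties need no induction. *)
Definition smooth f := exists2 d : nat -> R -> R, d 0%N = f &
  forall n t, is_derive t 1 (d n) (d n.+1 t).

Lemma smooth_derive1n f (d : nat -> R -> R) n : d 0%N = f ->
  (forall n t, is_derive t 1 (d n) (d n.+1 t)) -> derive1n n f = d n.
Proof.
move=> d0 dd; elim: n => [|n ih]; first by rewrite derive1n0.
rewrite derive1nS ih; apply/funext => t; rewrite derive1E.
by have [_] := dd n t.
Qed.

Lemma smooth_derivable f n t : smooth f -> derivable (derive1n n f) t 1.
Proof. by move=> [d d0 dd]; rewrite (smooth_derive1n n d0 dd); have [] := dd n t. Qed.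

Lemma smooth_expbump q : smooth (expbump q 1 0).
Proof.
pose fix N n : {poly R} := if n is m.+1 then expbump_deriv q (N m) (m.*2) else 1.
exists (fun n => expbump q (N n) n.*2) => // n t; exact: is_derive_expbump.
Qed.

Lemma smoothD f g : smooth f -> smooth g -> smooth (fun t => f t + g t).
Proof.
move=> [d d0 dd] [d' d'0 dd']; exists (fun n t => d n t + d' n t).
  by rewrite d0 d'0.
by move=> n t; have := dd n t; have := dd' n t => ? ?; exact: is_deriveD.
Qed.

Lemma smoothZ (k : R) f : smooth f -> smooth (fun t => k * f t).
Proof.
move=> [d d0 dd]; exists (fun n t => k * d n t); first by rewrite d0.
by move=> n t; have := dd n t => ?; exact: (@is_deriveZ _ _ _ (d n) k t 1 _ _).
Qed.

Lemma smooth_primitive f g : (forall t, is_derive t 1 g (f t)) -> smooth f -> smooth g.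
Proof.
move=> dg [d d0 dd]; exists (fun n => if n is m.+1 then d m else g) => //.
by case=> [|n] t; [rewrite d0|exact: dd].
Qed.

Lemma smooth_continuous f : smooth f -> continuous f.
Proof.
move=> [d d0 dd] t; rewrite -d0; apply: differentiable_continuous.
by apply/derivable1_diffP; have [] := dd 0%N t.
Qed.

Definition supported f a c := forall t, t \notin `[a, c] -> f t = 0.

Lemma test_functionP f a c : smooth f -> -1 < a -> c < 1 -> supported f a c ->
  test_function f.
Proof.
by move=> sf a1 c1 h; split; [move=> n t; exact: smooth_derivable|exists a, c].
Qed.

Definition quad a c n : {poly R} := n%:R *: (('X - a%:P) * (c%:P - 'X)).

Lemma quadE a c n t : (quad a c n).[t] = n%:R * ((t - a) * (c - t)).
Proof. by rewrite /quad !hornerE. Qed.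

Lemma expbump_supported a c n : a < c -> supported (expbump (quad a c n) 1 0) a c.
Proof.
move=> ac t; rewrite in_itv /= negb_and -!ltNge => h.
rewrite /expbump ifF //; apply/negbTE; rewrite -leNgt quadE mulr_ge0_le0 //.
by move: h => /orP[] h; [rewrite mulr_le0_ge0|rewrite mulr_ge0_le0] => //; lra.
Qed.

Lemma expbump_ge0 q t : 0 <= expbump q 1 0 t.
Proof. by rewrite /expbump; case: ifP => // _; rewrite hornerC expr0 divr1 mul1r expR_ge0. Qed.

Lemma expbump_le1 q t : expbump q 1 0 t <= 1.
Proof.
rewrite /expbump; case: ifP => // qt; rewrite hornerC expr0 divr1 mul1r expR_le1.
by rewrite oppr_le0 invr_ge0 ltW.
Qed.

Lemma expbump_gt0 a c t : a < t < c -> 0 < expbump (quad a c 1) 1 0 t.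
Proof.
move=> /andP[h1 h2]; rewrite /expbump ifT; last first.
  by rewrite quadE mul1r mulr_gt0 // subr_gt0.
by rewrite hornerC expr0 divr1 mul1r expR_gt0.
Qed.

Lemma expbump_exists a c : a < c -> exists b : R -> R, [/\ smooth b, supported b a c,
  forall t, 0 <= b t & forall t, a < t < c -> 0 < b t].
Proof.
move=> ac; exists (expbump (quad a c 1) 1 0); split; [exact: smooth_expbump|
  exact: expbump_supported|exact: expbump_ge0|exact: expbump_gt0].
Qed.

Lemma expbump_cvg a c t : a < c ->
  expbump (quad a c n) 1 0 t @[n --> \oo] --> (\1_(`]a, c[%classic) t : R).
Proof.
move=> ac; have [/andP[h1 h2]|nin] := boolP ((a < t) && (t < c)).
  rewrite indicE mem_set /=; last by rewrite in_itv /= h1.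
  have z0 : 0 < (t - a) * (c - t) by rewrite mulr_gt0 // subr_gt0.
  rewrite -expR0; apply/cvgrPdist_lt => e e0.
  have c0 : (fun n : nat => expR (- ((t - a) * (c - t))^-1 * n.+1%:R^-1)) @ \oo --> expR (0 : R).
    apply: continuous_cvg; first exact: continuous_expR.
    rewrite -[X in _ --> X](mulr0 (- ((t - a) * (c - t))^-1)).
    by apply: cvgMr; exact: cvg_harmonic.
  move/cvgrPdist_lt/(_ e e0) : c0 => [N _ hN]; exists N.+1 => // -[//|n] /= nN.
  have := hN n nN; rewrite /expbump ifT; last by rewrite quadE mulr_gt0.
  rewrite quadE hornerC expr0 divr1 mul1r mulr1n.
  rewrite (_ : - (n.+1%:R * _)^-1 = - ((t - a) * (c - t))^-1 / n.+1%:R) //.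
  by rewrite invfM mulrC mulNr.
rewrite indicE memNset /=; last by rewrite in_itv /=; apply/negP.
rewrite (_ : (fun n => _) = fun=> 0); first exact: cvg_cst.
apply/funext => n; rewrite /expbump ifF //; apply/negbTE; rewrite -leNgt quadE mulr_ge0_le0 //.
move: nin; rewrite negb_and -!leNgt => /orP[] h.
  by have [h'|h'] := leP t c; [rewrite mulr_le0_ge0|rewrite mulr_le0_ge0] => //; lra.
by have [h'|h'] := leP a t; [rewrite mulr_ge0_le0|rewrite mulr_ge0_le0] => //; lra.
Qed.

(** The primitive vanishing at -1 vanishes beyond the support, because the integral is 0. *)
Lemma test_primitive f a c : smooth f -> -1 < a -> a < c -> c < 1 -> supported f a c ->
  Int f = 0 -> exists2 phi, test_function phi & forall t, is_derive t 1 phi (f t).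
Proof.
move=> sf a1 ac c1 sup If.
have cf : cont f by apply: cont_continuous; exact: smooth_continuous.
have [Y Y0 dY] := cont_primitive cf.
have Y1 : Y 1 = 0 by have := Int_FTC dY cf; rewrite If Y0 subr0.
have Yl t : tdom t -> t <= a -> Y t = 0.
  move=> dt ta; have [<-|tn] := eqVneq (-1) t; first by rewrite Y0.
  have lt : -1 < t by rewrite lt_neqAle tn; move/tdomP: dt => /andP[].
  have [u /andP[u1 u2]] := mean_value dY (tdomN1 R) dt lt.
  rewrite Y0 subr0 => ->; rewrite sup ?mul0r // in_itv /= negb_and -!ltNge.
  by rewrite (lt_le_trans u2 ta).
have Yr t : tdom t -> c <= t -> Y t = 0.
  move=> dt ct; have [->|tn] := eqVneq t 1; first by rewrite Y1.
  have lt : t < 1 by rewrite lt_neqAle tn; move/tdomP: dt => /andP[].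
  have [u /andP[u1 u2]] := mean_value dY dt (tdom1 R) lt.
  rewrite Y1 sub0r => /eqP; rewrite sup ?mul0r ?oppr_eq0 ?in_itv /= ?negb_and -?ltNge.
    by move/eqP.
  by rewrite (le_lt_trans ct u1) orbT.
pose phi t := Y (clamp t).
have phil t : t <= a -> phi t = 0.
  move=> ta; have [h|h] := leP (-1) t.
    by rewrite /phi clamp_id ?Yl //; apply/tdomP; rewrite h; lra.
  by rewrite /phi /clamp (min_idPr _) ?(max_idPl _) ?Y0 //; lra.
have phir t : c <= t -> phi t = 0.
  move=> ct; have [h|h] := leP t 1.
    by rewrite /phi clamp_id ?Yr //; apply/tdomP; rewrite h andbT; lra.
  by rewrite /phi /clamp (min_idPl _) ?(max_idPr _) ?Y1 //; lra.
have dphi t : is_derive t 1 phi (f t).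
  apply/is_derive_diff_at => e e0.
  have [ta|ta] := ltP t a.
    rewrite sup; last by rewrite in_itv /= negb_and -!ltNge ta.
    exists (a - t); first by rewrite subr_gt0.
    move=> s; rewrite ltr_norml => /andP[_ sa].
    by rewrite !phil ?(ltW ta) ?mul0r ?subrr ?subr0 ?normr0 ?mulr_ge0 ?(ltW e0) //; lra.
  have [tc|tc] := ltP c t.
    rewrite sup; last by rewrite in_itv /= negb_and -!ltNge tc orbT.
    exists (t - c); first by rewrite subr_gt0.
    move=> s; rewrite ltr_norml => /andP[sc _].
    by rewrite !phir ?(ltW tc) ?mul0r ?subrr ?subr0 ?normr0 ?mulr_ge0 ?(ltW e0) //; lra.
  have dt : tdom t by apply/tdomP/andP; split; lra.
  have /strong_derivativeP/(_ t dt e e0)[d d0 hd] := dY.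
  exists (Num.min d (Num.min (t + 1) (1 - t))).
    by rewrite !lt_min d0; apply/andP; split; lra.
  move=> s; rewrite !lt_min => /and3P[sd]; rewrite !ltr_norml => /andP[s1 _] /andP[_ s2].
  have ds : tdom s by apply/tdomP/andP; split; lra.
  by rewrite /phi !clamp_id // hd.
exists phi => //; apply: (@test_functionP _ a c) => //; first exact: smooth_primitive dphi sf.
move=> t; rewrite in_itv /= negb_and -!ltNge => /orP[] h; [apply: phil|apply: phir]; exact: ltW.
Qed.

Lemma test_functionE phi : test_function phi -> exists2 psi, (forall t, is_derive t 1 phi (psi t)) &
  [/\ continuous psi, derive1 phi = psi, phi 1 = 0 & phi (-1) = 0].
Proof.
move=> [d [a [c [a1 c1 h]]]]; exists (derive1 phi).
  by move=> t; apply: DeriveDef; [exact: (d 0%N)|rewrite derive1E].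
split=> //.
- move=> t; apply: differentiable_continuous; apply/derivable1_diffP.
  by have := d 1%N t; rewrite derive1n1.
- by apply: h; rewrite in_itv /= negb_and -!ltNge c1 orbT.
- by apply: h; rewrite in_itv /= negb_and -!ltNge a1.
Qed.

Lemma strong_weak_derivative y h : strong_derivative y h -> cont h -> weak_derivative y h.
Proof.
move=> yh ch; have cy := strong_derivative_cont yh.
split; [exact: cont_integrable|exact: cont_integrable|].
move=> phi /test_functionE[psi dpsi [cpsi -> phi1 phiN1]].
have sphi : strong_derivative phi psi by apply: is_derive_strong => t _.
have := Int_parts yh sphi ch (cont_continuous cpsi).
by rewrite phi1 phiN1 !mulr0 subrr sub0r.
Qed.

Lemma Int_gt0 f a c : cont f -> (forall t, tdom t -> 0 <= f t) -> tdom a -> tdom c -> a < c ->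
  (forall t, a < t < c -> 0 < f t) -> 0 < Int f.
Proof.
move=> cf f0 da dc ac fp; have [Y Y0 dY] := cont_primitive cf.
rewrite (Int_FTC dY cf).
have mono s t : tdom s -> tdom t -> s <= t -> Y s <= Y t.
  move=> ds dt; rewrite le_eqVlt => /predU1P[->//|st].
  have [u /andP[u1 u2]] := mean_value dY ds dt st.
  have du : tdom u.
    move: ds dt => /tdomP/andP[? ?] /tdomP/andP[? ?]; apply/tdomP/andP; split; lra.
  move=> e; rewrite -subr_ge0 e mulr_ge0 ?f0 // subr_ge0 ltW //.
have [u uac e] := mean_value dY da dc ac.
have : 0 < Y c - Y a by rewrite e mulr_gt0 ?fp // subr_gt0.
have h1 : Y (-1) <= Y a by apply: mono => //; [exact: tdomN1|move/tdomP: da => /andP[]].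
have h2 : Y c <= Y 1 by apply: mono => //; [exact: tdom1|move/tdomP: dc => /andP[]].
by move: h1 h2; lra.
Qed.

Lemma Int_lin (k k' : R) f g : cont f -> cont g ->
  Int (fun t => k * f t + k' * g t) = k * Int f + k' * Int g.
Proof.
move=> cf cg; rewrite IntD; [|by apply: contM => //; exact: cont_cst..].
by congr (_ + _); exact: IntZ.
Qed.

(** The lemma of du Bois-Reymond. If [w s > w t], a difference of bumps near [s] and near [t],
    weighted so that its integral is 0, is the derivative of a test function which detects it.
    Exchanging [s] and [t], the function [w] is constant. *)
Lemma weak_derivative0 w : cont w ->
  (forall phi, test_function phi -> Int (fun t => w t * derive1 phi t) = 0) ->
  forall s t, tdom s -> tdom t -> w s <= w t.
Proof.
move=> cw hw s t ds dt; rewrite leNgt; apply/negP => lt.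
pose e := (w s - w t) / 3; have e0 : 0 < e by rewrite divr_gt0 ?subr_gt0.
have loc u : tdom u -> exists a c, [/\ -1 < a, a < c, c < 1 &
    forall v, a <= v <= c -> `|w v - w u| < e].
  move=> du; have /cvgrPdist_lt/(_ e e0) := (subspace_continuousP _ _).1 cw u du.
  rewrite /within /= => /nbhs_ballP[d /= d0 hd].
  have [u1 u2] := andP (proj1 (tdomP u) du).
  pose d' := Num.min d 1; have d'0 : 0 < d' by rewrite lt_min d0 ltr01.
  have [d'd d'1] : d' <= d /\ d' <= 1 by rewrite !ge_min !lexx orbT.
  have H v : `|v - u| < d -> tdom v -> `|w v - w u| < e.
    by move=> vd dv; rewrite distrC; apply: hd => //; rewrite /ball /= distrC.
  have [h|h] := leP 0 u.
    exists (u - d' / 2), (u - d' / 3); split; try lra.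
    move=> v /andP[? ?]; apply: H; first by rewrite ltr_norml; apply/andP; split; lra.
    by apply/tdomP/andP; split; lra.
  exists (u + d' / 3), (u + d' / 2); split; try lra.
  move=> v /andP[? ?]; apply: H; first by rewrite ltr_norml; apply/andP; split; lra.
  by apply/tdomP/andP; split; lra.
have [a [c [a1 ac c1 hac]]] := loc s ds.
have [a' [c' [a'1 ac' c'1 hac']]] := loc t dt.
have [b [sb sup b_ge0 b_gt0]] := expbump_exists ac.
have [b' [sb' sup' b'_ge0 b'_gt0]] := expbump_exists ac'.
have cb : cont b by apply: cont_continuous; exact: smooth_continuous.
have cb' : cont b' by apply: cont_continuous; exact: smooth_continuous.
have Ib : 0 < Int b.
  by apply: (@Int_gt0 _ a c) => //; apply/tdomP/andP; split; lra.
have Ib' : 0 < Int b'.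
  by apply: (@Int_gt0 _ a' c') => //; apply/tdomP/andP; split; lra.
have [||||||phi tphi dphi] := @test_primitive (fun t => Int b' * b t + - Int b * b' t)
    (Num.min a a') (Num.max c c').
- by apply: smoothD; exact: smoothZ.
- by rewrite lt_min a1.
- by rewrite gt_min lt_max ac.
- by rewrite gt_max c1.
- move=> u; rewrite in_itv /= negb_and -!ltNge lt_min gt_max => h.
  rewrite sup ?sup' ?mulr0 ?addr0 // in_itv /= negb_and -!ltNge.
    by case/orP: h => /andP[h1 h2]; rewrite ?h1 ?h2 ?orbT.
  by case/orP: h => /andP[h1 h2]; rewrite ?h1 ?h2 ?orbT.
- by apply: eq_trans (Int_lin (Int b') (- Int b) cb cb') _; ring.
have := hw phi tphi.
have -> : Int (fun t => w t * derive1 phi t) = Int b' * Int (fun t => w t * b t)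
    - Int b * Int (fun t => w t * b' t).
  rewrite -!IntZ; [|exact: contM..].
  rewrite -IntB; [|by apply: contM; [exact: cont_cst|exact: contM]..].
  apply: eq_Int => u _; have -> : derive1 phi u = Int b' * b u + - Int b * b' u.
    by rewrite derive1E; have [_] := dphi u.
  ring.
have l1 : (w s - e) * Int b <= Int (fun t => w t * b t).
  rewrite -IntZ //; apply: le_Int; [by apply: contM => //; exact: cont_cst|exact: contM|].
  move=> u du; have [uac|uac] := boolP (u \in `[a, c]); last by rewrite sup // !mulr0.
  rewrite ler_wpM2r //; move: uac; rewrite in_itv /= => /hac.
  by rewrite ltr_norml => /andP[]; lra.
have l2 : Int (fun t => w t * b' t) <= (w t + e) * Int b'.
  rewrite -IntZ //; apply: le_Int; [exact: contM|by apply: contM => //; exact: cont_cst|].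
  move=> u du; have [uac|uac] := boolP (u \in `[a', c']); last by rewrite sup' // !mulr0.
  rewrite ler_wpM2r //; move: uac; rewrite in_itv /= => /hac'.
  by rewrite ltr_norml => /andP[]; lra.
have we : w t + e < w s - e by rewrite /e; lra.
have l3 := ler_wpM2l (ltW Ib') l1; have l4 := ler_wpM2l (ltW Ib) l2.
have BB : 0 < Int b * Int b' by rewrite mulr_gt0.
have : (w t + e) * (Int b * Int b') < (w s - e) * (Int b * Int b') by rewrite ltr_pM2r.
by move: l3 l4; lra.
Qed.

(** A primitive of [h] has the weak derivative [h] as well, so it differs from [y] by a
    constant. *)
Lemma weak_strong_derivative y h : cont y -> cont h -> weak_derivative y h ->
  strong_derivative y h.
Proof.
move=> cy ch [_ _ yh]; have [H H0 dH] := cont_primitive ch.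
have [_ _ Hh] := strong_weak_derivative dH ch.
have cH := strong_derivative_cont dH.
have cw : cont (fun t => y t - H t) by exact: contB.
have w0 phi : test_function phi -> Int (fun t => (y t - H t) * derive1 phi t) = 0.
  move=> tphi; have [psi dpsi [cpsi epsi _ _]] := test_functionE tphi.
  have cd : cont (derive1 phi) by rewrite epsi; exact: cont_continuous.
  have -> : Int (fun t => (y t - H t) * derive1 phi t) =
      Int (fun t => y t * derive1 phi t) - Int (fun t => H t * derive1 phi t).
    rewrite -IntB; [|exact: contM..].
    by apply: eq_Int => t _; rewrite mulrBl.
  by rewrite /Int (yh phi tphi) (Hh phi tphi) subrr.
have le := weak_derivative0 cw w0.
apply: (strong_derivative_eq _ _ (strong_derivativeD dH
  (@strong_derivative_cst _ (y (-1) - H (-1))))).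
  move=> t; rewrite inE => dt /=.
  have := le _ _ dt (tdomN1 R); have := le _ _ (tdomN1 R) dt.
  by lra.
by move=> t _; rewrite /= addr0.
Qed.

End Bumps.

(** * Uniqueness of weak derivatives *)

Section AlmostEverywhere.
Context d (T : measurableType d) (R : realType) (mu : {measure set T -> \bar R}).
Import HBNNSimple.

(** The two sides need not be measurable: the integral is then a supremum over simple
    functions, and a simple function may be set to 0 on a null set. *)
Let le_nnintegral_ae (f g : T -> \bar R) : (forall x, 0 <= f x)%E -> (forall x, 0 <= g x)%E ->
  {ae mu, forall x, f x = g x} -> (\int[mu]_x f x <= \int[mu]_x g x)%E.
Proof.
move=> f0 g0 [N [mN N0 hN]]; rewrite !ge0_integralTE //.
apply: ge_ereal_sup => _ /= [h hf <-].
apply: ereal_sup_ubound; have mC : measurable (~` N) by exact: measurableC.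
exists (proj_nnsfun h mC).
  move=> x; rewrite -[proj_nnsfun h mC x]/(h x * \1_(~` N) x).
  rewrite indicE; have [xN|xN] := boolP (x \in ~` N).
    rewrite mulr1; have <- : f x = g x; last exact: hf.
    by apply: contrapT => fg; move: xN; rewrite inE; apply; exact: hN.
  by rewrite mulr0.
have e (k : {nnsfun T >-> R}) : sintegral mu k = (\int[mu]_x (k x)%:E)%E.
  by rewrite integral_nnsfun // patch_setT.
rewrite !e; apply: ae_eq_integral => //; [exact/measurable_EFinP..|].
exists N; split=> // x /= hx; apply: contrapT => xN; apply: hx => _.
by rewrite -[mindic R mC x]/(\1_(~` N) x) indicE mem_set ?mulr1.
Qed.

(** The cost does not change with the control on a null set, whether or not the running cost
    along the trajectory is measurable. *)
Lemma ae_eq_integral_nonmeasurable (D : set T) (f g : T -> \bar R) :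
  {ae mu, forall x, D x -> f x = g x} -> (\int[mu]_(x in D) f x = \int[mu]_(x in D) g x)%E.
Proof.
move=> fg; rewrite integral_mkcond [RHS]integral_mkcond.
have {}fg : {ae mu, forall x, (f \_ D) x = (g \_ D) x}.
  by apply: filterS fg => x h; rewrite /patch; case: ifPn => //; rewrite inE => /h.
rewrite integralE [RHS]integralE; congr (_ - _)%E; apply/eqP; rewrite eq_le;
by apply/andP; split; apply: le_nnintegral_ae => //; apply: filterS fg => x;
  rewrite ?funeposE ?funenegE => ->.
Qed.

End AlmostEverywhere.

Section FundamentalLemma.
Variable R : realType.
Implicit Types (f y h : R -> R) (t s a c : R).
Notation mu := (@lebesgue_measure R).

(** The bumps [exp(- 1 / (n (t - a) (c - t)))] tend to the indicator function of the interval. *)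
Lemma Int_itv0 h a c : integrable_tdom h ->
  (forall phi, test_function phi -> Int (fun t => h t * phi t) = 0) ->
  -1 < a -> a < c -> c < 1 -> Int (fun t => h t * \1_(`]a, c[%classic) t) = 0.
Proof.
move=> ih h0 a1 ac c1.
pose b n : R -> R := expbump (quad a c n) 1 0.
have tb n : test_function (b n).
  by apply: (@test_functionP _ _ a c) => //; [exact: smooth_expbump|exact: expbump_supported].
have cb n : continuous (b n) by apply: smooth_continuous; exact: smooth_expbump.
have mt := @measurable_tdom R.
have mh : measurable_fun (@tdom R : set (measurableTypeR R)) h.
  by apply/measurable_EFinP; case/integrableP: ih.
have [|||||_ _ cvg] := @dominated_convergence _ _ R mu (@tdom R) mt
  (fun n t => (h t * b n t)%:E) (fun t => (h t * \1_(`]a, c[%classic) t)%:E)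
  (fun t => `|h t|%:E).
- move=> n; apply/measurable_EFinP; apply: measurable_funM => //.
  by apply: measurable_funTS; exact: continuous_measurable_fun.
- apply/measurable_EFinP; apply: measurable_funM => //.
- apply: aeW => t _; apply: cvg_EFin; first by apply: nearW.
  by apply: cvgMr; exact: expbump_cvg.
- by have := integrable_abse ih.
- apply: aeW => t n _; rewrite /= lee_fin normrM ler_piMr //.
  by rewrite ger0_norm ?expbump_ge0 // expbump_le1.
rewrite /Int /Rintegral.
have e0 n : (\int[mu]_(t in tdom) (h t * b n t)%:E = 0)%E.
  have ib : mu.-integrable tdom (EFin \o (fun t => h t * b n t)).
    apply: (le_integrable mt _ _ ih).
      apply/measurable_EFinP; apply: measurable_funM => //.
      by apply: measurable_funTS; exact: continuous_measurable_fun.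
    move=> t _; rewrite /= lee_fin normrM ler_piMr //.
    by rewrite ger0_norm ?expbump_ge0 // expbump_le1.
  have := h0 _ (tb n); rewrite /Int /Rintegral => e.
  by rewrite -[LHS]fineK ?integrable_fin_num // e.
have : (fun n => \int[mu]_(t in tdom) (h t * b n t)%:E)%E @ \oo --> (0 : \bar R)%E.
  by under eq_fun do rewrite e0; exact: cvg_cst.
by move/(cvg_unique _ cvg) => /= ->.
Qed.

(** The primitive of [h] is constant inside the interval, and its derivative is [h] almost
    everywhere by Lebesgue's differentiation theorem. *)
Lemma fundamental_lemma h : integrable_tdom h ->
  (forall phi, test_function phi -> Int (fun t => h t * phi t) = 0) ->
  {ae mu, forall t, tdom t -> h t = 0}.
Proof.
move=> ih h0.
have mt := @measurable_tdom R.
pose f := h \_ tdom.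
have If : mu.-integrable setT (EFin \o f).
  by rewrite -restrict_EFin; apply/integrable_restrict => //=; rewrite setTI.
have Ifs (y : R) : mu.-integrable [set` Interval (BLeft (-1 : R)) (BRight y)] (EFin \o f).
  by apply: integrableS If => //; exact: measurable_itv.
have locf : locally_integrable [set: R] f.
  by apply: integrable_locally => //; exact: openT.
have := FTC1 Ifs locf.
have zero a c : -1 < a -> a < c -> c < 1 ->
    \int[mu]_(t in [set` Interval (BRight a) (BRight c)]) f t = 0.
  move=> a1 ac c1; rewrite -Rintegral_itv_bndo_bndc; last first.
    by apply: integrableS If => //; exact: measurable_itv.
  rewrite -(Int_itv0 ih h0 a1 ac c1) /Int.
  rewrite Rintegral_mkcond [RHS]Rintegral_mkcond; apply: eq_Rintegral => t _.
  rewrite /patch indicE /= /f /patch.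
  have [tac|tac] := boolP (t \in `]a, c[%classic); last first.
    by case: ifPn; rewrite ?mulr0.
  have dt : t \in tdom.
    move: tac; rewrite !inE /= in_itv /= => /andP[? ?].
    by apply/tdomP/andP; split; lra.
  by rewrite dt mulr1.
have n1 : {ae mu, forall t, t <> -1 :> R}.
  exists [set -1]; split; [by []|exact: lebesgue_measure_set1|].
  by move=> t /= /contrapT.
have p1 : {ae mu, forall t, t <> 1 :> R}.
  exists [set 1]; split; [by []|exact: lebesgue_measure_set1|].
  by move=> t /= /contrapT.
move: n1 p1; apply: filterS3; first exact: (ae_filter_ringOfSetsType mu).
move=> t tn1 tp1 H dt.
have [t1 t2] : -1 < t /\ t < 1.
  move/tdomP: (dt) => /andP[]; rewrite !le_eqVlt => /predU1P[e|h1]; first by case: tn1.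
  by move=> /predU1P[e|h2]; first by case: tp1.
have [|_ F'] := H; first by rewrite /= lte_fin.
pose F x := \int[mu]_(t in [set` Interval (BLeft (-1 : R)) (BRight x)]) f t.
have const s u : -1 < s -> s < u -> u < 1 -> F u = F s.
  move=> s1 su u1; apply/eqP; rewrite -subr_eq0 /F Rintegral_itvB ?zero //.
  - by rewrite bnd_simp ltW.
  - by rewrite bnd_simp ltW.
have D : is_derive t 1 F 0.
  apply/is_derive_diff_at => e e0; exists (Num.min (t + 1) (1 - t)).
    by rewrite lt_min; apply/andP; split; lra.
  move=> s; rewrite lt_min !ltr_norml => /andP[/andP[s1 _] /andP[_ s2]].
  have -> : F s = F t.
    have [st|st|->//] := ltgtP s t; [symmetry|]; apply: const; lra.
  by rewrite mul0r subrr subr0 normr0 mulr_ge0 // ltW.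
have -> : h t = f t by rewrite /f patchE mem_set.
rewrite -F' derive1E; by have [_] := D.
Qed.

End FundamentalLemma.

Section Uniqueness.
Variable R : realType.
Notation mu := (@lebesgue_measure R).

Lemma integrable_tdomM (h b : R -> R) : integrable_tdom h -> cont b ->
  integrable_tdom (fun t => h t * b t).
Proof.
move=> ih cb; have [B B0 hB] := cont_bounded cb.
have mh : measurable_fun (@tdom R : set (measurableTypeR R)) h.
  by apply/measurable_EFinP; case/integrableP: ih.
have mb : measurable_fun (@tdom R : set (measurableTypeR R)) b.
  by apply/measurable_EFinP; case/integrableP: (cont_integrable cb).
apply: (le_integrable (@measurable_tdom R) _ (g := EFin \o (fun t => B * h t))).
- by apply/measurable_EFinP; exact: measurable_funM.
- move=> t dt; rewrite /= lee_fin !normrM mulrC [`|B|]gtr0_norm // ler_wpM2r //; exact: hB.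
- exact: (integrableZl (@measurable_tdom R) B ih).
Qed.

(** Through this lemma the trajectory determines the control. *)
Lemma weak_derivative_unique (y h k : R -> R) :
  weak_derivative y h -> weak_derivative y k -> {ae mu, forall t, tdom t -> h t = k t}.
Proof.
move=> [_ ih hh] [_ ik hk].
have mt := @measurable_tdom R.
have ihk : integrable_tdom (fun t => h t - k t) by exact: (integrableB mt ih ik).
have : {ae mu, forall t, tdom t -> h t - k t = 0}.
  apply: fundamental_lemma => // phi tphi.
  have cphi : cont phi.
    have [psi dpsi _] := test_functionE tphi.
    by apply: strong_derivative_cont (is_derive_strong (fun t _ => dpsi t)).
  have ih' := integrable_tdomM ih cphi.
  have ik' := integrable_tdomM (integrableN ik) cphi.
  rewrite (_ : Int _ = Int (fun t => h t * phi t + (- k t) * phi t)); last first.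
    by apply: eq_Int => t _; rewrite mulrBl mulNr.
  rewrite integrable_IntD //.
  have -> : Int (fun t => - k t * phi t) = - Int (fun t => k t * phi t).
    rewrite -mulN1r -integrable_IntZ; last exact: integrable_tdomM.
    by apply: eq_Int => t _; rewrite mulN1r mulNr.
  by apply/eqP; rewrite subr_eq0 -eqr_opp /Int -(hh _ tphi) -(hk _ tphi).
apply: (@filterS _ _ (ae_filter_ringOfSetsType mu)) => t H dt.
by apply/eqP; rewrite -subr_eq0; exact/eqP/H.
Qed.

End Uniqueness.

(** * Second differences along a path *)

Section DirectionalDerivatives.
Variables (R : realType) (V : normedModType R).
Implicit Types (f g : V -> R) (x y z h a b v : V).

Lemma Ck_pred k f : Ck k.+1 f -> Ck k f.
Proof.
elim: k f => [|k ih] f [cf H]; first by split.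
by split=> // v; have [dv cv] := H v; split=> //; exact: ih.
Qed.

Lemma Ck_le k n f : (k <= n)%N -> Ck n f -> Ck k f.
Proof.
move=> /subnKC <-; elim: (n - k)%N => [|j ih]; first by rewrite addn0.
by rewrite addnS => /Ck_pred.
Qed.

Lemma is_derive_line f z h (tau : R) : derivable f (z + tau *: h) h ->
  is_derive tau 1 (fun s : R => f (z + s *: h)) ('D_h f (z + tau *: h)).
Proof.
have e : (fun s : R => s^-1 *: (f (z + (s *: (1 : R) + tau) *: h) - f (z + tau *: h))) =
    (fun s : R => s^-1 *: (f (s *: h + (z + tau *: h)) - f (z + tau *: h))).
  apply/funext => s; congr (_ *: (f _ - _)).
  by rewrite -[s *: (1 : R)]/(s * 1) mulr1 scalerDl addrCA.
move=> df; apply: DeriveDef; first by rewrite /derivable e.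
by rewrite /derive e.
Qed.

Lemma line_mean_value f z h : (forall x, derivable f x h) ->
  exists2 s : R, 0 < s < 1 & f (z + h) - f z = 'D_h f (z + s *: h).
Proof.
move=> df.
have sd : strong_derivative (fun s : R => f (z + s *: h)) (fun s => 'D_h f (z + s *: h)).
  by apply: is_derive_strong => t _; exact: is_derive_line.
have d0 : @tdom R 0 by apply/tdomP/andP; split; lra.
have [c c01] := mean_value sd d0 (tdom1 R) ltr01.
by rewrite scale1r scale0r addr0 subr0 mulr1 => e; exists c.
Qed.

Lemma derive_unique f x h (l : R) : derivable f x h ->
  diff_at (fun s : R => f (x + s *: h)) 0 l -> 'D_h f x = l.
Proof.
move=> df /is_derive_diff_at [_ <-].
have [|_] := @is_derive_line f x h 0; first by rewrite scale0r addr0.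
by rewrite scale0r addr0.
Qed.

Lemma derive_scale f x h (c : R) : (forall v y, derivable f y v) ->
  'D_(c *: h) f x = c * 'D_h f x.
Proof.
move=> df; apply: derive_unique => //.
have [->|c0] := eqVneq c 0.
  by move=> e e0; exists 1 => // s _; rewrite scale0r !scaler0 !mul0r !subrr normr0 mulr_ge0 // ltW.
have := @is_derive_line f x h 0 (df _ _); rewrite scale0r addr0 => /is_derive_diff_at D e e0.
have nc : 0 < `|c| by rewrite normr_gt0.
have [d d0 hd] := D (e / `|c|) (divr_gt0 e0 nc).
exists (d / `|c|); first by rewrite divr_gt0.
move=> s; rewrite subr0 ltr_pdivlMr // => sd.
have := hd (s * c); rewrite subr0 normrM => /(_ sd).
rewrite !scale0r !addr0 scalerA => H.
rewrite (_ : c * _ * s = 'D_h f x * (s * c)); last by ring.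
by rewrite (_ : e * `|s| = e / `|c| * (`|s| * `|c|)) //; field; rewrite gt_eqF.
Qed.

(** It suffices that one of the two directional derivatives is continuous: the increment along
    it is a value of that derivative at a nearby point. *)
Lemma derive_add f x a b : (forall v y, derivable f y v) -> continuous ('D_a f) ->
  'D_(a + b) f x = 'D_a f x + 'D_b f x.
Proof.
move=> df cA; apply: derive_unique => // e e0.
have e20 : 0 < e / 2 by rewrite divr_gt0.
have := @is_derive_line f x b 0 (df _ _); rewrite scale0r addr0 => /is_derive_diff_at.
move=> /(_ _ e20)[d1 d10 h1].
have /cvgrPdist_lt/(_ _ e20)/nbhs_ballP[d2 /= d20 h2] := cA x.
pose S := `|a| + `|b| + 1; have S0 : 0 < S by rewrite ltr_wpDl // addr_ge0.
exists (Num.min d1 (d2 / S)); first by rewrite lt_min d10 divr_gt0.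
move=> s; rewrite lt_min subr0 ltr_pdivlMr // => /andP[s1 s2].
have [c /andP[c0 c1]] := line_mean_value (x + s *: b) (df (s *: a)).
rewrite derive_scale // => ec.
have := h1 s; rewrite subr0 => /(_ s1); rewrite !scale0r !addr0 => H1.
have H2 : `|'D_a f (x + s *: b + c *: (s *: a)) - 'D_a f x| < e / 2.
  rewrite distrC; apply: h2; rewrite -ball_normE /= -[x + _ + _]addrA opprD addrA subrr sub0r normrN.
  apply: le_lt_trans s2; apply: le_trans (ler_normD _ _) _.
  rewrite !normrZ [`|c|]ger0_norm ?(ltW c0) //.
  have : c * (`|s| * `|a|) <= `|s| * `|a|.
    by rewrite ler_piMl ?mulr_ge0 // ltW.
  by have := normr_ge0 s; rewrite /S !mulrDr; lra.
have -> : f (x + s *: (a + b)) - f x - ('D_a f x + 'D_b f x) * s =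
  ('D_a f (x + s *: b + c *: (s *: a)) - 'D_a f x) * s +
  (f (x + s *: b) - f x - 'D_b f x * s).
  have -> : x + s *: (a + b) = x + s *: b + s *: a by rewrite scalerDr addrA addrAC.
  by rewrite mulrBl ['D_a f (_ + _) * s]mulrC -ec; ring.
rewrite (le_trans (ler_normD _ _)) // [e * _](_ : _ = e / 2 * `|s| + e / 2 * `|s|); last by field.
by rewrite lerD // normrM ler_wpM2r // ltW.
Qed.

Lemma derive_lincomb (I : Type) (r : seq I) (c : I -> R) (e : I -> V) f x : Ck 1 f ->
  'D_(\sum_(i <- r) c i *: e i) f x = \sum_(i <- r) c i * 'D_(e i) f x.
Proof.
move=> [cf H]; have df v y : derivable f y v by have [] := H v.
have cD v : continuous ('D_v f) by have [_ []] := H v.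
elim: r => [|i r ih].
  by rewrite !big_nil -[0 : V](scale0r (0 : V)) derive_scale // mul0r.
by rewrite !big_cons derive_add // ih derive_scale.
Qed.

Lemma derive_sumZ (I : Type) (r : seq I) (c : I -> R) (g : I -> V -> R) x h :
  (forall i, derivable (g i) x h) ->
  derivable (fun y => \sum_(i <- r) c i * g i y) x h /\
  'D_h (fun y => \sum_(i <- r) c i * g i y) x = \sum_(i <- r) c i * 'D_h (g i) x.
Proof.
move=> dg; elim: r => [|i r [ih1 ih2]].
  have -> : (fun y => \sum_(i <- [::]) c i * g i y) = cst 0.
    by apply/funext => y; rewrite big_nil.
  by rewrite big_nil derive_cst; split=> //; exact: derivable_cst.
have -> : (fun y => \sum_(j <- i :: r) c j * g j y) =
    (c i *: g i) + (fun y => \sum_(j <- r) c j * g j y).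
  by apply/funext => y; rewrite big_cons.
have dZ : derivable (c i *: g i) x h by exact: derivableZ.
split; first exact: derivableD.
by rewrite (deriveD dZ ih1) (deriveZ _ (dg i)) ih2 big_cons.
Qed.

(** The second difference is a difference of first derivatives at two points of the
    segment. *)
Lemma second_difference_line f z h (M : R) : Ck 2 f ->
  (forall s : R, tdom s -> `|'D_h ('D_h f) (z + s *: h)| <= M) ->
  `|f (z + h) + f (z - h) - 2 * f z| <= 2 * M.
Proof.
move=> [cf H] hM; have [df [cDf H']] := H h; have [ddf _] := H' h.
have sd : strong_derivative (fun s : R => f (z + s *: h)) (fun s => 'D_h f (z + s *: h)).
  by apply: is_derive_strong => t _; exact: is_derive_line.
have sd' : strong_derivative (fun s : R => 'D_h f (z + s *: h))
    (fun s => 'D_h ('D_h f) (z + s *: h)).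
  by apply: is_derive_strong => t _; exact: is_derive_line.
have d0 : @tdom R 0 by apply/tdomP/andP; split; lra.
have N10 : -1 < 0 :> R by lra.
have [c1 /andP[c10 c11] e1] := mean_value sd d0 (tdom1 R) ltr01.
have [c2 /andP[c20 c21] e2] := mean_value sd (tdomN1 R) d0 N10.
rewrite scale1r scale0r addr0 subr0 mulr1 in e1.
rewrite scaleN1r scale0r addr0 sub0r opprK mulr1 in e2.
have dc1 : tdom c1 by apply/tdomP/andP; split; lra.
have dc2 : tdom c2 by apply/tdomP/andP; split; lra.
have M0 : 0 <= M by apply: le_trans (hM _ d0).
have -> : f (z + h) + f (z - h) - 2 * f z = 'D_h f (z + c1 *: h) - 'D_h f (z + c2 *: h).
  by rewrite -e1 -e2; ring.
apply: le_trans (mean_value_le sd' hM dc2 dc1) _.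
by rewrite mulrC ler_wpM2r // ger0_norm; lra.
Qed.

(** Compactness of the interval makes the local bounds around the points of the path
    uniform. *)
Lemma tube_bounded g (z : R -> V) : continuous g -> {within tdom, continuous z} ->
  exists d : R, 0 < d /\ exists2 B : R, 0 <= B &
    forall t x, tdom t -> `|x - z t| < d -> `|g x| <= B.
Proof.
move=> cg cz; pose zc := z \o @clamp R.
have czc : continuous zc by exact: continuous_clamp_comp.
have /compact_near_coveringP cov : compact (@tdom R : set R) by exact: segment_compact.
have [n] : exists n : nat, forall t, tdom t -> forall x, `|x - zc t| < n.+1%:R^-1 -> `|g x| <= n%:R.
  have : \forall n \near \oo, forall t, tdom t ->
      (forall x, `|x - zc t| < n.+1%:R^-1 -> `|g x| <= n%:R).
    apply: cov => t0 dt0.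
    have /cvgrPdist_lt/(_ _ ltr01)/nbhs_ballP[d /= d0 hd] := cg (zc t0).
    have d20 : 0 < d / 2 by rewrite divr_gt0.
    have /cvgrPdist_lt/(_ _ d20) U := czc t0.
    pose k := Num.max (d / 2)^-1 (`|g (zc t0)| + 1).
    exists ([set t | `|zc t0 - zc t| < d / 2], [set n | (Num.trunc k < n)%N]).
      split=> //=; by exists (Num.trunc k).+1.
    move=> [t n] /= [ut kn] x xt.
    have kn' : k < n%:R.
      by apply: lt_le_trans (truncnS_gt k) _; rewrite ler_nat.
    have : `|g (zc t0) - g x| < 1.
      apply: hd; rewrite -ball_normE /=.
      have -> : zc t0 - x = (zc t0 - zc t) - (x - zc t) by rewrite opprB addrA subrK.
      apply: le_lt_trans (ler_normB _ _) _.
      have : n.+1%:R^-1 < d / 2.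
        rewrite -[X in _ < X]invrK ltf_pV2 ?posrE ?invr_gt0 //.
        apply: le_lt_trans (_ : k < _); first by rewrite /k le_max lexx.
        by apply: lt_trans kn' _; rewrite ltr_nat.
      by move: (n.+1%:R^-1) xt => w xt wd; move: ut xt wd; lra.
    move=> gx; have : `|g x| <= `|g (zc t0)| + `|g (zc t0) - g x|.
      rewrite -{1}[g x](subKr (g (zc t0))); exact: ler_normB.
    have : `|g (zc t0)| + 1 <= k by rewrite /k le_max lexx orbT.
    by move: kn' gx; lra.
  by move=> [N _ /(_ N (leqnn N)) h]; exists N.
move=> hn; exists n.+1%:R^-1; split; first by rewrite invr_gt0.
by exists n%:R => // t x dt xt; apply: (hn t dt); rewrite /zc /= clamp_id.
Qed.

(** The second derivative in the direction of [h] is a quadratic form in the coordinates of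
    [h], whose coefficients are bounded on a tube around the path. *)
Lemma second_difference (I : finType) (e : I -> V) f (z : R -> V) :
  Ck 2 f -> {within tdom, continuous z} ->
  exists d : R, 0 < d /\ exists2 C : R, 0 <= C &
    forall (t eps : R) (c : I -> R), tdom t -> 0 <= eps <= d -> (forall i, `|c i| <= eps) ->
      let h := \sum_i c i *: e i in
      `|f (z t + h) + f (z t - h) - 2 * f (z t)| <= C * eps ^+ 2.
Proof.
move=> Cf cz; have [cf H] := Cf.
pose D i j := 'D_(e j) ('D_(e i) f).
have cD i j : continuous (D i j) by have [_ [_ H']] := H (e i); have [_ []] := H' (e j).
have bD i j := tube_bounded (cD i j) cz.
have [d [d0 [B B0 hB]]] : exists d : R, 0 < d /\ exists2 B : R, 0 <= B &
    forall i j t x, tdom t -> `|x - z t| < d -> `|D i j x| <= B.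
  have /choice[dd hdd] (p : I * I) := bD p.1 p.2.
  have /choice[BB hBB] (p : I * I) : exists B : R, 0 <= B /\
      forall t x, tdom t -> `|x - z t| < dd p -> `|D p.1 p.2 x| <= B.
    by have [_ [B B0 hB]] := hdd p; exists B.
  have i0 p : 0 <= (dd p)^-1 by have [h _] := hdd p; rewrite invr_ge0 ltW.
  have s0 : 0 < \sum_p (dd p)^-1 + 1 by rewrite ltr_wpDl // sumr_ge0.
  exists (\sum_p (dd p)^-1 + 1)^-1; split; first by rewrite invr_gt0.
  exists (\sum_p BB p); first by rewrite sumr_ge0 // => p _; have [] := hBB p.
  move=> i j t x dt xt; apply: (@le_trans _ _ (BB (i, j))).
    have [_ h] := hBB (i, j); apply: (h t) => //; apply: lt_le_trans xt _.
    have [h0 _] := hdd (i, j); rewrite -[X in _ <= X]invrK lef_pV2 ?posrE ?invr_gt0 //.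
    rewrite (bigD1 (i, j)) //= -addrA lerDl addr_ge0 // sumr_ge0 //.
  rewrite (bigD1 (i, j)) //= lerDl sumr_ge0 // => p _; by have [] := hBB p.
pose S := \sum_i `|e i|; have S0 : 0 <= S by exact: sumr_ge0.
have S1 : 0 < S + 1 by rewrite ltr_wpDl.
exists (d / (2 * (S + 1))); split; first by rewrite divr_gt0 // mulr_gt0.
exists (2 * (\sum_(i : I) \sum_(j : I) B)).
  by rewrite mulr_ge0 // sumr_ge0 // => i _; rewrite sumr_ge0.
move=> t eps c dt /andP[eps0 epsd] hc /=; set h := \sum_i c i *: e i.
rewrite ler_pdivlMr ?mulr_gt0 // in epsd.
have C1 i : Ck 1 ('D_(e i) f) by have [_ []] := H (e i).
have Dh x : 'D_h f x = \sum_i c i * 'D_(e i) f x by exact: derive_lincomb (Ck_pred Cf).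
have Dhh x : 'D_h ('D_h f) x = \sum_i \sum_j c i * c j * D i j x.
  have -> : 'D_h f = (fun y => \sum_i c i * 'D_(e i) f y) by apply/funext => y; exact: Dh.
  have [_ ->] := @derive_sumZ I (index_enum I) c (fun i => 'D_(e i) f) x h
    (fun i => (proj2 (C1 i) h).1 x).
  apply: eq_bigr => i _; rewrite [in LHS](derive_lincomb _ _ _ _ (C1 i)) mulr_sumr.
  by apply: eq_bigr => j _; rewrite mulrA.
have hh : `|h| <= eps * S.
  rewrite /h /S mulr_sumr (le_trans (ler_norm_sum _ _ _)) // ler_sum // => i _.
  by rewrite normrZ ler_wpM2r.
have -> : 2 * (\sum_(i : I) \sum_(j : I) B) * eps ^+ 2 =
   2 * (\sum_(i : I) \sum_(j : I) eps * eps * B).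
  rewrite -mulrA; congr (_ * _); rewrite mulrC mulr_sumr; apply: eq_bigr => i _.
  by rewrite mulr_sumr; apply: eq_bigr => j _; rewrite expr2.
apply: second_difference_line => // s ds; rewrite Dhh.
rewrite (le_trans (ler_norm_sum _ _ _)) // ler_sum // => i _.
rewrite (le_trans (ler_norm_sum _ _ _)) // ler_sum // => j _.
rewrite !normrM ler_pM ?mulr_ge0 // ?ler_pM //.
apply: (hB _ _ t) => //; rewrite addrC addKr normrZ.
have s1 : `|s| <= 1 by move/tdomP : ds; rewrite ler_norml.
have : `|s| * `|h| <= `|h| by rewrite ler_piMl.
have : eps * S <= d / 2 by rewrite ler_pdivlMr //; nra.
by move: d0 hh; lra.
Qed.

End DirectionalDerivatives.

(** * The control as a function of the path *)

Section Rows.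
Variables (R : realType) (q : nat).
Local Notation V := 'rV[R]_q.+1.

Lemma cont_comp (W : topologicalType) (z : R -> W) (f : W -> R) :
  {within tdom, continuous z} -> continuous f -> cont (f \o z).
Proof.
move=> /subspace_continuousP cz cf; apply/subspace_continuousP => t dt.
by apply: cvg_comp; [exact: cz|exact: cf].
Qed.

Lemma cont_coord (z : R -> V) i : {within tdom, continuous z} -> cont (fun t => z t 0 i).
Proof. move=> cz; apply: (cont_comp cz (f := fun v : V => v 0 i)); exact: coord_continuous. Qed.

Lemma cont_row (z : R -> V) : (forall i, cont (fun t => z t 0 i)) ->
  {within tdom, continuous z}.
Proof.
move=> cz; have -> : z = fun t => \sum_i z t 0 i *: delta_mx 0 i.
  by apply/funext => t; exact: row_sum_delta.
have H (r : seq 'I_q.+1) :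
    {within tdom, continuous (fun t => \sum_(i <- r) z t 0 i *: (delta_mx 0 i : V))}.
  elim: r => [|i r ih].
    have -> : (fun t => \sum_(i <- [::]) z t 0 i *: (delta_mx 0 i : V)) = fun=> 0.
      by apply/funext => t; rewrite big_nil.
    by apply/subspace_continuousP => t _; exact: cvg_cst.
  have -> : (fun t => \sum_(i <- i :: r) z t 0 i *: (delta_mx 0 i : V)) =
      (fun t => z t 0 i *: (delta_mx 0 i : V) + \sum_(i <- r) z t 0 i *: (delta_mx 0 i : V)).
    by apply/funext => t; rewrite big_cons.
  apply/subspace_continuousP => t dt; apply: cvgD.
    by apply: cvgZl; move: (cz i) => /subspace_continuousP; exact.
  by move/subspace_continuousP : ih; exact.
exact: H.
Qed.

Lemma row_norm_le (v : V) (eps : R) : 0 <= eps -> (forall i, `|v 0 i| <= eps) -> `|v| <= eps.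
Proof.
move=> e0 h; rewrite -[`|v|]/(mx_norm v) mx_normrE; apply: bigmax_le => // -[i j] _ /=.
by rewrite ord1.
Qed.

Lemma lipschitz_bound (W : normedModType R) (f : W -> R) : lipschitz f ->
  exists2 L : R, 0 <= L & forall v w, `|f v - f w| <= L * `|v - w|.
Proof.
move=> [M [Mr h]]; exists (`|M| + 1); first by rewrite addr_ge0.
move=> v w; apply: (h _ _ (v, w)) => //=.
by rewrite (le_lt_trans (ler_norm M)) // ltrDl.
Qed.

Lemma cont_pair (z : R -> V) (w : R -> R) : {within tdom, continuous z} -> cont w ->
  {within tdom, continuous (fun t => (z t, w t))}.
Proof.
move=> /subspace_continuousP cz /subspace_continuousP cw; apply/subspace_continuousP => t dt.
exact: (cvg_pair (cz t dt) (cw t dt)).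
Qed.

End Rows.

(** The control for which the last equation of motion holds at the state [v], with [a] as
    the derivative of the last component. *)
Definition steering (R : realType) q (P : problemB R q) (v : 'rV[R]_q.+1) (a : R) : R :=
  (a - drift P v) / gain P v.

Section Steering.
Variables (R : realType) (q : nat) (P : problemB R q).
Local Notation V := 'rV[R]_q.+1.
Local Notation e := (fun i : 'I_q.+1 => delta_mx 0 i : V).
Local Notation f := (drift P).
Local Notation g := (gain P).
Local Notation F := (runcost P).
Local Notation U := (steering P).
Hypothesis wf : problemB_wf P.
Implicit Types (t eps a b : R) (v : V).

Lemma steeringE v a : f v + g v * U v a = a.
Proof. by have [_ _ _ _ g0] := wf; rewrite /steering mulrC divfK // subrKC. Qed.

Lemma steering_unique v a b : f v + g v * b = a -> b = U v a.
Proof. by have [_ _ _ _ g0] := wf; move=> <-; rewrite /steering addrC addKr mulrAC divff // mul1r. Qed.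

Lemma cont_steering (x : R -> V) (w : R -> R) : continuous f -> continuous g ->
  {within tdom, continuous x} -> cont w -> cont (fun t => U (x t) (w t)).
Proof.
move=> cf cg cx cw; have [_ _ _ _ g0] := wf.
apply: contM; first by apply: contB => //; exact: cont_comp cf.
by apply: contV => //; exact: cont_comp cg.
Qed.

Section Perturbation.
Variables (x : R -> V) (w : R -> R).
Hypothesis Cf : Ck 2 f.
Hypothesis Cg : Ck 2 g.
Hypothesis CF : Ck 2 F.
Hypothesis cx : {within tdom, continuous x}.
Hypothesis cw : cont w.

Lemma gain_away_from0 : exists2 c : R, 0 < c & forall t, tdom t -> c <= `|g (x t)|.
Proof.
have [_ _ _ _ g0] := wf; have [cg _] := Cg.
have [B B0 hB] := cont_bounded (contV (cont_comp cx cg) (fun t _ => g0 (x t))).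
exists B^-1; first by rewrite invr_gt0.
move=> t dt; have := hB t dt; rewrite normfV /= => h.
by rewrite -[X in _ <= X]invrK lef_pV2 // posrE ?invr_gt0 ?normr_gt0.
Qed.

Lemma second_difference_row (h : V -> R) : Ck 2 h ->
  exists d : R, 0 < d /\ exists2 C : R, 0 <= C & forall t eps v, tdom t -> 0 <= eps <= d ->
    (forall i, `|v 0 i| <= eps) -> `|h (x t + v) + h (x t - v) - 2 * h (x t)| <= C * eps ^+ 2.
Proof.
move=> Ch; have [d [d0 [C C0 H]]] := second_difference e Ch cx.
exists d; split=> //; exists C => // t eps v dt he hv.
by rewrite [v]row_sum_delta; exact: H.
Qed.

(** The basis of the product space is indexed by a sum type, the added element standing for the
    control. *)
Lemma second_difference_pair (z : R -> R) : cont z ->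
  exists d : R, 0 < d /\ exists2 C : R, 0 <= C & forall t eps v b, tdom t -> 0 <= eps <= d ->
    (forall i, `|v 0 i| <= eps) -> `|b| <= eps ->
    `|F (x t + v, z t + b) + F (x t - v, z t - b) - 2 * F (x t, z t)| <= C * eps ^+ 2.
Proof.
move=> cz.
pose ee (i : 'I_q.+1 + unit) : V * R := if i is inl i then (e i, 0) else (0, 1).
have [d [d0 [C C0 H]]] := second_difference ee CF (cont_pair cx cz).
exists d; split=> //; exists C => // t eps v b dt he hv hb.
pose c (i : 'I_q.+1 + unit) : R := if i is inl i then v 0 i else b.
have := H t eps c dt he.
have -> : \sum_i c i *: ee i = (v, b).
  rewrite big_sumType /= [X in _ + X](big_pred1 tt) /=; last by case.
  have -> : \sum_i v 0 i *: ((e i, 0) : V * R) = (v, 0).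
    rewrite [in RHS](row_sum_delta v); apply: (big_ind2 (fun (a : V * R) (b : V) => a = (b, 0))) => //.
      by move=> _ a _ a' -> ->; rewrite -[LHS]/(a + a', 0 + 0) addr0.
    by move=> i _; rewrite -[LHS]/(_ *: _, _ *: _) scaler0.
  rewrite -[b *: _]/(b *: 0, b *: 1) -[LHS]/(_ + _, _ + _) scaler0 add0r.
  by rewrite -[b *: 1]/(b * 1) mulr1 addr0.
by move=> /(_ _)/=; apply; case.
Qed.

(** To first order the control moves as little as the path. *)
Lemma steering_lipschitz : exists d : R, 0 < d /\ exists2 C : R, 0 <= C &
  forall t eps v a, tdom t -> 0 <= eps <= d -> (forall i, `|v 0 i| <= eps) -> `|a| <= eps ->
    `|U (x t + v) (w t + a) - U (x t) (w t)| <= C * eps.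
Proof.
have [_ _ /lipschitz_bound[Lf Lf0 hf] /lipschitz_bound[Lg Lg0 hg] g0] := wf.
have [c c0 hc] := gain_away_from0.
have [cf _] := Cf; have [cg _] := Cg.
have [B B0 hB] := cont_bounded (cont_steering cf cg cx cw).
exists (c / 2 / (Lg + 1)); split; first by rewrite !divr_gt0 // ltr_wpDl.
exists ((1 + Lf + Lg * B) / (c / 2)).
  by rewrite divr_ge0 ?addr_ge0 ?mulr_ge0 // ?ltW // divr_gt0.
move=> t eps v a dt /andP[e0 he] hv ha.
have nv : `|v| <= eps by exact: row_norm_le.
have g1 : `|g (x t + v) - g (x t)| <= Lg * eps.
  by apply: le_trans (hg _ _) _; rewrite addrC addKr ler_wpM2l.
have f1 : `|f (x t + v) - f (x t)| <= Lf * eps.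
  by apply: le_trans (hf _ _) _; rewrite addrC addKr ler_wpM2l.
have gv : c / 2 <= `|g (x t + v)|.
  have := hc t dt; move: he; rewrite ler_pdivlMr ?ltr_wpDl // => he.
  have := ler_normB (g (x t + v)) (g (x t + v) - g (x t)); rewrite opprB addrC subrK.
  by move: g1 he e0; nra.
rewrite [X in _ <= X]mulrAC ler_pdivlMr ?divr_gt0 //.
apply: (@le_trans _ _ (`|U (x t + v) (w t + a) - U (x t) (w t)| * `|g (x t + v)|)).
  by rewrite ler_wpM2l.
have E1 := steeringE (x t + v) (w t + a); have E2 := steeringE (x t) (w t).
rewrite -normrM.
have -> : (U (x t + v) (w t + a) - U (x t) (w t)) * g (x t + v) =
   a - (f (x t + v) - f (x t)) - (g (x t + v) - g (x t)) * U (x t) (w t).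
  by rewrite mulrBl [U _ _ * _]mulrC; move: E1 E2; lra.
apply: le_trans (ler_normB _ _) _; apply: le_trans (lerD (ler_normB _ _) (lexx _)) _.
rewrite !mulrDl mul1r; apply: lerD; first exact: lerD.
by rewrite -mulrDl normrM mulrAC ler_pM // hB.
Qed.

(** The control is not an affine function of the path. But the equations of motion for the two
    perturbed controls add up to twice those for the unperturbed one up to second order, so
    the mean of the two controls is off by a second order term only, whose effect on the
    running cost is of second order as it is Lipschitz. *)
Lemma runcost_second_difference : exists d : R, 0 < d /\ exists2 C : R, 0 <= C &
  forall t eps v a, tdom t -> 0 <= eps <= d -> (forall i, `|v 0 i| <= eps) -> `|a| <= eps ->
    F (x t + v, U (x t + v) (w t + a)) + F (x t - v, U (x t - v) (w t - a))
      - 2 * F (x t, U (x t) (w t)) <= C * eps ^+ 2.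
Proof.
have [/lipschitz_bound[LF LF0 hF] _ _ /lipschitz_bound[Lg Lg0 hg] g0] := wf.
have [c c0 hc] := gain_away_from0.
have [cf _] := Cf; have [cg _] := Cg.
have cu := cont_steering cf cg cx cw.
have [B B0 hB] := cont_bounded cu.
have [d1 [d10 [Cu Cu0 hu]]] := steering_lipschitz.
have [d2 [d20 [C2 C20 h2]]] := second_difference_row Cf.
have [d3 [d30 [C3 C30 h3]]] := second_difference_row Cg.
have [d4 [d40 [C4 C40 h4]]] := second_difference_pair cu.
pose k := 1 + Cu; have k1 : 1 <= k by rewrite lerDl.
have k0 : 0 < k by lra.
pose M := (C2 + B * C3 + 2 * Lg * Cu) / c.
have M0 : 0 <= M by rewrite divr_ge0 ?addr_ge0 ?mulr_ge0 // ltW.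
exists (Num.min (Num.min d1 d2) (Num.min d3 (d4 / k))).
split; first by rewrite !lt_min d10 d20 d30 divr_gt0.
exists (LF * M + C4 * k ^+ 2); first by rewrite addr_ge0 // mulr_ge0 // sqr_ge0.
move=> t eps v a dt /andP[e0]; rewrite !le_min => /andP[/andP[e1 e2] /andP[e3]].
rewrite ler_pdivlMr // => e4 hv ha.
have i1 : 0 <= eps <= d1 by rewrite e0.
have i2 : 0 <= eps <= d2 by rewrite e0.
have i3 : 0 <= eps <= d3 by rewrite e0.
have i4 : 0 <= eps * k <= d4 by rewrite e4 mulr_ge0 // ltW.
have hv' i : `|(- v) 0 i| <= eps by rewrite mxE normrN.
have ha' : `|- a| <= eps by rewrite normrN.
have nv : `|v| <= eps by exact: row_norm_le.
set up := U (x t + v) (w t + a); set um := U (x t - v) (w t - a); set u0 := U (x t) (w t).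
have bp : `|up - u0| <= Cu * eps by exact: hu.
have bm : `|um - u0| <= Cu * eps by exact: hu.
have gp : `|g (x t + v) - g (x t)| <= Lg * eps.
  by apply: le_trans (hg _ _) _; rewrite addrC addKr ler_wpM2l.
have gm : `|g (x t - v) - g (x t)| <= Lg * eps.
  by apply: le_trans (hg _ _) _; rewrite addrC addKr normrN ler_wpM2l.
have sf := h2 t eps v dt i2 hv; have sg := h3 t eps v dt i3 hv.
have E1 := steeringE (x t + v) (w t + a); have E2 := steeringE (x t - v) (w t - a).
have E3 := steeringE (x t) (w t).
have motion (f1 f2 f3 g1 g2 g3 b1 b2 b3 w0 a0 : R) : f1 + g1 * b1 = w0 + a0 ->
    f2 + g2 * b2 = w0 - a0 -> f3 + g3 * b3 = w0 ->
    (b1 + b2 - 2 * b3) * g3 = - (f1 + f2 - 2 * f3) - b3 * (g1 + g2 - 2 * g3)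
      - ((g1 - g3) * (b1 - b3) + (g2 - g3) * (b2 - b3)) by clear; lra.
have mid : `|up + um - 2 * u0| <= M * eps ^+ 2.
  rewrite mulrAC ler_pdivlMr //.
  apply: (@le_trans _ _ (`|up + um - 2 * u0| * `|g (x t)|)); first by rewrite ler_wpM2l // hc.
  rewrite -normrM.
  have -> : (up + um - 2 * u0) * g (x t) = - (f (x t + v) + f (x t - v) - 2 * f (x t))
     - u0 * (g (x t + v) + g (x t - v) - 2 * g (x t))
     - ((g (x t + v) - g (x t)) * (up - u0) + (g (x t - v) - g (x t)) * (um - u0)).
    exact: motion E1 E2 E3.
  apply: le_trans (ler_normB _ _) _; apply: le_trans (lerD (ler_normB _ _) (ler_normD _ _)) _.
  rewrite normrN (normrM u0) (normrM (g (x t + v) - g (x t))) (normrM (g (x t - v) - g (x t))).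
  have h1 : `|u0| <= B by exact: hB.
  have q1 : `|u0| * `|g (x t + v) + g (x t - v) - 2 * g (x t)| <= B * (C3 * (eps * eps)).
    by rewrite ler_pM // -expr2.
  have q2 : `|g (x t + v) - g (x t)| * `|up - u0| <= (Lg * eps) * (Cu * eps) by rewrite ler_pM.
  have q3 : `|g (x t - v) - g (x t)| * `|um - u0| <= (Lg * eps) * (Cu * eps) by rewrite ler_pM.
  have -> : (C2 + B * C3 + 2 * Lg * Cu) * eps ^+ 2 = C2 * eps ^+ 2 + B * (C3 * (eps * eps)) +
    (Lg * eps * (Cu * eps) + Lg * eps * (Cu * eps)) by ring.
  by apply: lerD; apply: lerD.
set b := (up - um) / 2.
have bb : `|b| <= eps * k.
  have -> : b = ((up - u0) - (um - u0)) / 2 by rewrite /b; congr (_ / _); ring.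
  rewrite normrM [`|2^-1|]ger0_norm ?invr_ge0 //.
  rewrite ler_pdivrMr // (le_trans (ler_normB _ _)) // (le_trans (lerD bp bm)) //.
  by rewrite /k -mulr2n -[_ *+ 2]mulr_natr ler_wpM2r // mulrC ler_wpM2l // lerDr.
have hv4 i : `|v 0 i| <= eps * k.
  by apply: le_trans (hv i) _; rewrite ler_peMr.
have S4 := h4 t (eps * k) v b dt i4 hv4 bb.
have shift (y : V) (s s' : R) : s - s' = (up + um - 2 * u0) / 2 ->
    F (y, s) - F (y, s') <= LF * M * eps ^+ 2 / 2.
  move=> ss; apply: le_trans (ler_norm _) _; apply: le_trans (hF _ _) _.
  rewrite -[(y, s) - _]/(y - y, s - s') subrr ss prod_normE /= normr0.
  rewrite (max_idPr _) // normrM [`|2^-1|]ger0_norm ?invr_ge0 // mulrA ler_wpM2r ?invr_ge0 //.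
  by rewrite -mulrA ler_wpM2l.
have S1 : F (x t + v, up) - F (x t + v, u0 + b) <= LF * M * eps ^+ 2 / 2.
  by apply: shift; rewrite /b; field.
have S2 : F (x t - v, um) - F (x t - v, u0 - b) <= LF * M * eps ^+ 2 / 2.
  by apply: shift; rewrite /b; field.
have S3 := ler_norm (F (x t + v, u0 + b) + F (x t - v, u0 - b) - 2 * F (x t, u0)).
have -> : (LF * M + C4 * k ^+ 2) * eps ^+ 2 = LF * M * eps ^+ 2 + C4 * (eps * k) ^+ 2 by ring.
rewrite [X in _ <= X + _]splitr; apply: le_trans _ (lerD (lerD S1 S2) (le_trans S3 S4)).
by rewrite le_eqVlt; apply/orP; left; apply/eqP; ring.
Qed.

End Perturbation.
End Steering.

(** * Trajectories and their interpolation *)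

Section Trajectories.
Variables (R : realType) (q : nat) (P : problemB R q).
Local Notation V := 'rV[R]_q.+1.
Local Notation f := (drift P).
Local Notation g := (gain P).
Local Notation F := (runcost P).
Local Notation U := (steering P).
Local Notation mu := (@lebesgue_measure R).
Implicit Types (x : R -> V) (u w : R -> R) (t : R).

(** A strong solution of the equations of motion, up to the choice of the control. *)
Definition trajectory x w : Prop :=
  [/\ forall i j : 'I_q.+1, j = i.+1 :> nat ->
        strong_derivative (fun t => x t 0 i) (fun t => x t 0 j),
      strong_derivative (fun t => x t 0 ord_max) w & cont w].

Lemma trajectory_cont x w : trajectory x w -> {within tdom, continuous x}.
Proof.
move=> [xx xw _]; apply: cont_row => i; have [iq|qi] := ltnP i q.
  have iq' : (i.+1 < q.+1)%N by [].
  by apply: strong_derivative_cont (xx i (Ordinal iq') _).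
rewrite (_ : i = ord_max); last by apply/val_inj/eqP; rewrite /= eqn_leq qi -ltnS ltn_ord.
exact: strong_derivative_cont xw.
Qed.

Hypothesis wf : problemB_wf P.
Hypothesis cf : continuous f.
Hypothesis cg : continuous g.

Lemma trajectory_admissible x w : trajectory x w -> x (-1) = init P ->
  admissible P x (fun t => U (x t) (w t)).
Proof.
move=> tr x1; have cx := trajectory_cont tr; have [xx xw cw] := tr; split=> //.
- by apply: cont_integrable; exact: cont_steering.
- by move=> i j ij; apply: strong_weak_derivative; [exact: xx|exact: cont_coord].
rewrite (_ : (fun t => _ + _) = w); first exact: strong_weak_derivative.
by apply/funext => t; rewrite steeringE.
Qed.

(** Between continuous functions weak derivatives are strong ones. In the last equation, the
    weak derivative may fail to be continuous, but it is unique almost everywhere. *)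
Lemma admissible_trajectory x u w : admissible P x u ->
  strong_derivative (fun t => x t 0 ord_max) w -> cont w ->
  trajectory x w /\ {ae mu, forall t, tdom t -> u t = U (x t) (w t)}.
Proof.
move=> [cx _ xx xu _] xw cw; split.
  split=> // i j ij; apply: weak_strong_derivative (xx i j ij); exact: cont_coord.
have := weak_derivative_unique xu (strong_weak_derivative xw cw).
apply: (@filterS _ _ (ae_filter_ringOfSetsType mu)) => t H dt.
by apply: (steering_unique wf); exact: H.
Qed.

Lemma eq_cost x u u' : {ae mu, forall t, tdom t -> u t = u' t} -> cost P x u = cost P x u'.
Proof.
move=> uu; rewrite /cost /Rintegral; congr (fine _ + _).
apply: ae_eq_integral_nonmeasurable; move: uu.
apply: (@filterS _ _ (ae_filter_ringOfSetsType mu)) => t H dt.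
by rewrite H.
Qed.

Section Polynomials.
Variable (N : nat).
Hypothesis N_gt0 : (0 < N)%N.
Implicit Types (p : 'I_q.+1 -> {poly R}) (X : 'M[R]_(N.+1, q.+1)).

Definition poly_state p t : V := \row_i (p i).[t].
Definition nodal_mx p : 'M[R]_(N.+1, q.+1) := \matrix_(k, i) (p i).[node R k].
Definition poly_chain p := forall i j : 'I_q.+1, j = i.+1 :> nat -> (p i)^`() = p j.

Lemma col_nodal_mx p i : col i (nodal_mx p) = nodal N (p i).
Proof. by apply/colP => k; rewrite !mxE. Qed.

Lemma poly_trajectory p : poly_chain p ->
  trajectory (poly_state p) (horner (p ord_max)^`()).
Proof.
move=> hp; split; last exact: cont_poly.
- move=> i j ij; rewrite (_ : (fun t => _) = horner (p i)); last first.
    by apply/funext => t; rewrite mxE.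
  rewrite (_ : (fun t => _) = horner (p i)^`()); first exact: strong_derivative_poly.
  by apply/funext => t; rewrite mxE -(hp _ _ ij).
rewrite (_ : (fun t => _) = horner (p ord_max)); first exact: strong_derivative_poly.
by apply/funext => t; rewrite mxE.
Qed.

Lemma interp_cost_nodal p : (forall i, (size (p i) <= N.+1)%N) ->
  interp_cost P (nodal_mx p) =
  cost P (poly_state p) (fun t => U (poly_state p t) (p ord_max)^`().[t]).
Proof.
move=> sp; have e : interp_state (nodal_mx p) = poly_state p.
  by apply/funext => t; apply/rowP => i; rewrite !mxE col_nodal_mx interp_nodal.
rewrite /interp_cost e; congr (cost _ _ _); apply/funext => t.
by rewrite /interp_control e col_nodal_mx interp_nodal.
Qed.

(** The nodal differential equations are equations between polynomials of degree at most
    [N], so they hold between the nodes too. *)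
Lemma feasible_trajectory m1 b X (Uk : 'cV[R]_N.+1) : feasibleBN P m1 b X Uk ->
  trajectory (interp_state X) (horner (interp (col ord_max X))^`()) /\
  interp_state X (-1) = init P.
Proof.
move=> [[dX _] X0 _ _ _].
pose p i := interp (col i X).
have [sp np] : (forall i, (size (p i) <= N.+1)%N) /\ forall i k, (p i).[node R k] = X k i.
  by split=> i; have [s n] := interpP N_gt0 (col i X) => // k; rewrite n mxE.
split.
  apply: poly_trajectory => i j ij; apply/eqP; rewrite -subr_eq0; apply/eqP.
  apply: (poly_nodes_eq0 N_gt0).
    rewrite (leq_trans (size_polyD _ _)) // geq_max size_polyN sp andbT.
    rewrite (leq_trans (size_poly _ _)) // (leq_trans (leq_pred _)) //; exact: sp.
  move=> k; have := congr1 (fun c : 'cV[R]_N.+1 => c k 0) (diffmx_nodal N_gt0 (sp i)).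
  by rewrite (nodal_interp N_gt0) (dX _ _ ij) !mxE => h; rewrite hornerD hornerN -h np subrr.
rewrite -X0; apply/rowP => i; rewrite !mxE -(@node0 R N); exact: np.
Qed.

Lemma nodal_feasible m1 b p (B : R) :
  (forall i, (size (p i) <= N.+1)%N) -> poly_chain p -> poly_state p (-1) = init P ->
  (forall i, blo b 0 i <= - B) -> (forall i, B <= bhi b 0 i) ->
  (forall t i, tdom t -> `|(p i).[t]| <= B) ->
  (forall t, tdom t -> `|U (poly_state p t) (p ord_max)^`().[t]| <= B) ->
  (forall j, (1 <= j <= m1 - 1)%N -> dlo b j <= (p ord_max)^`(j).[-1] <= dhi b j) ->
  \sum_(0 <= n < (N - q.+1 - m1 + 1).+1) `|spectral_coef m1 n (nodal N (p ord_max))| <= dsum b ->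
  feasibleBN P m1 b (nodal_mx p)
    (\col_k U (poly_state p (node R k)) (p ord_max)^`().[node R k]).
Proof.
move=> sp hp p0 blo_b bhi_b pB uB hd hs.
have rp k : row k (nodal_mx p) = poly_state p (node R k) by apply/rowP => i; rewrite !mxE.
have dn (k : 'I_N.+1) : tdom (node R k) by apply/tdomP; exact: node_itv.
split.
- split=> [i j ij|k]; rewrite !col_nodal_mx (diffmx_nodal N_gt0) ?sp //.
    by rewrite (hp _ _ ij).
  by rewrite !mxE rp steeringE.
- by rewrite rp node0.
- move=> k i; apply/andP; have : `|row_mx (nodal_mx p)
      (\col_k U (poly_state p (node R k)) (p ord_max)^`().[node R k]) k i| <= B.
    by case: (split_ordP i) => i' ->; rewrite ?row_mxEl ?row_mxEr mxE; [exact: pB|exact: uB].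
  rewrite ler_norml => /andP[h1 h2]; split; first exact: le_trans h1.
  exact: le_trans h2 _.
- by move=> j hj; rewrite col_nodal_mx (diffmx_exp_nodal N_gt0) // mxE node0; exact: hd.
- by rewrite col_nodal_mx.
Qed.

End Polynomials.

End Trajectories.

Section Approximation.
Variables (R : realType) (q : nat) (x : R -> 'rV[R]_q.+1) (xr : nat -> R -> R) (m m1 : nat).
Hypothesis tr : trajectory x (xr 1).
Hypothesis dxr : forall j, (1 <= j < m)%N -> strong_derivative (xr j) (xr j.+1).
Hypothesis bv : bounded_variation (-1) 1 (xr m).
Hypothesis m1_itv : (1 <= m1 < m)%N.

(** The chain of primitives leading from the [m1]-th derivative of the last component, which
    is expanded in Legendre polynomials, to the first component. *)
Let Y (j : nat) : R -> R :=
  if (j < m1)%N then xr (m1 - j) else fun t => x t 0 (inord (q - (j - m1))).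

Let cxr j : (1 <= j < m)%N -> cont (xr j).
Proof. by move=> hj; exact: strong_derivative_cont (dxr hj). Qed.

Let dY j : (j < m1 + q)%N -> strong_derivative (Y j.+1) (Y j).
Proof.
have [xx xw _] := tr; move=> jq; rewrite /Y.
have [h|h] := ltnP j.+1 m1.
  rewrite (ltnW h) (_ : (m1 - j = (m1 - j.+1).+1)%N); last by lia.
  by apply: dxr; lia.
have [h'|h'] := ltnP j m1.
  rewrite (_ : (m1 - j = 1)%N); last by lia.
  rewrite (_ : inord _ = ord_max) //; apply: val_inj; rewrite /= inordK; lia.
by apply: xx; rewrite !inordK; lia.
Qed.

Let Y_state (i : 'I_q.+1) : Y (m1 + (q - i)) = fun t => x t 0 i.
Proof.
rewrite /Y ltnNge leq_addr /=; apply/funext => t; congr (x t 0 _); apply: val_inj.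
by rewrite /= inordK; have := ltn_ord i; lia.
Qed.

Let Y_derivative j : (1 <= j <= m1)%N -> Y (m1 - j) = xr j.
Proof. by move=> hj; rewrite /Y ifT; [congr xr; lia|lia]. Qed.

(** The competitors. The derivatives of the last component of order less than [m1] have exact
    values at -1 because every primitive is taken with the right initial value, and the first
    [K + 1] Legendre coefficients of the [m1]-th one are exact because it is a truncated
    expansion. *)
Lemma approximating_polynomials : exists (A C : R) (eps : nat -> R) (N0 : nat),
  [/\ forall d : R, 0 < d -> exists N1, forall N, (N1 <= N)%N -> 0 <= eps N <= d,
      forall N, (q.+1 + m1 + 1 < N)%N ->
        eps N ^+ 2 <= C / (N - q.+1 - m1 - 1)%N%:R ^+ (2 * m - 2 * m1 - 1) &
      forall N, (N0 <= N)%N -> exists p : 'I_q.+1 -> {poly R},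
      [/\ (forall i, (size (p i) <= N.+1)%N) /\ poly_chain p,
          poly_state p (-1) = x (-1) /\ poly_state p 1 = x 1,
          (forall t i, tdom t -> `|(p i).[t] - x t 0 i| <= eps N) /\
          (forall t, tdom t -> `|(p ord_max)^`().[t] - xr 1 t| <= eps N),
          forall j, (1 <= j <= m1 - 1)%N -> (p ord_max)^`(j).[-1] = xr j (-1) &
          \sum_(0 <= n < (N - q.+1 - m1 + 1).+1) `|spectral_coef m1 n (nodal N (p ord_max))|
            <= A]].
Proof.
have [m1p m1m] : (1 <= m1)%N /\ (m1 < m)%N by lia.
pose s := (m - m1 - 1)%N; have sm : (m1 + s.+1 = m)%N by rewrite /s; lia.
pose ys j := xr (m1 + j)%N.
have dys j : (j <= s)%N -> strong_derivative (ys j) (ys j.+1).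
  by move=> js; rewrite /ys addnS; apply: dxr; lia.
have [T hT] := bounded_variation_tv_dominated bv.
have hT' : tv_dominated (ys s.+1) T by rewrite /ys sm.
have [C0 C00 [n0 hC0]] := moment_decay dys hT'.
have Y0 : Y 0 = ys 0%N by rewrite /Y /ys m1p subn0 addn0.
have cY0 : cont (Y 0) by rewrite Y0 /ys addn0; apply: cxr; rewrite m1p.
rewrite -Y0 in hC0.
have [A hA] := legendre_coef_summable C00 hC0.
pose J := (m1 + q)%N; pose k N := (N - q.+1 - m1 - 1)%N.
pose eps N : R := 2 ^+ J * tail_bound C0 s (k N).
have e0 N : 0 <= eps N.
  by rewrite !mulr_ge0 ?invr_ge0 ?mulr_ge0 ?sqrtr_ge0 ?exprn_ge0.
exists A, ((2 ^+ J * (4 * C0)) ^+ 2), eps, (q.+1 + m1 + 1 + n0 + J).+1; split.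
- move=> d d0.
  pose c := 2 ^+ J * (4 * C0) / d; have c0 : 0 <= c by rewrite !mulr_ge0 ?invr_ge0 // ltW.
  exists ((Num.trunc (c ^+ 2)).+1 + q.+1 + m1 + 1)%N => N hN.
  rewrite e0 /=.
  have kN : c ^+ 2 <= (k N)%:R.
    apply/ltW/(lt_le_trans (truncnS_gt _)); rewrite ler_nat.
    by move: (Num.trunc _) hN => z; rewrite /k; lia.
  have k0 : (0 < k N)%N by rewrite /k; lia.
  have ck : c <= Num.sqrt (k N)%:R by rewrite -[c]ger0_norm // -sqrtr_sqr ler_wsqrtr.
  have k0' : 0 < (k N)%:R :> R by rewrite ltr0n.
  rewrite /eps /tail_bound mulrA ler_pdivrMr ?mulr_gt0 ?exprn_gt0 ?sqrtr_gt0 //.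
  apply: (@le_trans _ _ (d * Num.sqrt (k N)%:R)).
    by rewrite [d * _]mulrC -ler_pdivrMr.
  rewrite ler_wpM2l ?(ltW d0) // ler_peMl ?sqrtr_ge0 // exprn_ege1 // ler1n //.
- move=> N hN; have k0 : (0 < k N)%N by rewrite /k; lia.
  rewrite /eps /tail_bound mulrA expr_div_n -/(k N) [(_ ^+ s * _) ^+ 2]exprMn sqr_sqrtr // -exprM.
  by rewrite (_ : (2 * m - 2 * m1 - 1 = (s * 2).+1)%N) ?exprSr //; rewrite /s; lia.
move=> N hN; pose K := (N - q.+1 - m1 + 1)%N.
have JK : (J <= K.+1)%N by rewrite /J /K; lia.
pose p (i : 'I_q.+1) := approximant Y K (m1 + (q - i)).
have err j t : (j <= J)%N -> tdom t -> `|(approximant Y K j).[t] - Y j t| <= eps N.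
  move=> jJ dt; apply: (@le_trans _ _ (2 ^+ j * tail_bound C0 s K)).
    apply: (approximant_error dY) => // u du.
    by apply: (legendre_sum_approx cY0 C00 hC0) => //; rewrite /K; lia.
  rewrite /eps ler_pM ?exprn_ge0 ?ler_weXn2l ?ler1n //.
    by rewrite mulr_ge0 ?mulr_ge0 ?invr_ge0 ?mulr_ge0 ?sqrtr_ge0 ?exprn_ge0.
  have k0 : 0 < (k N)%:R :> R by rewrite ltr0n /k; lia.
  have kK : (k N)%:R <= K%:R :> R by rewrite ler_nat /k /K; lia.
  have K0 := lt_le_trans k0 kK.
  rewrite /tail_bound ler_wpM2l ?mulr_ge0 // lef_pV2 ?posrE ?mulr_gt0 ?exprn_gt0 ?sqrtr_gt0 //.
  by rewrite ler_pM ?exprn_ge0 ?sqrtr_ge0 ?ler_wsqrtr // lerXn2r ?nnegrE.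
have sp i : (size (p i) <= N.+1)%N.
  by apply: leq_trans (size_approximant _ _ _) _; have := ltn_ord i; rewrite /K; lia.
have iJ (i : 'I_q.+1) : (m1 + (q - i) <= J)%N by rewrite leq_add2l leq_subr.
have pmax : p ord_max = approximant Y K m1 by rewrite /p subnn addn0.
have dpmax j : (j <= m1)%N -> (p ord_max)^`(j) = approximant Y K (m1 - j).
  by move=> jm; rewrite pmax -{1}(subnKC jm) derivn_approximant.
exists p; split.
- split=> // i j ij; rewrite /p.
  have -> : (m1 + (q - i) = (m1 + (q - j)).+1)%N by have := ltn_ord j; lia.
  exact: deriv_approximant.
- split; apply/rowP => i; rewrite mxE -[RHS](congr1 (fun y => y _) (Y_state i)).
    by rewrite /p; case: (m1) m1p => // n _; rewrite addSn approximant_N1.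
  have [h _] := approximant_orth cY0 dY JK (iJ i).
  by rewrite h // addn_gt0 m1p.
- split=> [t i dt|t dt].
    by rewrite -[x t 0 i](congr1 (fun y => y t) (Y_state i)); exact: err.
  have := err (m1 - 1)%N t _ dt.
  rewrite (Y_derivative (j := 1)) ?m1p // -dpmax // derivn1; apply; rewrite /J; lia.
- move=> j hj; rewrite dpmax; last by lia.
  rewrite -(Y_derivative (j := j)); last by lia.
  by rewrite (_ : (m1 - j = (m1 - j.+1).+1)%N) ?approximant_N1 //; lia.
apply: le_trans (hA K); rewrite big_mkord -/K; apply: ler_sum => n _.
have nK : (n <= K)%N by rewrite -ltnS ltn_ord.
have N0 : (0 < N)%N by lia.
rewrite spectral_coef_nodal // dpmax // subnn; last first.
  by rewrite (leq_trans (leq_add nK (size_lsum _ _))) //; rewrite /K; lia.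
by rewrite legendre_sum_coef.
Qed.

End Approximation.

(** * Comparison of the optimal costs *)

Section Comparison.
Variables (R : realType) (q : nat) (P : problemB R q).
Local Notation V := 'rV[R]_q.+1.
Local Notation f := (drift P).
Local Notation g := (gain P).
Local Notation F := (runcost P).
Local Notation U := (steering P).
Implicit Types (x y : R -> V) (w z : R -> R).
Hypothesis wf : problemB_wf P.
Hypothesis Cf : Ck 2 f.
Hypothesis Cg : Ck 2 g.
Hypothesis CF : Ck 2 F.

Lemma trajectory_reflection x w y z : trajectory x w -> trajectory y z ->
  trajectory (fun t => x t - (y t - x t)) (fun t => w t - (z t - w t)).
Proof.
move=> [xx xw cw] [yy yz cz]; split.
- move=> i j ij; have := strong_derivativeB (xx i j ij) (strong_derivativeB (yy i j ij) (xx i j ij)).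
  by apply: strong_derivative_eq => t _; rewrite !mxE.
- have := strong_derivativeB xw (strong_derivativeB yz xw).
  by apply: strong_derivative_eq => t _; rewrite ?mxE.
by apply: contB => //; exact: contB.
Qed.

Lemma cont_runcost x w : trajectory x w -> cont (fun t => F (x t, U (x t) (w t))).
Proof.
move=> tr; have cx := trajectory_cont tr; have [_ _ cw] := tr.
have [cF _] := CF; have [cf _] := Cf; have [cg _] := Cg.
exact: (cont_comp (cont_pair cx (cont_steering wf cf cg cx cw)) cF).
Qed.

(** The trajectory obtained by reflecting a competitor [y] in [x] is admissible, hence not
    cheaper than [x], and the average cost of [y] and its reflection exceeds the optimal cost by
    a second order term; so does the cost of [y]. *)
Lemma cost_perturbation x u w : optimalB P x u -> trajectory x w ->
  {ae @lebesgue_measure R, forall t, tdom t -> u t = U (x t) (w t)} ->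
  exists d : R, 0 < d /\ exists2 C : R, 0 <= C &
  forall (eps : R) y z, 0 <= eps <= d -> trajectory y z -> y (-1) = x (-1) -> y 1 = x 1 ->
    (forall t i, tdom t -> `|y t 0 i - x t 0 i| <= eps) ->
    (forall t, tdom t -> `|z t - w t| <= eps) ->
    cost P y (fun t => U (y t) (z t)) - cost P x u <= C * eps ^+ 2.
Proof.
move=> [[_ _ _ _ x0] opt] tr eu.
have cx := trajectory_cont tr; have [_ _ cw] := tr.
have [cf _] := Cf; have [cg _] := Cg.
have [d [d0 [C C0 H]]] := runcost_second_difference wf Cf Cg CF cx cw.
exists d; split=> //; exists (C * 2); first by rewrite mulr_ge0.
move=> eps y z he ytr yN1 y1 hy hz.
pose y' t := x t - (y t - x t); pose z' t := w t - (z t - w t).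
have y'tr : trajectory y' z' by exact: trajectory_reflection.
have y'N1 : y' (-1) = x (-1) by rewrite /y' yN1 subrr subr0.
have y'1 : y' 1 = x 1 by rewrite /y' y1 subrr subr0.
have : cost P x u <= cost P y' (fun t => U (y' t) (z' t)).
  by apply: opt; apply: trajectory_admissible; rewrite ?y'N1.
rewrite (eq_cost P x eu).
have := cont_runcost tr; have := cont_runcost ytr; have := cont_runcost y'tr.
rewrite /cost yN1 y1 y'N1 y'1 -!/(Int _).
set A' := fun t => F (y' t, _); set A := fun t => F (y t, _); set A0 := fun t => F (x t, _).
move=> cA' cA cA0.
have : Int (fun t => A t + A' t - 2 * A0 t) <= C * eps ^+ 2 * 2.
  rewrite -Int_cst; apply: le_Int.
  - by apply: contB; [exact: contD|apply: contM => //; exact: cont_cst].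
  - exact: cont_cst.
  move=> t dt; have := H t eps (y t - x t) (z t - w t) dt he _ (hz t dt).
  rewrite (addrC (x t) (y t - x t)) subrK (addrC (w t) (z t - w t)) subrK; apply.
  by move=> i; rewrite !mxE; exact: hy.
rewrite IntB ?IntD ?IntZ //; first by lra.
- exact: contD.
- by apply: contM => //; exact: cont_cst.
Qed.

End Comparison.

Lemma finite_bound (R : realType) (I : finType) (h : I -> R -> R) : (forall i, cont (h i)) ->
  exists2 B : R, 0 <= B & forall i t, tdom t -> `|h i t| <= B.
Proof.
move=> ch; have /choice[B hB] (i : I) : exists B : R, 0 <= B /\ forall t, tdom t -> `|h i t| <= B.
  by have [B B0 hB] := cont_bounded (ch i); exists B; split=> //; exact: ltW.
exists (\sum_i B i); first by rewrite sumr_ge0 // => i _; have [] := hB i.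
move=> i t dt; have [_ h1] := hB i; apply: le_trans (h1 t dt) _.
rewrite (bigD1 i) //= lerDl sumr_ge0 // => j _; by have [] := hB j.
Qed.

(** An asymptotic bound holds from the start once the constant is allowed to depend on the
    finitely many first terms. *)
Lemma uniform_bound (R : realType) (a c : nat -> R) (C : R) (N1 N0 : nat) : 0 <= C ->
  (forall N, (N1 <= N)%N -> 0 < c N) ->
  (forall N, (N1 <= N)%N -> (N0 <= N)%N -> `|a N| <= C / c N) ->
  exists M : R, forall N, (N1 <= N)%N -> `|a N| <= M / c N.
Proof.
move=> C0 c0 h.
exists (C + \sum_(N < N0) `|a N| * `|c N|) => N hN.
have cN := c0 N hN; rewrite ler_pdivlMr //.
have [h0|h0] := leqP N0 N.
  have := h N hN h0; rewrite ler_pdivlMr // => h1; apply: le_trans h1 _.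
  by rewrite lerDl sumr_ge0 // => i _; rewrite mulr_ge0.
rewrite (bigD1 (Ordinal h0)) //= [`|c N|]gtr0_norm // addrCA lerDl addr_ge0 //.
by rewrite sumr_ge0 // => i _; rewrite mulr_ge0.
Qed.

Unset Implicit Arguments.

Theorem theorem2 (R : realType) (q : nat) (P : problemB R q)
    (x : R -> 'rV[R]_q.+1) (u : R -> R) (xr : nat -> R -> R) (m m1 : nat) :
  problemB_wf P ->
  optimalB P x u ->
  (2 <= m)%N ->
  strong_derivatives m (fun t => x t 0 ord_max) xr ->
  bounded_variation (-1) 1 (xr m) ->
  (1 <= m1 <= m - 1)%N ->
  Ck m (drift P) -> Ck m (gain P) -> Ck m (runcost P) ->
  exists T : bounds R q,
  forall b : bounds R q, beyond m1 T b ->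
    interior_trajectory m1 b x u xr /\
    forall (N1 : nat)
      (X : forall N, 'M[R]_(N.+1, q.+1)) (U : forall N, 'cV[R]_N.+1),
      (q.+1 + m1 + 1 < N1)%N ->
      (forall N, (N1 <= N)%N -> optimalBN P m1 b (X N) (U N)) ->
      exists M1 : R, forall N, (N1 <= N)%N ->
        `|cost P x u - cost P (interp_state (X N)) (interp_control P (X N))|
        <= M1 / ((N - q.+1 - m1 - 1)%N%:R) ^+ (2 * m - 2 * m1 - 1).
Proof.
move=> wf opt m2 [xr0 dxr] bv hm1.
move=> /(Ck_le m2) Cf /(Ck_le m2) Cg /(Ck_le m2) CF.
have [cf _] := Cf; have [cg _] := Cg.
have [adm optx] := opt.
have cxr j : (j < m)%N -> cont (xr j) by move=> jm; exact: strong_derivative_cont (dxr j jm).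
have dx : strong_derivative (fun t => x t 0 ord_max) (xr 1).
  by apply: strong_derivative_eq (dxr 0 (ltnW m2)).
have [tr eu] := admissible_trajectory wf adm dx (cxr 1 m2).
have cx := trajectory_cont tr.
have cu := cont_steering wf cf cg cx (cxr 1 m2).
have m1m : (1 <= m1 < m)%N by lia.
have dxr' j : (1 <= j < m)%N -> strong_derivative (xr j) (xr j.+1).
  by move=> /andP[_]; exact: dxr.
have [A [C [eps [N0 [eps0 eps2 hp]]]]] := approximating_polynomials tr dxr' bv m1m.
have [Bx Bx0 hBx]  : exists2 B : R, 0 <= B & forall i t, tdom t -> `|x t 0 i| <= B.
  by apply: finite_bound => i; exact: cont_coord.
have [Bu Bu0 hBu] := cont_bounded cu.
have [Bd Bd0 hBd] : exists2 B : R, 0 <= B &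
    forall (j : 'I_m) t, tdom t -> `|xr j t| <= B.
  by apply: finite_bound => j; exact: cxr.
have [UU hUU] : exists B : R, forall t, tdom t -> `|xr m1.+1 t| <= B.
  have [h|h] := ltnP m1.+1 m; first by have [B _ hB] := cont_bounded (cxr _ h); exists B.
  rewrite (_ : m1.+1 = m); last by lia.
  have [T hT] := bounded_variation_tv_dominated bv.
  by have [B _ hB] := dominated_bounded hT; exists B.
have [d1 [d10 [Cu Cu0 hu]]] := steering_lipschitz wf Cf Cg cx (cxr 1 m2).
have [d2 [d20 [CJ CJ0 hJ]]] := cost_perturbation wf Cf Cg CF opt tr eu.
(* The margin 1 leaves room for the competitors, which are only close to the optimum. *)
pose B := Bx + Bu + Bd + 1.
pose S := Num.max A (6 / Num.sqrt pi
  * (UU + fine (total_variation (-1) 1 (xr m1.+1))) * zeta (3 / 2)).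
exists (Bounds (const_mx (- B)) (const_mx B) (fun=> - B) (fun=> B) S).
move=> b [/= hb hd hs].
have lob i : blo b 0 i < - B by have [] := hb i; rewrite mxE.
have hib i : B < bhi b 0 i by have [_] := hb i; rewrite mxE.
have near (a c k e : R) : `|a| <= k -> `|c - a| <= e -> `|c| <= k + e.
  by move=> h1 h2; rewrite -(subrK a c) addrC (le_trans (ler_normD _ _)) // lerD.
have inside (y lo hi : R) : lo < - B -> B < hi -> `|y| <= B -> lo < y < hi.
  move=> h1 h2; rewrite ler_norml => /andP[h3 h4].
  by rewrite (lt_le_trans h1 h3) (le_lt_trans h4 h2).
have hBd' j t : tdom t -> (1 <= j <= m1 - 1)%N -> `|xr j t| <= B.
  move=> dt hj; have jm : (j < m)%N by move: hj hm1; clear; lia.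
  apply: le_trans (hBd (Ordinal jm) t dt) _; rewrite /B.
  by move: Bx0 Bu0; clear; lra.
split.
  split.
  - move=> t i dt; apply: inside => //; apply: le_trans (hBx i t dt) _.
    by rewrite /B; move: Bu0 Bd0; clear; lra.
  - move: eu; apply: (@filterS _ _ (ae_filter_ringOfSetsType _)) => t H dt.
    rewrite (H dt); apply: inside => //; apply: le_trans (hBu t dt) _.
    by rewrite /B; move: Bx0 Bd0; clear; lra.
  - by move=> t j dt hj; have [h1 h2] := hd j hj; apply: inside => //; exact: hBd'.
  by exists UU; split=> //; apply: le_lt_trans hs; rewrite /S le_max lexx orbT.
move=> N1 X U hN1 hX.
have big N : (N1 <= N)%N -> (q.+1 + m1 + 1 < N)%N := leq_trans hN1.
(* The threshold beyond which the polynomial competitor lies within the bounds. *)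
pose d := Num.min (Num.min d1 d2) (Num.min 1 (Cu + 1)^-1).
have d0 : 0 < d by rewrite !lt_min d10 d20 ltr01 invr_gt0 ltr_wpDl.
have [N2 hN2] := eps0 d d0.
apply: (@uniform_bound _ _ _ (CJ * `|C|) N1 (maxn N0 N2)); first by rewrite mulr_ge0.
  by move=> N hN; rewrite exprn_gt0 // ltr0n; move: (big N hN); clear; lia.
move=> N hN; rewrite geq_max => /andP[hN0 /hN2]; rewrite !le_min.
move=> /andP[e0 /andP[/andP[ed1 ed2] /andP[e1 eCu]]].
have N_gt0 : (0 < N)%N by exact: leq_trans (big N hN).
have [feas optN] := hX N hN.
have lower : cost P x u <= cost P (interp_state (X N)) (interp_control P (X N)).
  apply: optx; have [trN initN] := feasible_trajectory N_gt0 feas.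
  exact: (trajectory_admissible wf cf cg trN initN).
rewrite distrC ger0_norm ?subr_ge0 //.
have [p [[sp pc] [pN1 p1] [perr derr] pd psum]] := hp N hN0.
have ptr := poly_trajectory pc.
have e01 : 0 <= eps N <= d1 by rewrite e0.
have e02 : 0 <= eps N <= d2 by rewrite e0.
have perr' t i : tdom t -> `|poly_state p t 0 i - x t 0 i| <= eps N.
  by move=> dt; rewrite mxE; exact: perr.
have upper : interp_cost P (X N) <= interp_cost P (nodal_mx N p).
  apply: optN; apply: (@nodal_feasible _ _ _ wf N N_gt0 m1 b p B) => //.
  - by rewrite pN1; have [] := adm.
  - by move=> i; apply: ltW.
  - by move=> i; apply: ltW.
  - move=> t i dt; apply: le_trans (near _ _ _ _ (hBx i t dt) (perr t i dt)) _.
    by rewrite /B; move: Bu0 Bd0 e1; clear; lra.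
  - move=> t dt; have := hu t (eps N) (poly_state p t - x t) ((p ord_max)^`().[t] - xr 1 t) dt e01.
    rewrite (addrC (x t)) subrK (addrC (xr 1 t)) subrK => /(_ _ (derr t dt)) h.
    have {}h : `|steering P (poly_state p t) (p ord_max)^`().[t] - steering P (x t) (xr 1 t)|
        <= Cu * eps N by apply: h => i; have := perr' t i dt; rewrite !mxE.
    have h1 : Cu * eps N <= 1.
      apply: (@le_trans _ _ ((Cu + 1) * eps N)); first by rewrite ler_wpM2r // lerDl.
      by rewrite mulrC -ler_pdivlMr ?mul1r // ltr_wpDl.
    apply: le_trans (near _ _ _ _ (hBu t dt) h) _.
    by rewrite /B; move: Bx0 Bd0 h1; clear; lra.
  - move=> j hj; rewrite pd //; have [h1 h2] := hd j hj.
    have /andP[h3 h4] := inside _ _ _ h1 h2 (hBd' j (-1) (tdomN1 R) hj).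
    by rewrite !ltW.
  - by apply: le_trans psum _; apply/ltW/(le_lt_trans _ hs); rewrite /S le_max lexx.
have := hJ (eps N) _ _ e02 ptr pN1 p1 perr' derr.
rewrite -(interp_cost_nodal P N_gt0 sp) => h.
apply: (@le_trans _ _ (CJ * eps N ^+ 2)).
  by apply: le_trans h; rewrite lerD2r.
rewrite -mulrA ler_wpM2l // (le_trans (eps2 _ (big N hN))) //.
rewrite ler_wpM2r ?ler_norm // invr_ge0 exprn_ge0 //.
Qed.
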